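(* Let $U\subset V=\mathbb{R}^n$ be an open subset which is star-shaped around $0$, let $S\colon U\to K(\mathfrak{g})$ be a real-analytic map, and let $\theta\in\Omega^1(U,V)$ be the real-analytic solution of the singular initial value problem $$\mathcal{L}_{\mathscr{E}}(\mathcal{L}_{\mathscr{E}}-\mathrm{id})\theta=S(\mathscr{E},\theta)\mathscr{E},\qquad \theta_0=\mathrm{id}_V,\quad (d\theta)_0=0 .$$ Suppose that $\omega:=I(S(\mathscr{E},\theta))\in\Omega^1(U,\mathfrak{g})$ satisfies the consistency relation $$d\omega+\omega\wedge\omega=S(\theta,\theta).$$ Then on a sufficiently small open neighborhood $U'\subset U$ of $0$ (star-shaped around $0$) there exists a unique torsion-free real-analytic connection $\nabla$ on $TU'$ such that for all $v\in U'$ the radial curve $\gamma_v(t):=tv$, $t\in[0,1]$, is a geodesic of $\nabla$ and $$S_v=P_{1,0}\cdot R^\nabla_{\gamma_v(1)},$$ where $P_{1,0}$ denotes the inverse of the parallel translation map $P_{\gamma_v}\colon T_0U'\to T_vU'$ of $\nabla$ along $\gamma_v$, and $R^\nabla$ denotes the curvature tensor of $\nabla$.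
   Context: $V=\mathbb{R}^n$, $G=\mathrm{GL}(V)$, $\mathfrak{g}=\mathfrak{gl}(V)$. The space of algebraic curvature tensors is $$K(\mathfrak{g})=\{R\in\textstyle\bigwedge^2V^*\otimes\mathfrak{g}\mid R(x,y)z+R(y,z)x+R(z,x)y=0\ \ \forall x,y,z\in V\}.$$ $\mathscr{E}$ is the Euler vector field on $V$, $\mathscr{E}_v=v$ (flow $v\mapsto e^tv$), and $\mathcal{L}_{\mathscr{E}}$ is the Lie derivative along it acting on vector-valued differential forms. All tangent spaces of open subsets of $V$ are identified with $V$. For $\theta\in\Omega^1(U,V)$: $S(\mathscr{E},\theta)\in\Omega^1(U,\mathfrak{g})$ is $S(\mathscr{E},\theta)_v(w)=S_v(v,\theta_v(w))$; $S(\mathscr{E},\theta)\mathscr{E}\in\Omega^1(U,V)$ is $w\mapsto S_v(v,\theta_v(w))v$ at $v$; and $S(\theta,\theta)\in\Omega^2(U,\mathfrak{g})$ is $S(\theta,\theta)_v(x,y)=S_v(\theta_v(x),\theta_v(y))$. For $\omega\in\Omega^1(U,\mathfrak{g})$, $(\omega\wedge\omega)(x,y)=[\omega(x),\omega(y)]$. The integration map $I$ on vector-valued $1$-forms on $U$ is $(I\eta)_x=\int_0^1\eta_{tx}\,dt$. The curvature is $R^\nabla(X,Y)=\nabla_X\nabla_Y-\nabla_Y\nabla_X-\nabla_{[X,Y]}$. For a linear isomorphism $P\colon T_0U'\to T_vU'$, the action of $P^{-1}$ on $R=R^\nabla_v$ is $(P^{-1}\cdot R)(x,y)=P^{-1}\circ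 R(Px,Py)\circ P$ for $x,y\in T_0U'=V$. *)

(* Defs.v *)
From HB Require Import structures.
From mathcomp Require Import all_boot all_order all_algebra.
From mathcomp Require Import all_classical all_reals all_analysis.

Set Implicit Arguments.
Unset Strict Implicit.
Unset Printing Implicit Defensive.

Import Order.TTheory GRing.Theory Num.Theory.
Import numFieldNormedType.Exports.

Local Open Scope classical_set_scope.
Local Open Scope ring_scope.

(* V = R^n is the space 'cV[R]_n of column vectors and gl(V) is 'M[R]_n, acting
   on V by *m.  Tangent spaces of open subsets of V are identified with V, so a
   vector field is a map V -> V and a W-valued 1-form is a map
   eta : V -> V -> W, with eta v w the value at the point v on the tangent
   vector w.  All these maps are total, and only their restrictions to the open
   set under consideration are meaningful. *)

Section Regularity.
Context {R : realType} {n : nat}.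
Notation V := 'cV[R]_n.

Definition star_shaped (U : set V) : Prop :=
  U 0 /\ forall (v : V) (t : R), U v -> 0 <= t <= 1 -> U (t *: v).

Definition monomial (h : V) (k : {ffun 'I_n -> nat}) : R :=
  \prod_(i < n) h i 0 ^+ k i.

(* The partial sum over the box of the multi-indices with all entries < N. *)
Definition box_sum (W : nmodType) (F : {ffun 'I_n -> nat} -> W) (N : nat) : W :=
  \sum_(k : {ffun 'I_n -> 'I_N}) F [ffun i => val (k i)].

Definition abs_summable_to (W : normedModType R)
    (F : {ffun 'I_n -> nat} -> W) (s : W) : Prop :=
  cvgn (box_sum (fun k => `|F k|)) /\ box_sum F @ \oo --> s.

(* The norm of V is the sup norm, so the conditions |h| < r below describe
   polydiscs. *)
Definition real_analytic (W : normedModType R) (U : set V) (f : V -> W) : Prop :=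
  forall a : V, U a ->
    exists (c : {ffun 'I_n -> nat} -> W) (r : R), 0 < r /\
      forall h : V, `|h| < r ->
        abs_summable_to (fun k => monomial h k *: c k) (f (a + h)).

Fixpoint Ck (W : normedModType R) (k : nat) (U : set V) (f : V -> W) : Prop :=
  if k is k'.+1 then
    (forall v : V, U v -> differentiable f v) /\
    (forall w : V, Ck k' U (fun v => 'D_w f v))
  else forall v : V, U v -> {for v, continuous f}.

Definition smooth (W : normedModType R) (U : set V) (f : V -> W) : Prop :=
  forall k : nat, Ck k U f.

End Regularity.

Section Forms.
Context {R : realType} {n : nat}.
Notation V := 'cV[R]_n.

Definition one_form (W : normedModType R) (U : set V) (eta : V -> V -> W) : Prop :=
  forall v : V, U v -> linear (eta v).

Definition real_analytic_form (W : normedModType R) (U : set V)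
    (eta : V -> V -> W) : Prop :=
  forall w : V, real_analytic U (fun v => eta v w).

Definition euler_flow (t : R) (v : V) : V := expR t *: v.

Definition pullback (W : normedModType R) (phi : V -> V) (eta : V -> V -> W) :
    V -> V -> W :=
  fun v w => eta (phi v) ('d phi v w).

Definition lie_euler (W : normedModType R) (eta : V -> V -> W) : V -> V -> W :=
  fun v w => derive1 (fun t : R => pullback (euler_flow t) eta v w) 0.

(* x and y are extended to constant vector fields, whose bracket vanishes. *)
Definition ext_d (W : normedModType R) (eta : V -> V -> W) : V -> V -> V -> W :=
  fun v x y => 'D_x (fun u => eta u y) v - 'D_y (fun u => eta u x) v.

Definition wedge_sq (omega : V -> V -> 'M[R]_n) : V -> V -> V -> 'M[R]_n :=
  fun v x y => omega v x *m omega v y - omega v y *m omega v x.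

(* The form is evaluated at t *: x on w itself, not on t *: w: no pullback is
   taken. *)
Definition integration_map (m p : nat) (eta : V -> V -> 'M[R]_(m, p)) :
    V -> V -> 'M[R]_(m, p) :=
  fun x w =>
    \matrix_(i, j) \int[lebesgue_measure]_(t in `[0, 1]) eta (t *: x) w i j.

End Forms.

Section CurvatureTensors.
Context {R : realType} {n : nat}.
Notation V := 'cV[R]_n.

Definition curvature_tensors : set (V -> V -> 'M[R]_n) :=
  [set T | [/\ forall x, linear (T x), forall y, linear (T^~ y),
               forall x, T x x = 0 &
               forall x y z, T x y *m z + T y z *m x + T z x *m y = 0]].

Definition S_euler (S : V -> V -> V -> 'M[R]_n) (theta : V -> V -> V) :
    V -> V -> 'M[R]_n :=
  fun v w => S v v (theta v w).

Definition act_inv (P : 'M[R]_n) (T : V -> V -> 'M[R]_n) : V -> V -> 'M[R]_n :=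
  fun x y => invmx P *m T (P *m x) (P *m y) *m P.

End CurvatureTensors.

Section Connections.
Context {R : realType} {n : nat}.
Notation V := 'cV[R]_n.

Definition lie_bracket (X Y : V -> V) : V -> V :=
  fun v => 'D_(X v) Y v - 'D_(Y v) X v.

(* nabla X Y stands for the covariant derivative of Y along X.  That nabla X Y
   depends on U only through the restrictions of X and Y to U follows from the
   axioms, with f equal to 1 on U and to 0 elsewhere. *)
Definition connection (U : set V) (nabla : (V -> V) -> (V -> V) -> V -> V) : Prop :=
  [/\ forall X Y, smooth U X -> smooth U Y -> smooth U (nabla X Y),
      forall X X' Y, smooth U X -> smooth U X' -> smooth U Y ->
        forall v, U v ->
          nabla (fun u => X u + X' u) Y v = nabla X Y v + nabla X' Y v,
      forall (f : V -> R) X Y, smooth U f -> smooth U X -> smooth U Y ->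
        forall v, U v -> nabla (fun u => f u *: X u) Y v = f v *: nabla X Y v,
      forall X Y Y', smooth U X -> smooth U Y -> smooth U Y' ->
        forall v, U v ->
          nabla X (fun u => Y u + Y' u) v = nabla X Y v + nabla X Y' v &
      forall (f : V -> R) X Y, smooth U f -> smooth U X -> smooth U Y ->
        forall v, U v ->
          nabla X (fun u => f u *: Y u) v =
            'D_(X v) f v *: Y v + f v *: nabla X Y v].

Definition real_analytic_connection (U : set V)
    (nabla : (V -> V) -> (V -> V) -> V -> V) : Prop :=
  forall X Y, real_analytic U X -> real_analytic U Y ->
    real_analytic U (nabla X Y).

Definition torsion_free (U : set V)
    (nabla : (V -> V) -> (V -> V) -> V -> V) : Prop :=
  forall X Y, smooth U X -> smooth U Y ->
    forall v, U v -> nabla X Y v - nabla Y X v = lie_bracket X Y v.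

Definition curvature (nabla : (V -> V) -> (V -> V) -> V -> V)
    (X Y Z : V -> V) : V -> V :=
  fun v => nabla X (nabla Y Z) v - nabla Y (nabla X Z) v
           - nabla (lie_bracket X Y) Z v.

(* The curvature is tensorial, hence its value at v may be computed on the
   extensions of tangent vectors to constant vector fields; the columns of the
   matrix are the images of the standard basis. *)
Definition curvature_at (nabla : (V -> V) -> (V -> V) -> V -> V) (v : V) :
    V -> V -> 'M[R]_n :=
  fun x y =>
    \matrix_(i, j) curvature nabla (cst x) (cst y) (cst (delta_mx j 0)) v i 0.

(* If e_j are the constant fields of the standard basis and W = sum_j W_j e_j,
   the covariant derivative of W along gamma is
     sum_j W_j' e_j + sum_j W_j nabla_(gamma') e_j. *)
Definition cov_deriv_along (nabla : (V -> V) -> (V -> V) -> V -> V)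
    (gamma W : R -> V) : R -> V :=
  fun t => derive1 W t + nabla (cst (derive1 gamma t)) (cst (W t)) (gamma t).

Definition parallel_along (nabla : (V -> V) -> (V -> V) -> V -> V)
    (gamma W : R -> V) : Prop :=
  forall t : R, 0 <= t <= 1 ->
    derivable W t 1 /\ cov_deriv_along nabla gamma W t = 0.

Definition geodesic (nabla : (V -> V) -> (V -> V) -> V -> V)
    (gamma : R -> V) : Prop :=
  (forall t : R, 0 <= t <= 1 -> derivable gamma t 1) /\
  parallel_along nabla gamma (derive1 gamma).

(* P is the parallel translation map along gamma from time 0 to time 1. *)
Definition parallel_translation (nabla : (V -> V) -> (V -> V) -> V -> V)
    (gamma : R -> V) (P : 'M[R]_n) : Prop :=
  forall w : V, exists W : R -> V,
    [/\ parallel_along nabla gamma W, W 0 = w & W 1 = P *m w].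

Definition radial_curve (v : V) : R -> V := fun t => t *: v.

Definition radially_prescribed (U : set V) (S : V -> V -> V -> 'M[R]_n)
    (nabla : (V -> V) -> (V -> V) -> V -> V) : Prop :=
  forall v : V, U v ->
    geodesic nabla (radial_curve v) /\
    exists P : 'M[R]_n,
      [/\ parallel_translation nabla (radial_curve v) P, P \in unitmx &
          forall x y : V,
            S v x y = act_inv P (curvature_at nabla (radial_curve v 1)) x y].

End Connections.

(* Main.v *)
Require Import Defs.
From HB Require Import structures.
From mathcomp Require Import all_boot all_order all_algebra.
From mathcomp Require Import all_classical all_reals all_analysis.
From mathcomp Require Import ring lra.

(** In the constant frame a connection is nabla_X Y = D_X Y + G(X) Y, with G v
    linear from V to matrices. Let Th v be the matrix of theta at v, E the Euler
    field and om the form omega.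

    Existence. The form theta is meant to be the coframe whose dual frame is
    parallel along rays and standard at the origin. In that frame the connection
    is d + om, and in the constant frame it is G v x = Th^-1 (D_x Th + om x Th).

    Its curvature is Th^-1 (d om + om /\ om) Th, which the consistency relation
    identifies (frame_chris_curvature).

    The singular equation says that along the ray through v the matrix
    J t = t Th (t v) solves the Jacobi equation J'' = S (v, J) v
    (djac_is_derive). As S (v, v) = 0, the vectors t v solve it too, with the
    same initial data as J v, so Th v v = v (coframe_radial). Then S (E, theta)
    vanishes on radial vectors and so does om (om_radial); hence Th^-1 is
    parallel along rays, and rays are geodesics.

    For the torsion, the Jacobi equation is integrated once along rays, to
    L_E theta = id + om E (coframe_first_integral). Differentiating this identity
    and using the consistency relation and the Bianchi identity of S shows that
    the torsion T = d theta + om /\ theta satisfies D_E T = -2 T. So t^2 T (t v)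
    is constant in t, hence zero (frame_torsion_eq0).

    Uniqueness. Let nabla be a connection as required and W the parallel frame
    along a ray, standard at the origin. Then t id is a Jacobi field of nabla,
    coming from the variation through rays, and so is W t J t, because the
    curvature in the frame W is S. They have the same initial data, so
    W = Th^-1 (frame_coframe). This determines the curvature of nabla and the
    radial part G v v (single_connection). Two connections with the same radial
    part and the same curvature have the same G: the curvature of the pair
    (E, y) is the derivative of G y along E up to terms that are linear in G y,
    so along a ray the difference solves a linear differential equation with
    zero initial value (two_connections).

    Both parts take place on a ball around the origin on which Th is invertible
    and the entries of S (E, theta) are given by one power series each, which
    makes om analytic (exists_common_ball); any open star-shaped subset serves
    as well.

    Analyticity. Power series in n variables are treated as absolutely summable
    families indexed by multi-indices, so that the closure properties of
    analytic functions become exchanges of two summations (asum_pair): products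
    (ps_mul), change of centre by the binomial theorem (ps_translate), inverses
    by the Neumann series (ps_inv). The radial integral divides the terms of
    degree d by d + 1 (radial_integral). *)

Import Order.TTheory GRing.Theory Num.Theory.
Import numFieldNormedType.Exports.

Local Open Scope classical_set_scope.
Local Open Scope ring_scope.

Set Implicit Arguments.
Unset Strict Implicit.
Unset Printing Implicit Defensive.

(** * Absolutely summable families of reals *)

(** The sum of the positive parts minus the sum of the negative parts; it is only
    meaningful for families that are absolutely summable in the sense of summ.
    It is locked so that unification does not unfold the suprema. *)
HB.lock Definition asum (R : realType) (T : choiceType) (f : T -> R) : R :=
  fine (\esum_(k in [set: T]) (Num.max (f k) 0)%:E)
  - fine (\esum_(k in [set: T]) (Num.max (- f k) 0)%:E).

Section Summable.
Context {R : realType}.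

Definition summ {T : choiceType} (f : T -> R) : Prop :=
  (\esum_(k in [set: T]) (`|f k|)%:E < +oo)%E.

Lemma summ_le {T : choiceType} (f g : T -> R) :
  (forall k, `|f k| <= g k) -> summ g -> summ f.
Proof.
move=> fg; apply: le_lt_trans; apply: le_esum => k _.
by rewrite lee_fin (le_trans (fg k))// ler_norm.
Qed.

Lemma summ_norm {T : choiceType} (f : T -> R) : summ f -> summ (fun k => `|f k|).
Proof. by rewrite /summ; under [in X in _ -> X]eq_esum do rewrite normr_id. Qed.

Lemma summD {T : choiceType} (f g : T -> R) :
  summ f -> summ g -> summ (fun k => f k + g k).
Proof.
move=> sf sg; apply: le_lt_trans (lte_add_pinfty sf sg).
by rewrite -esumD//; apply: le_esum => k _; rewrite lee_fin ler_normD.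
Qed.

Lemma summZ {T : choiceType} (a : R) (f : T -> R) :
  summ f -> summ (fun k => a * f k).
Proof.
move=> sf.
have -> : summ (fun k => a * f k) =
    (\esum_(k in [set: T]) (`|a|%:E * (`|f k|)%:E) < +oo)%E :> Prop.
  by rewrite /summ; congr (is_true (_ < _)%E); apply: eq_esum => k _; rewrite normrM.
have fin : (\esum_(k in [set: T]) (`|f k|)%:E)%E \is a fin_num.
  by rewrite ge0_fin_numE// esum_ge0.
apply: (@le_lt_trans _ _ (`|a|%:E * \esum_(k in [set: T]) (`|f k|)%:E)%E).
  apply: ge_ereal_sup => _ [X [finX _] <-].
  rewrite fsbig_finite//= -ge0_sume_distrr//.
  rewrite lee_pmul//; first by apply: sume_ge0.
  by apply: esum_ge; exists X => //; rewrite fsbig_finite.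
by rewrite -(fineK fin) -EFinM ltry.
Qed.

Lemma summN {T : choiceType} (f : T -> R) : summ f -> summ (fun k => - f k).
Proof. by move=> /(summZ (-1)); under eq_fun do rewrite mulN1r. Qed.

Lemma summ0 {T : choiceType} : summ (fun _ : T => 0 : R).
Proof. by rewrite /summ esum1// => k _; rewrite normr0. Qed.

Lemma maxr0E (x : R) : Num.max x 0 = x + Num.max (- x) 0.
Proof.
have [x0|x0] := leP x 0; first by rewrite max_l ?addrN// oppr_ge0.
by rewrite max_r ?addr0// oppr_le0 ltW.
Qed.

Lemma summ_pos {T : choiceType} (f : T -> R) :
  summ f -> summ (fun k => Num.max (f k) 0).
Proof.
move=> sf; apply: (@summ_le _ _ (fun k => `|f k|)); last exact: summ_norm.
move=> k; by case: (leP (f k) 0) => h; rewrite ?normr0.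
Qed.

Lemma summ_neg {T : choiceType} (f : T -> R) :
  summ f -> summ (fun k => Num.max (- f k) 0).
Proof. by move/summN/summ_pos. Qed.

Lemma ge0_esumE {T : choiceType} (f : T -> R) :
  (forall k, 0 <= f k) -> summ f ->
  (\esum_(k in [set: T]) (f k)%:E = (asum f)%:E)%E.
Proof.
move=> f0 sf; rewrite asum.unlock [X in _ - fine X]esum1; last first.
  by move=> k _; rewrite max_r// oppr_le0.
under [in RHS]eq_esum do rewrite max_l//.
rewrite subr0 fineK// ge0_fin_numE; last by apply: esum_ge0 => k _; rewrite lee_fin.
by move: sf; rewrite /summ; under eq_esum do rewrite ger0_norm//.
Qed.

Lemma ge0_asumD {T : choiceType} (f g : T -> R) :
  (forall k, 0 <= f k) -> (forall k, 0 <= g k) -> summ f -> summ g ->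
  asum (fun k => f k + g k) = asum f + asum g.
Proof.
move=> f0 g0 sf sg; apply: EFin_inj.
rewrite -ge0_esumE; [|by move=> k; rewrite addr_ge0|exact: summD].
rewrite (_ : _%:E = (asum f)%:E + (asum g)%:E)%E// -!ge0_esumE//.
by rewrite -esumD// => k _; rewrite lee_fin.
Qed.

Lemma asumE {T : choiceType} (f : T -> R) : summ f ->
  asum f = asum (fun k => Num.max (f k) 0) - asum (fun k => Num.max (- f k) 0).
Proof.
have m0 (x : R) : 0 <= Num.max x 0 by rewrite le_max lexx orbT.
move=> sf.
have E g : (forall k, 0 <= g k) -> summ g ->
    fine (\esum_(k in [set: T]) (g k)%:E) = asum g.
  by move=> g0 sg; rewrite ge0_esumE.
rewrite {1}asum.unlock; congr (_ - _); apply: E => // .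
- exact: summ_pos.
- exact: summ_neg.
Qed.

(** Positive parts are not additive, so additivity of the sum needs decompositions
    into nonnegative families other than the one in the definition. *)
Lemma asum_pos_neg {T : choiceType} (p q : T -> R) :
  (forall k, 0 <= p k) -> (forall k, 0 <= q k) -> summ p -> summ q ->
  asum (fun k => p k - q k) = asum p - asum q.
Proof.
move=> p0 q0 sp sq; set f := fun k => _.
have sf : summ f by apply: summD => //; exact: summN.
have m0 (x : R) : 0 <= Num.max x 0 by rewrite le_max lexx orbT.
have E : asum (fun k => Num.max (f k) 0) + asum q =
         asum (fun k => Num.max (- f k) 0) + asum p.
  rewrite -!ge0_asumD//; [|exact: summ_neg|exact: summ_pos].
  congr asum; apply/funext => k; rewrite /f (maxr0E (p k - q k)); ring.
by apply/eqP; rewrite (asumE sf) subr_eq addrAC eq_sym subr_eq E addrC.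
Qed.

Lemma asumD {T : choiceType} (f g : T -> R) : summ f -> summ g ->
  asum (fun k => f k + g k) = asum f + asum g.
Proof.
move=> sf sg; rewrite (asumE sf) (asumE sg).
have m0 (x : R) : 0 <= Num.max x 0 by rewrite le_max lexx orbT.
have [sf1 sf2] := (summ_pos sf, summ_neg sf).
have [sg1 sg2] := (summ_pos sg, summ_neg sg).
have -> : (fun k => f k + g k) = (fun k =>
    (Num.max (f k) 0 + Num.max (g k) 0) - (Num.max (- f k) 0 + Num.max (- g k) 0)).
  apply/funext => k; rewrite (maxr0E (f k)) (maxr0E (g k)); ring.
rewrite asum_pos_neg ?ge0_asumD//; first ring.
- by move=> k; rewrite addr_ge0.
- by move=> k; rewrite addr_ge0.
- exact: summD.
- exact: summD.
Qed.

Lemma asumN {T : choiceType} (f : T -> R) : asum (fun k => - f k) = - asum f.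
Proof. by rewrite asum.unlock opprB; under [in X in _ - X]eq_esum do rewrite opprK. Qed.

Lemma asum0 {T : choiceType} : asum (fun _ : T => 0 : R) = 0.
Proof. by rewrite asum.unlock !esum1 ?subr0// => k _; rewrite ?oppr0 maxxx. Qed.

Lemma asumB {T : choiceType} (f g : T -> R) : summ f -> summ g ->
  asum (fun k => f k - g k) = asum f - asum g.
Proof. by move=> sf sg; rewrite asumD ?asumN//; exact: summN. Qed.

Lemma asum_ge0 {T : choiceType} (f : T -> R) :
  (forall k, 0 <= f k) -> 0 <= asum f.
Proof.
move=> f0; rewrite asum.unlock [X in _ - fine X]esum1; last first.
  by move=> k _; rewrite max_r// oppr_le0.
rewrite subr0 fine_ge0// esum_ge0// => k _.
by rewrite lee_fin le_max lexx orbT.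
Qed.

Lemma ler_asum {T : choiceType} (f g : T -> R) : summ f -> summ g ->
  (forall k, f k <= g k) -> asum f <= asum g.
Proof.
move=> sf sg fg; rewrite -subr_ge0 -asumB// asum_ge0// => k.
by rewrite subr_ge0.
Qed.

Lemma ler_norm_asum {T : choiceType} (f : T -> R) : summ f ->
  `|asum f| <= asum (fun k => `|f k|).
Proof.
move=> sf; have sa := summ_norm sf.
rewrite ler_norml -asumN !ler_asum//.
- by move=> k; exact: ler_norm.
- exact: summN.
- by move=> k; rewrite lerNl ler_normr lexx orbT.
Qed.

Lemma asum_norm_le {T : choiceType} (f g : T -> R) :
  (forall k, `|f k| <= g k) -> summ g -> `|asum f| <= asum g.
Proof.
move=> fg sg; have sf := summ_le fg sg.
by rewrite (le_trans (ler_norm_asum sf))// ler_asum//; exact: summ_norm.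
Qed.

(** For a > 0 and nonnegative terms the inequality <= compares suprema over
    finite subfamilies, and its instance for the inverse of a is the converse. *)
Lemma asumZ {T : choiceType} (a : R) (f : T -> R) : summ f ->
  asum (fun k => a * f k) = a * asum f.
Proof.
have pos (b : R) (g : T -> R) : 0 < b -> (forall k, 0 <= g k) -> summ g ->
    asum (fun k => b * g k) <= b * asum g.
  move=> b0 g0 sg; rewrite -lee_fin -ge0_esumE; first last.
  - exact: summZ.
  - by move=> k; rewrite mulr_ge0// ltW.
  apply: ge_ereal_sup => _ [X [finX _] <-].
  rewrite fsbig_finite//= sumEFin -mulr_sumr lee_fin ler_pM2l// -lee_fin.
  rewrite -ge0_esumE//.
  by apply: esum_ge; exists X => //; rewrite fsbig_finite//= sumEFin.
have posE (b : R) (g : T -> R) : 0 < b -> (forall k, 0 <= g k) -> summ g ->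
    asum (fun k => b * g k) = b * asum g.
  move=> b0 g0 sg; apply/eqP; rewrite eq_le pos//=.
  rewrite -ler_pdivlMl//; apply: le_trans (pos b^-1 _ _ _ _).
  - rewrite le_eqVlt; apply/orP; left; apply/eqP; congr asum; apply/funext => k.
    by rewrite mulrA mulVf ?mul1r// gt_eqF.
  - by rewrite invr_gt0.
  - by move=> k; rewrite mulr_ge0// ltW.
  - exact: summZ.
move=> sf.
have m0 (x : R) : 0 <= Num.max x 0 by rewrite le_max lexx orbT.
have gt0 (b : R) : 0 < b -> asum (fun k => b * f k) = b * asum f.
  move=> b0; rewrite asumE; last exact: summZ.
  rewrite (asumE sf) mulrBr -!posE//; [|exact: summ_neg|exact: summ_pos].
  have mM (x : R) : Num.max (b * x) 0 = b * Num.max x 0.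
    by rewrite maxr_pMr ?mulr0// ltW.
  by congr (_ - _); congr asum; apply/funext => k; rewrite -?mulrN mM.
have [a0|/gt0//|->] := ltgtP a 0.
- rewrite -[a]opprK mulNr -gt0 ?oppr_gt0// -asumN; congr asum; apply/funext => k.
  by rewrite mulNr.
- by rewrite mul0r; under eq_fun do rewrite mul0r; rewrite asum0.
Qed.

End Summable.

Section Fubini.
Context {R : realType}.

Lemma summ_reindex {T T' : choiceType} (e : T -> T') (f : T' -> R) :
  injective e -> (forall k', ~ range e k' -> f k' = 0) ->
  (summ f <-> summ (f \o e)) /\ asum f = asum (f \o e).
Proof.
move=> ie f0.
have H (g : T' -> R) : (forall k', ~ range e k' -> g k' = 0) ->
    (\esum_(k in [set: T']) (g k)%:E = \esum_(k in [set: T]) (g (e k))%:E)%E.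
  move=> g0; rewrite -(esum_image [set: T] e (fun k => (g k)%:E)); last first.
    by move=> x y _ _; exact: ie.
  rewrite [RHS]esum_mkcond; apply: eq_esum => k _.
  by case: ifPn => // /negP; rewrite inE => /g0 ->.
split.
  by rewrite /summ (H (fun k => `|f k|))// => k /f0 ->; rewrite normr0.
rewrite !asum.unlock (H (fun k => Num.max (f k) 0)); last first.
  by move=> k /f0 ->; rewrite maxxx.
rewrite (H (fun k => Num.max (- f k) 0))// => k /f0 ->.
by rewrite oppr0 maxxx.
Qed.

Lemma summ_inj {T T' : choiceType} (e : T -> T') (f : T' -> R) :
  injective e -> summ f -> summ (f \o e).
Proof.
move=> ie sf; pose g k := if k \in range e then f k else 0.
have g0 k : ~ range e k -> g k = 0 by move=> h; rewrite /g memNset.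
have -> : f \o e = g \o e.
  by apply/funext => k /=; rewrite /g mem_set//; exists k.
apply/(summ_reindex ie g0).1; apply: (summ_le _ (summ_norm sf)) => k.
by rewrite /g; case: ifP => // _; rewrite normr0.
Qed.

Lemma summ_single {T : choiceType} (k0 : T) (f : T -> R) :
  (forall k, k != k0 -> f k = 0) -> summ f /\ asum f = f k0.
Proof.
move=> f0.
have H (g : T -> R) : (forall k, 0 <= g k) -> (forall k, k != k0 -> g k = 0) ->
    (\esum_(k in [set: T]) (g k)%:E = (g k0)%:E)%E.
  move=> gp g0; rewrite -(@esum_set1 _ _ k0 (fun k => (g k)%:E)) ?lee_fin//.
  rewrite [RHS]esum_mkcond; apply: eq_esum => k _.
  by case: ifPn => // /negP; rewrite inE/= => /eqP/g0 ->.
split.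
  by rewrite /summ (H (fun k => `|f k|)) ?ltry// => k /f0 ->; rewrite normr0.
rewrite asum.unlock (H (fun k => Num.max (f k) 0)); first last.
- by move=> k /f0 ->; rewrite maxxx.
- by move=> k; rewrite le_max lexx orbT.
rewrite (H (fun k => Num.max (- f k) 0)); first last.
- by move=> k /f0 ->; rewrite oppr0 maxxx.
- by move=> k; rewrite le_max lexx orbT.
by rewrite /= (maxr0E (f k0)) addrK.
Qed.

Lemma summ_bigsum {T : choiceType} (I : Type) (r : seq I) (f : I -> T -> R) :
  (forall i, summ (f i)) -> summ (fun k => \sum_(i <- r) f i k).
Proof.
move=> sf; elim: r => [|i r IH].
  by under eq_fun do rewrite big_nil; exact: summ0.
by under eq_fun do rewrite big_cons; exact: summD.
Qed.

Lemma asum_bigsum {T : choiceType} (I : Type) (r : seq I) (f : I -> T -> R) :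
  (forall i, summ (f i)) ->
  asum (fun k => \sum_(i <- r) f i k) = \sum_(i <- r) asum (f i).
Proof.
move=> sf; elim: r => [|i r IH].
  by rewrite big_nil; under eq_fun do rewrite big_nil; exact: asum0.
rewrite big_cons -IH; under eq_fun do rewrite big_cons.
by rewrite asumD//; exact: summ_bigsum.
Qed.

Section pairs.
Context {T1 T2 : choiceType}.
Implicit Type F : T1 -> T2 -> R.

Let esum_pair F : (forall i j, 0 <= F i j) ->
  (\esum_(p in [set: T1 * T2]) (F p.1 p.2)%:E =
   \esum_(i in [set: T1]) \esum_(j in [set: T2]) (F i j)%:E)%E.
Proof.
move=> F0; rewrite esum_esum; last by move=> i j _ _; rewrite lee_fin.
by congr esum; apply/seteqP; split.
Qed.

Lemma summ_row F : summ (fun p => F p.1 p.2) -> forall i, summ (F i).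
Proof. by move=> sF i; apply: (@summ_inj _ _ (pair i) _ _ sF) => x y []. Qed.

Lemma summ_col F : summ (fun p => F p.1 p.2) -> forall j, summ (F^~ j).
Proof. by move=> sF j; apply: (@summ_inj _ _ (fun i => (i, j)) _ _ sF) => x y []. Qed.

Let fubini_ge0 F : (forall i j, 0 <= F i j) -> summ (fun p => F p.1 p.2) ->
  summ (fun i => asum (F i)) /\
  asum (fun p => F p.1 p.2) = asum (fun i => asum (F i)).
Proof.
move=> F0 sF; have sr := summ_row sF.
have A0 i : 0 <= asum (F i) by exact: asum_ge0.
have E : (\esum_(p in [set: T1 * T2]) (F p.1 p.2)%:E =
    \esum_(i in [set: T1]) (asum (F i))%:E)%E.
  by rewrite esum_pair//; apply: eq_esum => i _; rewrite ge0_esumE.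
have sA : summ (fun i => asum (F i)).
  rewrite /summ; under eq_esum do rewrite ger0_norm//.
  rewrite -E; move: sF; rewrite /summ.
  by under eq_esum do rewrite ger0_norm//.
split=> //; apply: EFin_inj.
by rewrite -(@ge0_esumE _ _ (fun p => F p.1 p.2))// E ge0_esumE.
Qed.

(** Splitting the family into positive and negative parts reduces the exchange
    of sums to the case of nonnegative terms. *)
Lemma asum_pair F : summ (fun p => F p.1 p.2) ->
  summ (fun i => asum (F i)) /\
  asum (fun p => F p.1 p.2) = asum (fun i => asum (F i)).
Proof.
move=> sF.
have m0 (x : R) : 0 <= Num.max x 0 by rewrite le_max lexx orbT.
pose P i j := Num.max (F i j) 0; pose Q i j := Num.max (- F i j) 0.
have sP : summ (fun p => P p.1 p.2) by exact: (summ_pos sF).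
have sQ : summ (fun p => Q p.1 p.2) by exact: (summ_neg sF).
have P0 i j : 0 <= P i j by exact: m0.
have Q0 i j : 0 <= Q i j by exact: m0.
have [sP1 eP] := fubini_ge0 P0 sP.
have [sQ1 eQ] := fubini_ge0 Q0 sQ.
have E i : asum (F i) = asum (P i) - asum (Q i).
  exact: asumE (summ_row sF i).
have -> : (fun i => asum (F i)) = (fun i => asum (P i) - asum (Q i)).
  exact/funext.
split; first by apply: summD => //; exact: summN.
by rewrite asumE// asumB// -eP -eQ.
Qed.

(** Tonelli's criterion: iterated absolute summability, with a bound for the inner
    sums in place of their exact values. *)
Lemma summ_pair F (G : T1 -> R) :
  (forall i, summ (F i)) -> (forall i, asum (fun j => `|F i j|) <= G i) ->
  summ G -> summ (fun p => F p.1 p.2).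
Proof.
move=> sF FG sG.
rewrite /summ (esum_pair (F := fun i j => `|F i j|))//.
apply: le_lt_trans sG; apply: le_esum => i _.
rewrite ge0_esumE//; last exact: summ_norm.
by rewrite lee_fin (le_trans (FG i))// ler_norm.
Qed.

End pairs.

Lemma summ_swap {T1 T2 : choiceType} (F : T1 -> T2 -> R) :
  summ (fun p => F p.1 p.2) -> summ (fun p => F p.2 p.1).
Proof.
move=> sF; apply: (@summ_inj _ _ (fun p => (p.2, p.1)) _ _ sF).
by move=> [a b] [c d] [-> ->].
Qed.

Lemma asum_exchange {T1 T2 : choiceType} (F : T1 -> T2 -> R) :
  summ (fun p => F p.1 p.2) ->
  asum (fun i => asum (F i)) = asum (fun j => asum (F^~ j)).
Proof.
move=> sF; have sF' := summ_swap sF.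
rewrite -(asum_pair sF).2 -(asum_pair (F := fun j i => F i j) sF').2.
have inj : injective (fun p : T2 * T1 => (p.2, p.1)).
  by move=> [a b] [c d] [-> ->].
rewrite (summ_reindex (f := fun p => F p.1 p.2) inj _).2//.
by move=> [a b] []; exists (b, a).
Qed.

Lemma summ_marginal {T1 T2 : choiceType} (F : T1 -> T2 -> R) :
  summ (fun p => F p.1 p.2) -> summ (fun j => asum (F^~ j)).
Proof. by move=> /summ_swap sF; exact: (asum_pair (F := fun j i => F i j) sF).1. Qed.

End Fubini.

(** * Sums over boxes of multi-indices *)

Section BoxSums.
Context {R : realType} {n : nat}.
Notation K := {ffun 'I_n -> nat}.

Lemma asum_fin (T : finType) (f : T -> R) : summ f /\ asum f = \sum_i f i.
Proof.
pose d (i k : T) := if k == i then f i else 0.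
have d0 i k : k != i -> d i k = 0 by rewrite /d => /negbTE ->.
have -> : f = fun k => \sum_i d i k.
  apply/funext => k; rewrite (bigD1 k)//= {1}/d eqxx big1 ?addr0// => i.
  by rewrite eq_sym => /d0.
split; first by apply: summ_bigsum => i; exact: (summ_single (d0 i)).1.
rewrite asum_bigsum => [|i]; last exact: (summ_single (d0 i)).1.
apply: eq_bigr => i _; rewrite (summ_single (d0 i)).2 (bigD1 i)//=.
by rewrite big1 ?addr0// => j; rewrite eq_sym => /d0.
Qed.

Definition box_index (N : nat) (k : {ffun 'I_n -> 'I_N}) : K :=
  [ffun i => val (k i)].

Lemma box_index_inj N : injective (@box_index N).
Proof.
move=> k k' /ffunP kk'; apply/ffunP => i; apply: val_inj.
by have := kk' i; rewrite !ffunE.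
Qed.

Lemma box_indexP N (k : K) :
  (forall i, (k i < N)%N) -> exists k', k = box_index (N := N) k'.
Proof.
move=> kN; exists [ffun i => Ordinal (kN i)].
by apply/ffunP => i; rewrite !ffunE.
Qed.

Definition in_box N (k : K) := [forall i, (k i < N)%N].

Lemma in_box_index N (k : {ffun 'I_n -> 'I_N}) : in_box N (box_index k).
Proof. by apply/forallP => i; rewrite ffunE /=; exact: ltn_ord. Qed.

Lemma asum_box (f : K -> R) N :
  summ (fun k => if in_box N k then f k else 0) /\
  asum (fun k => if in_box N k then f k else 0) = box_sum f N.
Proof.
set g := fun k => _.
have g0 k : ~ range (@box_index N) k -> g k = 0.
  move=> h; rewrite /g; case: ifP => // /forallP /box_indexP[k' E].
  by case: h; exists k'.
have [H1 H2] := summ_reindex (@box_index_inj N) g0.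
have [F1 F2] := asum_fin (g \o @box_index N).
split; first exact/H1.
by rewrite H2 F2; apply: eq_bigr => k _; rewrite /g /= in_box_index.
Qed.

Lemma asum_supported (f : K -> R) N : (forall k, ~~ in_box N k -> f k = 0) ->
  summ f /\ asum f = box_sum f N.
Proof.
move=> f0; have := asum_box f N.
by rewrite (_ : (fun k => _) = f)//; apply/funext => k; case: ifPn => // /f0.
Qed.

(** The boxes exhaust the multi-indices, so that suprema over finite subfamilies
    may be computed on boxes. *)
Lemma finite_in_box (X : set K) : finite_set X ->
  exists N, forall k, X k -> in_box N k.
Proof.
move=> finX; exists (\sum_(k <- finmap.enum_fset (fset_set X)) \sum_i k i)%N.+1 => k Xk.
apply/forallP => i; rewrite ltnS.
have kX : k \in finmap.enum_fset (fset_set X) by rewrite in_fset_set// inE.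
rewrite (bigD1_seq k)//= ?finmap.fset_uniq// (bigD1 i)//= -addnA.
exact: leq_addr.
Qed.

Lemma in_box_le N M k : (N <= M)%N -> in_box N k -> in_box M k.
Proof.
by move=> NM /forallP h; apply/forallP => i; exact: leq_trans (h i) NM.
Qed.

Lemma box_sum_nd (f : K -> R) : (forall k, 0 <= f k) ->
  nondecreasing_seq (box_sum f).
Proof.
move=> f0 N M NM; have [sN <-] := asum_box f N; have [sM <-] := asum_box f M.
apply: ler_asum => // k; case: ifPn; first by move/(in_box_le NM) => ->.
by case: ifP.
Qed.

Lemma summ_of_cvg_box (f : K -> R) :
  cvgn (box_sum (fun k => `|f k|)) -> summ f.
Proof.
move=> cf; set L := limn (box_sum (fun k => `|f k|)).
apply: (@le_lt_trans _ _ L%:E); last by rewrite ltry.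
apply: ge_ereal_sup => _ [X [finX _] <-].
have [N XN] := finite_in_box finX.
apply: (@le_trans _ _ (box_sum (fun k => `|f k|) N)%:E); last first.
  rewrite lee_fin; apply: nondecreasing_cvgn_le => //.
  exact: (box_sum_nd (fun k => normr_ge0 (f k))).
have [sN <-] := asum_box (fun k => `|f k|) N.
rewrite -ge0_esumE//; last by move=> k; case: ifP.
apply: esum_ge; exists X => //.
apply: lee_fsum => // k Xk; by rewrite XN.
Qed.

(** Both the sum and the box sums are controlled by the family of absolute values:
    its tail outside a large box is small. *)
Lemma box_sum_cvg (f : K -> R) : summ f ->
  cvgn (box_sum (fun k => `|f k|)) /\ box_sum f @ \oo --> asum f.
Proof.
move=> sf; have sa := summ_norm sf.
have nd := box_sum_nd (fun k => normr_ge0 (f k)).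
split.
  apply: nondecreasing_is_cvgn => //; exists (asum (fun k => `|f k|)).
  move=> _ [N _ <-]; have [sN <-] := asum_box (fun k => `|f k|) N.
  by apply: ler_asum => // k; case: ifP.
have key N : `|asum f - box_sum f N| <=
    asum (fun k => `|f k|) - box_sum (fun k => `|f k|) N.
  have [sN <-] := asum_box f N.
  have [saN <-] := asum_box (fun k => `|f k|) N.
  rewrite -!asumB//; apply: asum_norm_le; last first.
    by apply: summD => //; exact: summN.
  by move=> k; case: ifP => _; rewrite ?subrr ?normr0 ?subr0.
apply/cvgrPdist_lt => e e0.
have : ((asum (fun k => `|f k|) - e)%:E < (asum (fun k => `|f k|))%:E)%E.
  by rewrite lte_fin ltrBlDr ltrDl.
rewrite -ge0_esumE// => /ereal_sup_gt[_ [X [finX _] <-] Xe].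
have [N XN] := finite_in_box finX.
exists N => // M /= NM; apply: le_lt_trans (key M) _.
rewrite ltrBlDr addrC -ltrBlDr -lte_fin; apply: (lt_le_trans Xe).
have [sM <-] := asum_box (fun k => `|f k|) M.
rewrite -ge0_esumE//; last by move=> k; case: ifP.
apply: esum_ge; exists X => //.
by apply: lee_fsum => // k Xk; rewrite (in_box_le NM)// XN.
Qed.

End BoxSums.

(** * Power series in several variables *)

Section PowerSeries.
Context {R : realType} {n : nat}.
Notation V := 'cV[R]_n.
Notation K := {ffun 'I_n -> nat}.
Implicit Types (c d : K -> R) (k m p : K) (h v : V) (r : R).

Lemma ler_mxnorm (a b : nat) (M : 'M[R]_(a, b)) i j : `|M i j| <= `|M|.
Proof.
rewrite /Num.Def.normr/= mx_normrE.
exact: (le_bigmax _ (fun ij => `|M ij.1 ij.2|) (i, j)).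
Qed.

Lemma mxnorm_le (a b : nat) (M : 'M[R]_(a, b)) (e : R) : 0 <= e ->
  (forall i j, `|M i j| <= e) -> `|M| <= e.
Proof.
by move=> e0 H; rewrite /Num.Def.normr/= mx_normrE; apply: bigmax_le.
Qed.

Definition deg k : nat := (\sum_i k i)%N.
Definition mi0 : K := [ffun=> 0%N].
Definition mi1 (i : 'I_n) : K := [ffun j => (j == i : nat)].
Definition miD k m : K := [ffun i => (k i + m i)%N].
Definition miB k m : K := [ffun i => (k i - m i)%N].
Definition mile k m : bool := [forall i, (k i <= m i)%N].
(** The corner of the polydisc of radius r, where every monomial attains its
    largest absolute value; summability there controls the whole polydisc. *)
Definition cvec r : V := const_mx r.

Lemma miDC k m : miD k m = miD m k.
Proof. by apply/ffunP => i; rewrite !ffunE addnC. Qed.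

Lemma miD_inj k : injective (miD k).
Proof. by move=> m p /ffunP E; apply/ffunP => i; have := E i; rewrite !ffunE => /addnI. Qed.

Lemma miDB k m : mile k m -> miD k (miB m k) = m.
Proof. by move=> /forallP h; apply/ffunP => i; rewrite !ffunE subnKC. Qed.

Lemma miDK k m : miB (miD k m) k = m.
Proof. by apply/ffunP => i; rewrite !ffunE addnC addnK. Qed.

Lemma mile_D k m : mile k (miD k m).
Proof. by apply/forallP => i; rewrite ffunE leq_addr. Qed.

Lemma deg0 : deg mi0 = 0%N.
Proof. by rewrite /deg big1// => i _; rewrite ffunE. Qed.

Lemma deg1 i : deg (mi1 i) = 1%N.
Proof.
rewrite /deg (bigD1 i)//= ffunE eqxx big1// => j.
by rewrite ffunE => /negbTE ->.
Qed.

Lemma leq_deg k i : (k i <= deg k)%N.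
Proof. by rewrite /deg (bigD1 i)//= leq_addr. Qed.

Lemma deg_eq0 k : deg k = 0%N -> k = mi0.
Proof.
move=> d0; apply/ffunP => i; rewrite ffunE.
by apply/eqP; rewrite -leqn0 -d0 leq_deg.
Qed.

Lemma deg_eq1 k : deg k = 1%N -> exists i, k = mi1 i.
Proof.
move=> d1; have [i ki] : exists i, k i != 0%N.
  apply/existsP; apply: contraT => /existsPn /= H.
  by move: d1; rewrite /deg big1// => i _; apply/eqP; have := H i; rewrite negbK.
exists i; apply/ffunP => j; rewrite ffunE; move: d1; rewrite /deg (bigD1 i)//=.
case E: (k i) ki => [|a]// _; rewrite addSn => -[/eqP].
rewrite addn_eq0 => /andP[/eqP a0 /eqP s0].
have [->|ji] := eqVneq j i; first by rewrite E a0.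
by apply/eqP; rewrite -leqn0 -s0 (bigD1 j)//= leq_addr.
Qed.

Lemma monomialD h k m : monomial h (miD k m) = monomial h k * monomial h m.
Proof.
by rewrite /monomial -big_split; apply: eq_bigr => i _; rewrite ffunE exprD.
Qed.

Lemma monomial0 h : monomial h mi0 = 1.
Proof. by rewrite /monomial big1// => i _; rewrite ffunE expr0. Qed.

Lemma monomial1 h i : monomial h (mi1 i) = h i 0.
Proof.
rewrite /monomial (bigD1 i)//= ffunE eqxx expr1 big1 ?mulr1// => j.
by rewrite ffunE => /negbTE ->; rewrite expr0.
Qed.

Lemma monomial_at0 k : k != mi0 -> monomial (0 : V) k = 0.
Proof.
move=> k0; have [i ki] : exists i, k i != 0%N.
  apply/existsP; apply: contraT => /existsPn /= H.
  case/eqP: k0; apply/ffunP => i; rewrite ffunE; apply/eqP.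
  by have := H i; rewrite negbK.
by rewrite /monomial (bigD1 i)//= mxE expr0n (negbTE ki) mul0r.
Qed.

Lemma monomial_cvec r k : monomial (cvec r) k = r ^+ deg k.
Proof.
by rewrite /monomial /deg expr_sum; apply: eq_bigr => i _; rewrite mxE.
Qed.

Lemma monomial_le h k r : `|h| <= r -> `|monomial h k| <= r ^+ deg k.
Proof.
move=> hr; rewrite /monomial normr_prod /deg expr_sum.
apply: ler_prod => i _; rewrite normr_ge0 normrX lerXn2r ?nnegrE//.
- by rewrite (le_trans _ hr).
- exact: le_trans (ler_mxnorm h i 0) hr.
Qed.

Lemma cvec_norm r : 0 <= r -> `|cvec r| <= r.
Proof. by move=> r0; apply: mxnorm_le => // i j; rewrite mxE ger0_norm. Qed.

Definition cabs c r : Prop := summ (fun k => c k * r ^+ deg k).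
(** The weighted l^1 norm, which is submultiplicative for Cauchy products. *)
Definition cnorm c r : R := asum (fun k => `|c k| * r ^+ deg k).
Definition ps c h : R := asum (fun k => c k * monomial h k).

Lemma summ_ps c h r : `|h| <= r -> cabs c r -> summ (fun k => c k * monomial h k).
Proof.
move=> hr /summ_norm sc; apply: (summ_le _ sc) => k.
rewrite !normrM ler_wpM2l// (le_trans (monomial_le k hr))//.
by rewrite ger0_norm// exprn_ge0// (le_trans _ hr).
Qed.

Lemma cabs_le c r r' : 0 <= r' <= r -> cabs c r -> cabs c r'.
Proof.
move=> /andP[r0 rr'] /(summ_ps (le_trans (cvec_norm r0) rr')).
by under eq_fun do rewrite monomial_cvec.
Qed.

Lemma cabs_norm c r : 0 <= r -> cabs c r -> summ (fun k => `|c k| * r ^+ deg k).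
Proof.
move=> r0 /summ_norm sc; rewrite (_ : (fun k => _) = (fun k => `|c k * r ^+ deg k|))//.
apply/funext => k.
by rewrite normrM (ger0_norm (exprn_ge0 _ r0)).
Qed.

Lemma ps_cvec c r : ps c (cvec r) = asum (fun k => c k * r ^+ deg k).
Proof. by rewrite /ps; under eq_fun do rewrite monomial_cvec. Qed.

Lemma ps_at0 c : ps c 0 = c mi0.
Proof.
rewrite /ps (summ_single (k0 := mi0) _).2 ?monomial0 ?mulr1// => k k0.
by rewrite monomial_at0// mulr0.
Qed.

(** ** Products *)

(** The Cauchy product. Only the finitely many k below p contribute, but a sum over
    all k makes the product formula an exchange of two infinite sums. *)
Definition conv c d p : R :=
  asum (fun k => if mile k p then c k * d (miB p k) else 0).

Let convF c d h k p := (if mile k p then c k * d (miB p k) else 0) * monomial h p.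

Let convF_row c d h k : summ (fun m => d m * monomial h m) ->
  summ (convF c d h k) /\
  asum (convF c d h k) = c k * monomial h k * ps d h.
Proof.
move=> sd.
have f0 p : ~ range (miD k) p -> convF c d h k p = 0.
  move=> np; rewrite /convF; case: ifP; rewrite ?mul0r// => kp.
  by case: np; exists (miB p k) => //; rewrite miDB.
have [H1 H2] := summ_reindex (@miD_inj k) f0.
have E : convF c d h k \o miD k =
    fun m => c k * monomial h k * (d m * monomial h m).
  by apply/funext => m; rewrite /convF /= mile_D miDK monomialD; ring.
by rewrite E in H1 H2; split; [apply/H1; exact: summZ|rewrite H2 asumZ].
Qed.

Let convF_row_abs c d h k : summ (fun m => d m * monomial h m) ->
  asum (fun p => `|convF c d h k p|) =
  `|c k * monomial h k| * asum (fun m => `|d m * monomial h m|).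
Proof.
move=> sd.
have f0 p : ~ range (miD k) p -> `|convF c d h k p| = 0.
  move=> np; rewrite /convF; case: ifP; rewrite ?mul0r ?normr0// => kp.
  by case: np; exists (miB p k) => //; rewrite miDB.
rewrite (summ_reindex (@miD_inj k) f0).2 -asumZ; last exact: summ_norm.
congr asum; apply/funext => m; rewrite /convF /= mile_D miDK monomialD -normrM.
by congr (`|_|); ring.
Qed.

Let conv_col c d p : summ (fun k => if mile k p then c k * d (miB p k) else 0).
Proof.
apply: (asum_supported (N := (deg p).+1) _).1 => k; apply: contraNeq.
case: ifP => [/forallP kp _|_ /eqP//]; apply/forallP => i.
by rewrite ltnS (leq_trans (kp i))// leq_deg.
Qed.

Let convF_col c d h p : asum (fun k => convF c d h k p) = conv c d p * monomial h p.
Proof.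
rewrite /convF /conv mulrC -asumZ; last exact: conv_col.
congr asum; apply/funext => k.
by rewrite mulrC.
Qed.

Let summ_convF c d h : summ (fun k => c k * monomial h k) ->
  summ (fun k => d k * monomial h k) ->
  summ (fun kp : K * K => convF c d h kp.1 kp.2).
Proof.
move=> sc sd.
apply: (summ_pair (G := fun k =>
  asum (fun m => `|d m * monomial h m|) * `|c k * monomial h k|)).
- by move=> k; exact: (convF_row c k sd).1.
- by move=> k; rewrite convF_row_abs// mulrC.
- by apply: summZ; exact: summ_norm.
Qed.

(** The family c k * d m * h^(k + m) is summed by rows on the right-hand side and
    along the fibres k + m = p on the left-hand side. *)
Lemma ps_mul c d h : summ (fun k => c k * monomial h k) ->
  summ (fun k => d k * monomial h k) ->
  summ (fun k => conv c d k * monomial h k) /\ ps (conv c d) h = ps c h * ps d h.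
Proof.
move=> sc sd; have sF := summ_convF sc sd.
split.
  by have := summ_marginal sF; under eq_fun do rewrite convF_col.
rewrite /ps; under eq_fun do rewrite -convF_col.
rewrite -(asum_exchange sF).
under eq_fun do rewrite (convF_row _ _ sd).2 mulrC.
by rewrite asumZ// mulrC.
Qed.

Lemma cabs_conv c d r : cabs c r -> cabs d r -> cabs (conv c d) r.
Proof.
have E e : cabs e r = summ (fun k => e k * monomial (cvec r) k).
  by congr summ; apply/funext => k; rewrite monomial_cvec.
by rewrite !E => sc sd; exact: (ps_mul sc sd).1.
Qed.

Lemma cnorm_ge0 c r : 0 <= r -> 0 <= cnorm c r.
Proof. by move=> r0; apply: asum_ge0 => k; rewrite mulr_ge0// exprn_ge0. Qed.

Lemma cnorm_conv c d r : 0 <= r -> cabs c r -> cabs d r ->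
  cnorm (conv c d) r <= cnorm c r * cnorm d r.
Proof.
move=> r0 sc sd.
pose ac k := `|c k|; pose ad k := `|d k|.
have sac : summ (fun k => ac k * monomial (cvec r) k).
  by under eq_fun do rewrite monomial_cvec; exact: cabs_norm.
have sad : summ (fun k => ad k * monomial (cvec r) k).
  by under eq_fun do rewrite monomial_cvec; exact: cabs_norm.
have [s1 e1] := ps_mul sac sad.
have -> : cnorm c r * cnorm d r = ps (conv ac ad) (cvec r).
  by rewrite e1 !ps_cvec.
apply: ler_asum => //.
- by apply: cabs_norm => //; exact: cabs_conv.
- move=> k; rewrite monomial_cvec ler_wpM2r ?exprn_ge0//.
  apply: asum_norm_le => // m.
  by case: ifP; rewrite ?normr0// normrM.
Qed.

(** ** Change of centre *)

(** The coefficient of h^m in the sum of c k * (v + h)^k. *)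
Definition tcoef c v m : R :=
  asum (fun k => c k * \prod_i ('C(k i, m i)%:R * v i 0 ^+ (k i - m i))).

Let binom_widen (a N : nat) (x y : R) : (a < N)%N ->
  \sum_(i < N) ('C(a, i)%:R * x ^+ (a - i)) * y ^+ i = (x + y) ^+ a.
Proof.
move=> aN; rewrite exprDn.
rewrite (big_ord_widen N (fun i => x ^+ (a - i) * y ^+ i *+ 'C(a, i))) ?ltnS//.
rewrite [RHS]big_mkcond; apply: eq_bigr => i _; rewrite ltnS.
case: leqP => [_|/bin_small ->]; last by rewrite !mul0r.
by rewrite -[RHS]mulr_natl mulrA.
Qed.

Let tF c v h k m :=
  c k * \prod_i ('C(k i, m i)%:R * v i 0 ^+ (k i - m i)) * monomial h m.

Let tF_row c v h k :
  summ (tF c v h k) /\ asum (tF c v h k) = c k * monomial (v + h) k.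
Proof.
have f0 m : ~~ in_box (deg k).+1 m -> tF c v h k m = 0.
  move=> /forallPn[i]; rewrite -leqNgt => im.
  rewrite /tF (bigD1 i)//= bin_small ?mul0r ?mulr0 ?mul0r//.
  exact: leq_ltn_trans (leq_deg k i) im.
have [s1 e1] := asum_supported f0; split=> //; rewrite e1 /box_sum.
transitivity (\sum_(m : {ffun 'I_n -> 'I_(deg k).+1}) c k *
    \prod_i (('C(k i, m i)%:R * v i 0 ^+ (k i - m i)) * h i 0 ^+ m i)).
  apply: eq_bigr => m _; rewrite /tF /monomial -mulrA -big_split/=.
  by congr (_ * _); apply: eq_bigr => i _; rewrite !ffunE.
rewrite -mulr_sumr; congr (_ * _).
rewrite -(bigA_distr_bigA (fun i j => ('C(k i, (j : 'I_(deg k).+1))%:R *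
  v i 0 ^+ (k i - j)) * h i 0 ^+ j)).
by apply: eq_bigr => i _; rewrite binom_widen ?mxE// ltnS leq_deg.
Qed.

(* With absolute values everywhere the sum of a row is again a binomial power,
   evaluated inside the polydisc of radius r + r'. *)
Let absv v : V := \col_i `|v i 0|.

Let absvD v h r r' : `|v| <= r -> `|h| <= r' -> `|absv v + absv h| <= r + r'.
Proof.
move=> vr hr; apply: mxnorm_le => [|i j].
  by rewrite addr_ge0// (le_trans _ vr, le_trans _ hr).
rewrite !mxE ger0_norm ?addr_ge0// lerD//.
- exact: le_trans (ler_mxnorm v i 0) vr.
- exact: le_trans (ler_mxnorm h i 0) hr.
Qed.

Let summ_tF c v h r r' : `|v| <= r -> `|h| <= r' -> cabs c (r + r') ->
  summ (fun km : K * K => tF c v h km.1 km.2).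
Proof.
move=> vr hr cc.
have rr : 0 <= r + r' by rewrite addr_ge0// (le_trans _ vr, le_trans _ hr).
apply: (summ_pair (G := fun k => `|c k| * (r + r') ^+ deg k)).
- by move=> k; exact: (tF_row c v h k).1.
- move=> k.
  have -> : (fun m => `|tF c v h k m|) = tF (fun k => `|c k|) (absv v) (absv h) k.
    apply/funext => m; rewrite /tF /monomial !normrM !normr_prod.
    by congr (_ * _ * _); apply: eq_bigr => i _;
      rewrite ?normrM ?normr_nat ?normrX ?mxE.
  rewrite (tF_row _ _ _ k).2 ler_wpM2l//.
  exact: le_trans (ler_norm _) (monomial_le _ (absvD vr hr)).
- exact: cabs_norm.
Qed.

(** The column m of the summable double family of the expansion, at the corner of a
    polydisc around v, is this family times a nonzero constant. *)
Lemma summ_tcoef c v r m : `|v| < r -> cabs c r ->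
  summ (fun k => c k * \prod_i ('C(k i, m i)%:R * v i 0 ^+ (k i - m i))).
Proof.
move=> vr cc; pose e := r - `|v|; have e0 : 0 < e by rewrite subr_gt0.
have := @summ_tF c v (cvec e) `|v| e (lexx _) (cvec_norm (ltW e0)).
rewrite subrKC => /(_ cc) /summ_col /(_ m) /(summZ (e ^+ deg m)^-1).
congr summ; apply/funext => k; rewrite /tF monomial_cvec mulrC mulfK//.
by rewrite expf_neq0// gt_eqF.
Qed.

(** The binomial theorem, applied inside an absolutely convergent series. *)
Lemma ps_translate c v h r : `|v| + `|h| <= r -> `|v| < r -> cabs c r ->
  summ (fun m => tcoef c v m * monomial h m) /\
  ps c (v + h) = ps (tcoef c v) h.
Proof.
move=> vhr vr cc.
have cc' : cabs c (`|v| + `|h|) by apply: cabs_le cc; rewrite addr_ge0.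
have sF := summ_tF (lexx `|v|) (lexx `|h|) cc'.
have col m : asum (fun k => tF c v h k m) = tcoef c v m * monomial h m.
  rewrite /tF /tcoef mulrC -asumZ; last exact: summ_tcoef vr cc.
  by congr asum; apply/funext => k; rewrite mulrC.
split; first by have := summ_marginal sF; under eq_fun do rewrite col.
rewrite /ps; under [in RHS]eq_fun do rewrite -col.
rewrite -(asum_exchange sF); congr asum; apply/funext => k.
by rewrite (tF_row c v h k).2.
Qed.

Lemma cabs_tcoef c v r r' : 0 <= r' -> `|v| + r' <= r -> `|v| < r -> cabs c r ->
  cabs (tcoef c v) r'.
Proof.
move=> r0 vr vr' cc; have vh : `|v| + `|cvec r'| <= r.
  by rewrite (le_trans _ vr)// lerD2l cvec_norm.
have := (ps_translate vh vr' cc).1.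
by congr summ; apply/funext => m; rewrite monomial_cvec.
Qed.

(** ** Derivative coefficients *)

(** The coefficients of the partial derivative of the series in the i-th variable. *)
Definition dcoef (i : 'I_n) c m : R := c (miD (mi1 i) m) * (m i).+1%:R.

Let tcoef1E c v i k :
  c k * \prod_j ('C(k j, mi1 i j)%:R * v j 0 ^+ (k j - mi1 i j)) =
  if mile (mi1 i) k then c k * ((k i)%:R * monomial v (miB k (mi1 i))) else 0.
Proof.
case: ifPn => [_|/forallPn[j]]; last first.
  rewrite -ltnNge ffunE; case: eqP => //= -> ki.
  by rewrite (bigD1 i)//= ffunE eqxx bin_small// mul0r mul0r mulr0.
congr (_ * _); rewrite /monomial (bigD1 i)//= [in RHS](bigD1 i)//=.
rewrite !ffunE eqxx bin1 -mulrA; congr (_ * (_ * _)).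
apply: eq_bigr => j ji; rewrite !ffunE (negbTE ji).
by rewrite bin0 mul1r.
Qed.

(** The first-order coefficient of the re-expansion at v is the termwise
    derivative of the series at v. Multiplied by the i-th coordinate of v it becomes
    the i-th part of the Euler operator, which is what radial integration needs. *)
Lemma tcoef_mi1 c v i r : `|v| < r -> cabs c r ->
  [/\ summ (fun m => dcoef i c m * monomial v m),
      tcoef c v (mi1 i) = ps (dcoef i c) v,
      summ (fun k => c k * (k i)%:R * monomial v k) &
      v i 0 * tcoef c v (mi1 i) = asum (fun k => c k * (k i)%:R * monomial v k)].
Proof.
move=> vr cc; have := summ_tcoef (mi1 i) vr cc.
under eq_fun do rewrite tcoef1E.
set f := fun k => _ => sf.
have T : tcoef c v (mi1 i) = asum f.
  by congr asum; apply/funext => k; exact: tcoef1E.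
have f0 k : ~ range (miD (mi1 i)) k -> f k = 0.
  move=> nk; rewrite /f; case: ifP => // kp.
  by case: nk; exists (miB k (mi1 i)) => //; rewrite miDB.
have [H1 H2] := summ_reindex (@miD_inj (mi1 i)) f0.
have E : f \o miD (mi1 i) = fun m => dcoef i c m * monomial v m.
  apply/funext => m; rewrite /f /= mile_D miDK /dcoef !ffunE eqxx.
  by rewrite add1n mulrA.
have E2 : (fun k => c k * (k i)%:R * monomial v k) = fun k => v i 0 * f k.
  apply/funext => k; rewrite /f; case: ifPn => [ik|].
    by rewrite -{3}(miDB ik) monomialD monomial1; ring.
  move=> /forallPn[j]; rewrite -ltnNge ffunE; case: eqP => //= ->.
  by rewrite ltnS leqn0 => /eqP ->; rewrite !mulr0 mul0r.
rewrite E in H1 H2; rewrite T E2; split => //; first by apply/H1.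
- exact: summZ.
- by rewrite asumZ.
Qed.

Lemma cabs_dcoef i c r r' : 0 <= r' -> r' < r -> cabs c r -> cabs (dcoef i c) r'.
Proof.
move=> r0 rr cc; have vr : `|cvec r'| < r by rewrite (le_lt_trans (cvec_norm r0)).
have [+ _ _ _] := tcoef_mi1 i vr cc.
by under eq_fun do rewrite monomial_cvec.
Qed.

End PowerSeries.

(** * Functions with a power series expansion *)

Section Analytic.
Context {R : realType} {n : nat}.
Notation V := 'cV[R]_n.
Notation K := {ffun 'I_n -> nat}.
Implicit Types (c d : K -> R) (a h v w : V) (r : R) (f g : V -> R).

Definition has_ps a r c f : Prop :=
  [/\ 0 < r, cabs c r & forall h, `|h| < r -> f (a + h) = ps c h].

Definition ana a f : Prop := exists c r, has_ps a r c f.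

Lemma has_ps_le a r r' c f : 0 < r' <= r -> has_ps a r c f -> has_ps a r' c f.
Proof.
move=> /andP[r0 rr] [_ cc E]; split=> // [|h hr].
  by apply: cabs_le cc; rewrite ltW.
by apply: E; exact: lt_le_trans hr rr.
Qed.

Lemma near_ball a (P : V -> Prop) :
  (\near a, P a) -> exists2 r, 0 < r & forall h, `|h| < r -> P (a + h).
Proof.
move=> /nbhs_ballP[r /= r0 H]; exists r => // h hr; apply: H.
by rewrite -ball_normE /ball_/= opprD addrA subrr sub0r normrN.
Qed.

Lemma near_of_ball a (P : V -> Prop) r :
  0 < r -> (forall h, `|h| < r -> P (a + h)) -> \near a, P a.
Proof.
move=> r0 H; apply/nbhs_ballP; exists r => //= y.
rewrite -ball_normE /ball_/= distrC => ay.
by have := H _ ay; rewrite subrKC.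
Qed.

Lemma ana_ext a f g : (\near a, f a = g a) -> ana a f -> ana a g.
Proof.
move=> /near_ball[r r0 E] [c [r' H]]; exists c, (Num.min r r').
have [r'0 _ _] := H.
have : has_ps a (Num.min r r') c f.
  by apply: has_ps_le H; rewrite lt_min r0 r'0 /= ge_min lexx orbT.
move=> [m0 cc Ef]; split=> // h hm; rewrite -Ef// E//.
by apply: lt_le_trans hm _; rewrite ge_min lexx.
Qed.

Lemma has_ps_common a c d r r' f g : has_ps a r c f -> has_ps a r' d g ->
  exists s, has_ps a s c f /\ has_ps a s d g.
Proof.
move=> H1 H2; exists (Num.min r r').
have [r0 _ _] := H1; have [r'0 _ _] := H2.
by split; [apply: has_ps_le H1|apply: has_ps_le H2];
  rewrite lt_min r0 r'0/= ge_min lexx ?orbT.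
Qed.

Lemma anaD a f g : ana a f -> ana a g -> ana a (fun v => f v + g v).
Proof.
move=> [c [r H1]] [d [r' H2]].
have [s [[s0 cc Ef] [_ cd Eg]]] := has_ps_common H1 H2.
exists (fun k => c k + d k), s; split=> // [|h hs].
  by rewrite /cabs; under eq_fun do rewrite mulrDl; exact: summD.
rewrite Ef// Eg// /ps -asumD; first by under eq_fun do rewrite -mulrDl.
- exact: summ_ps (ltW hs) cc.
- exact: summ_ps (ltW hs) cd.
Qed.

Lemma anaM a f g : ana a f -> ana a g -> ana a (fun v => f v * g v).
Proof.
move=> [c [r H1]] [d [r' H2]].
have [s [[s0 cc Ef] [_ cd Eg]]] := has_ps_common H1 H2.
exists (conv c d), s; split=> // [|h hs]; first exact: cabs_conv.
rewrite Ef// Eg// (ps_mul _ _).2//.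
- exact: summ_ps (ltW hs) cc.
- exact: summ_ps (ltW hs) cd.
Qed.

Lemma ana_cst a (x : R) : ana a (fun=> x).
Proof.
pose c (k : K) := if k == mi0 then x else 0.
have c0 k : k != mi0 -> c k = 0 by rewrite /c => /negbTE ->.
exists c, 1; split=> // [|h _].
  by apply: (summ_single (k0 := mi0) _).1 => k /c0 ->; rewrite mul0r.
rewrite /ps (summ_single (k0 := mi0) _).2 => [|k /c0 ->]; last by rewrite mul0r.
by rewrite monomial0 mulr1 /c eqxx.
Qed.

Lemma ana_coord a i : ana a (fun v => v i 0).
Proof.
apply: (@ana_ext _ (fun v => a i 0 + (v - a) i 0)).
  by apply: (near_of_ball ltr01) => h _; rewrite !mxE subrKC.
apply: anaD; first exact: ana_cst.
pose c (k : K) := (k == mi1 i)%:R : R.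
have c0 k : k != mi1 i -> c k = 0 by rewrite /c => /negbTE ->.
exists c, 1; split=> // [|h _].
  by apply: (summ_single (k0 := mi1 i) _).1 => k /c0 ->; rewrite mul0r.
rewrite /ps (summ_single (k0 := mi1 i) _).2 => [|k /c0 ->]; last by rewrite mul0r.
by rewrite monomial1 /c eqxx mul1r addrC addKr.
Qed.

Lemma anaN a f : ana a f -> ana a (fun v => - f v).
Proof.
by move=> /(anaM (ana_cst a (-1))); under eq_fun do rewrite mulN1r.
Qed.

Lemma ana_sum (I : Type) (s : seq I) (F : I -> V -> R) a :
  (forall i, ana a (F i)) -> ana a (fun v => \sum_(i <- s) F i v).
Proof.
move=> aF; elim: s => [|i s IH].
  by under eq_fun do rewrite big_nil; exact: ana_cst.
by under eq_fun do rewrite big_cons; exact: anaD.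
Qed.

Lemma ana_prod (I : Type) (s : seq I) (F : I -> V -> R) a :
  (forall i, ana a (F i)) -> ana a (fun v => \prod_(i <- s) F i v).
Proof.
move=> aF; elim: s => [|i s IH].
  by under eq_fun do rewrite big_nil; exact: ana_cst.
by under eq_fun do rewrite big_cons; exact: anaM.
Qed.

(** ** Differentiability at the centre *)

(** A remainder of second order does not affect differentiability and derivatives. *)
Lemma differentiable_quad a g (C r : R) : 0 < r ->
  (forall h, `|h| < r -> `|g (a + h)| <= C * `|h| ^+ 2) ->
  differentiable g a /\ forall w, 'D_w g a = 0.
Proof.
move=> r0 H.
have g0 : g a = 0.
  by apply/eqP; rewrite -normr_le0; have := H 0; rewrite addr0 normr0 expr0n/= mulr0; exact.
have E : g \o shift a = cst (g a) + (0 : V -> R) +o_ (0 : V) id.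
  apply/eqaddoP => e e0 /=.
  pose r' := Num.min r (e / (`|C| + 1)).
  have C0 : 0 < `|C| + 1 by rewrite ltr_wpDl.
  have r'0 : 0 < r' by rewrite lt_min r0 divr_gt0.
  apply: (@near_of_ball _ _ r') => // h hr; rewrite add0r.
  rewrite /= /cst !fctE g0 addr0 subr0 addrC.
  have hr1 : `|h| < r by apply: lt_le_trans hr _; rewrite ge_min lexx.
  have hr2 : `|h| < e / (`|C| + 1).
    by apply: lt_le_trans hr _; rewrite ge_min lexx orbT.
  apply: le_trans (H h hr1) _; rewrite expr2 mulrA ler_wpM2r//.
  apply: (@le_trans _ _ ((`|C| + 1) * `|h|)).
    by rewrite ler_wpM2r// (le_trans (ler_norm C))// lerDl.
  by rewrite mulrC -ler_pdivlMr// ltW.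
have D : 'd g a = (0 : V -> R) :> (V -> R).
  by apply: diff_unique => //; exact: cst_continuous.
have dg : differentiable g a.
  apply/diff_locallyP; split; first by rewrite D; exact: cst_continuous.
  by rewrite D.
by split=> // w; rewrite deriveE// D.
Qed.

(** A monomial of degree d >= 2 is at most |h|^2 * r^(d - 2). *)
Lemma ps_tail c r h : 0 < r -> cabs c r -> `|h| < r ->
  `|ps c h - (c mi0 + \sum_i c (mi1 i) * h i 0)| <=
    cnorm c r / r ^+ 2 * `|h| ^+ 2.
Proof.
move=> r0 cc hr.
pose lo (k : K) := if (deg k <= 1)%N then c k else 0.
pose hi (k : K) := if (deg k <= 1)%N then 0 else c k.
have lo0 k : ~~ in_box 2 k -> lo k * monomial h k = 0.
  move=> /forallPn[i]; rewrite -leqNgt => ki; rewrite /lo.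
  by rewrite leqNgt (leq_trans ki (leq_deg k i)) mul0r.
have [slo elo] := asum_supported lo0.
have sc := summ_ps (ltW hr) cc.
have E : (fun k => hi k * monomial h k) =
    (fun k => c k * monomial h k - lo k * monomial h k).
  by apply/funext => k; rewrite /hi /lo; case: ifP => _; ring.
have lin : asum (fun k => lo k * monomial h k) = c mi0 + \sum_i c (mi1 i) * h i 0.
  pose e0 (k : K) := if k == mi0 then c mi0 else 0.
  pose e1 (i : 'I_n) (k : K) := if k == mi1 i then c (mi1 i) * h i 0 else 0.
  have e00 k : k != mi0 -> e0 k = 0 by rewrite /e0 => /negbTE ->.
  have e10 i k : k != mi1 i -> e1 i k = 0 by rewrite /e1 => /negbTE ->.
  have -> : (fun k => lo k * monomial h k) = fun k => e0 k + \sum_i e1 i k.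
    apply/funext => k; rewrite /lo leq_eqVlt ltnS leqn0.
    have [/eqP/deg_eq0 ->|k0] := boolP (deg k == 0)%N.
      rewrite deg0/= monomial0 mulr1 /e0 eqxx big1 ?addr0// => i _.
      by apply: e10; apply/eqP => /(congr1 deg); rewrite deg0 deg1.
    have k0' : k != mi0 by apply: contraNneq k0 => ->; rewrite deg0.
    rewrite orbF e00// add0r.
    have [/eqP/deg_eq1[i ->]|k1] := boolP (deg k == 1)%N.
      rewrite monomial1 (bigD1 i)//= {1}/e1 eqxx big1 ?addr0// => j ji.
      apply: e10; apply/eqP => /ffunP/(_ i); rewrite !ffunE eqxx.
      by rewrite eq_sym (negbTE ji).
    rewrite mul0r big1// => i _; apply: e10; apply: contraNneq k1 => ->.
    by rewrite deg1.
  have [s0 a0] := summ_single e00.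
  have s1 i := (summ_single (e10 i)).1.
  rewrite asumD//; last exact: summ_bigsum.
  rewrite a0 asum_bigsum//; congr (_ + _); first by rewrite /e0 eqxx.
  by apply: eq_bigr => i _; rewrite (summ_single (e10 i)).2 /e1 eqxx.
have -> : ps c h - (c mi0 + \sum_i c (mi1 i) * h i 0) =
    asum (fun k => hi k * monomial h k).
  by rewrite E asumB// lin.
have := cabs_norm (ltW r0) cc => scn.
rewrite -mulrA mulrC /cnorm -asumZ//; apply: asum_norm_le; last exact: summZ.
move=> k; rewrite /hi; case: leqP => [_|k2].
  by rewrite mul0r normr0 mulr_ge0// ?mulr_ge0 ?invr_ge0 ?exprn_ge0// ltW.
rewrite normrM mulrCA ler_wpM2l//.
apply: le_trans (monomial_le k (lexx _)) _.
rewrite -(subnK k2) !exprD.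
rewrite (_ : r ^- 2 * `|h| ^+ 2 * _ = r ^+ (deg k - 2) * `|h| ^+ 2).
  by rewrite ler_wpM2r ?exprn_ge0// lerXn2r ?nnegrE// ltW.
by field; exact: lt0r_neq0.
Qed.

(** Up to a remainder of second order the function is its affine part. *)
Lemma has_ps_derive a r c f : has_ps a r c f ->
  differentiable f a /\ forall w, 'D_w f a = \sum_i w i 0 * c (mi1 i).
Proof.
move=> [r0 cc E].
pose L v : R := c mi0 + \sum_i c (mi1 i) * (v - a) i 0.
have dcoord i : differentiable (fun v : V => (v - a) i 0) a /\
    forall w, 'D_w (fun v : V => (v - a) i 0) a = w i 0.
  have -> : (fun v : V => (v - a) i 0) = (fun v : V => v i 0) - cst (a i 0).
    by apply/funext => v; rewrite !fctE !mxE.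
  have dc : differentiable (fun v : V => v i 0 : R) a by exact: differentiable_coord.
  split; first exact: differentiableB.
  move=> w; rewrite deriveB//; first last.
  - exact: diff_derivable.
  rewrite derive_cst subr0.
  have did : derivable (id : V -> V) a w by exact: derivable_id.
  by have /matrixP/(_ i 0) := derive_mx did; rewrite derive_id mxE => ->.
have dL : differentiable L a /\ forall w, 'D_w L a = \sum_i w i 0 * c (mi1 i).
  have -> : L = cst (c mi0) + \sum_i (c (mi1 i) *: (fun v : V => (v - a) i 0)).
    apply/funext => v; rewrite /L !fctE; congr (_ + _).
    by rewrite fct_sumE.
  have ds i : differentiable (c (mi1 i) *: (fun v : V => (v - a) i 0)) a.
    by apply: differentiableZ; exact: (dcoord i).1.
  split; first by apply: differentiableD => //; exact: differentiable_sum.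
  move=> w; rewrite deriveD//; first last.
  - by apply: diff_derivable; exact: differentiable_sum.
  rewrite derive_cst add0r derive_sum; last by move=> i; exact: diff_derivable.
  apply: eq_bigr => i _; rewrite deriveZ; last exact: diff_derivable (dcoord i).1.
  by rewrite (dcoord i).2 mulrC.
have Q h : `|h| < r -> `|(f \- L) (a + h)| <= cnorm c r / r ^+ 2 * `|h| ^+ 2.
  by move=> hr; rewrite /= E// /L addrAC subrr add0r; exact: ps_tail.
have [dg Dg] := differentiable_quad r0 Q.
have -> : f = L + (f \- L) by apply/funext => v; rewrite !fctE subrKC.
split; first by apply: differentiableD => //; exact: dL.1.
move=> w; rewrite deriveD; [|exact: diff_derivable dL.1|exact: diff_derivable].
by rewrite dL.2 Dg addr0.
Qed.

Lemma has_ps_translate a r c f v : `|v| < r -> has_ps a r c f ->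
  has_ps (a + v) (r - `|v|) (tcoef c v) f.
Proof.
move=> vr [r0 cc E]; have e0 : 0 < r - `|v| by rewrite subr_gt0.
split=> // [|h hr]; first by apply: (cabs_tcoef (ltW e0) _ vr cc); rewrite subrKC.
have vh : `|v| + `|h| < r by rewrite -ltrBrDl.
rewrite -addrA E ?(le_lt_trans (ler_normD _ _))//.
exact: (ps_translate (ltW vh) vr cc).2.
Qed.

Lemma ana_near a f : ana a f -> \near a, ana a f.
Proof.
move=> [c [r H]]; have [r0 _ _] := H.
apply: (near_of_ball r0) => h hr; exists (tcoef c h), (r - `|h|).
exact: has_ps_translate.
Qed.

Lemma ana_differentiable a f : ana a f -> differentiable f a.
Proof. by move=> [c [r /has_ps_derive[]]]. Qed.

Lemma has_ps_deriveE a r c f v w : `|v| < r -> has_ps a r c f ->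
  'D_w f (a + v) = \sum_i w i 0 * ps (dcoef i c) v.
Proof.
move=> vr H; rewrite (has_ps_derive (has_ps_translate vr H)).2.
have [_ cc _] := H.
by apply: eq_bigr => i _; have [_ -> _ _] := tcoef_mi1 i vr cc.
Qed.

Lemma has_ps_derive_ps a r r' c f w : 0 < r' < r -> has_ps a r c f ->
  has_ps a r' (fun k => \sum_i w i 0 * dcoef i c k) (fun v => 'D_w f v).
Proof.
move=> /andP[r'0 rr] H; have [r0 cc E] := H.
have cd i : cabs (dcoef i c) r' by exact: cabs_dcoef (ltW r'0) rr cc.
split=> // [|h hr].
  rewrite /cabs; under eq_fun do rewrite mulr_suml.
  apply: summ_bigsum => i; under eq_fun do rewrite -mulrA.
  by apply: summZ; exact: cd.
rewrite (has_ps_deriveE _ (lt_trans hr rr) H) /ps.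
under [X in _ = asum X]eq_fun do rewrite mulr_suml.
have sd i := summ_ps (ltW hr) (cd i).
rewrite asum_bigsum; last first.
  by move=> i; under eq_fun do rewrite -mulrA; apply: summZ; exact: sd.
apply: eq_bigr => i _; under [X in _ = asum X]eq_fun do rewrite -mulrA.
by rewrite asumZ.
Qed.

Lemma ana_derive a f w : ana a f -> ana a (fun v => 'D_w f v).
Proof.
move=> [c [r H]]; have [r0 _ _] := H.
exists (fun k => \sum_i w i 0 * dcoef i c k), (r / 2).
by apply: has_ps_derive_ps H; rewrite divr_gt0//= gtr_pMr// invf_lt1// ltr1n.
Qed.

(** Both iterated derivatives read off the coefficient at mi1 i + mi1 j. *)
Lemma ana_deriveC a f w w' : ana a f ->
  'D_w (fun v => 'D_w' f v) a = 'D_w' (fun v => 'D_w f v) a.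
Proof.
move=> [c [r H]]; have [r0 _ _] := H.
have r2 : 0 < r / 2 < r by rewrite divr_gt0//= gtr_pMr// invf_lt1// ltr1n.
rewrite (has_ps_derive (has_ps_derive_ps w' r2 H)).2.
rewrite (has_ps_derive (has_ps_derive_ps w r2 H)).2.
under eq_bigr do rewrite mulr_sumr; rewrite exchange_big/=.
apply: eq_bigr => i _; rewrite mulr_sumr; apply: eq_bigr => j _.
rewrite /dcoef (miDC (mi1 i)) !ffunE eq_sym; ring.
Qed.

End Analytic.

(** ** Inverses *)

Section Inverse.
Context {R : realType} {n : nat}.
Notation V := 'cV[R]_n.
Notation K := {ffun 'I_n -> nat}.
Implicit Types (c d u : K -> R) (a h v w : V) (f g : V -> R).

Lemma asum_geometric (x : R) : `|x| < 1 ->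
  summ (fun j : nat => x ^+ j) /\ asum (fun j : nat => x ^+ j) = (1 - x)^-1.
Proof.
move=> x1.
have d0 : 0 < 1 - `|x| by rewrite subr_gt0.
have sx : summ (fun j : nat => x ^+ j).
  apply: (@le_lt_trans _ _ ((1 - `|x|)^-1)%:E); last by rewrite ltry.
  rewrite -(@nneseries_esumT _ (fun j => `|x ^+ j|%:E))//.
  apply: lime_le; first by apply: is_cvg_nneseries => *.
  apply: nearW => N; rewrite sumEFin lee_fin.
  rewrite big_mkord; under eq_bigr do rewrite normrX.
  rewrite -[leRHS]mul1r ler_pdivlMr// mulrC -[1 - `|x|]opprB mulNr -subrX1 opprB.
  by rewrite lerBlDr lerDl exprn_ge0.
split=> //.
have x1' : 1 - x != 0.
  by rewrite subr_eq0; apply: contraTneq x1 => <-; rewrite normr1 ltxx.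
pose e (j : nat) : R := if j is 0 then 1 else 0.
pose t (j : nat) := if j is 0 then 0 else x ^+ j.
have e0 j : j != 0%N -> e j = 0 by case: j.
have t0 j : ~ range S j -> t j = 0 by case: j => // j []; exists j.
have [st et] := summ_reindex succn_inj t0.
have [se ee] := summ_single e0.
have E : asum (fun j : nat => x ^+ j) = 1 + x * asum (fun j : nat => x ^+ j).
  rewrite -asumZ//.
  have -> : (fun j => x * x ^+ j) = t \o S by apply/funext => j; rewrite /= exprS.
  have -> : 1 = asum e by rewrite ee.
  rewrite -et -asumD//; last first.
    apply/st; have -> : t \o S = fun j => x * x ^+ j by apply/funext => j; rewrite /= exprS.
    exact: summZ.
  by congr asum; apply/funext => -[|j]; rewrite /= ?expr0 ?addr0 ?add0r.
apply: (mulfI x1'); rewrite mulfV// mulrBl mul1r {1}E; ring.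
Qed.

Fixpoint ps_pow u (j : nat) : K -> R :=
  if j is j'.+1 then conv u (ps_pow u j') else fun k => (k == mi0)%:R.

Lemma cabs_pow u r j : 0 <= r -> cabs u r -> cabs (ps_pow u j) r /\
  cnorm (ps_pow u j) r <= cnorm u r ^+ j.
Proof.
move=> r0 cu; elim: j => [|j [IH1 IH2]] /=.
  have z (k : K) : k != mi0 -> (k == mi0)%:R * r ^+ deg k = 0.
    by move=> /negbTE ->; rewrite mul0r.
  split; first exact: (summ_single z).1.
  rewrite /cnorm (summ_single (k0 := mi0) _).2; last first.
    by move=> k /negbTE ->; rewrite normr0 mul0r.
  by rewrite eqxx deg0 normr1 mulr1.
split; first exact: cabs_conv.
apply: le_trans (cnorm_conv r0 cu IH1) _.
by rewrite exprS ler_wpM2l// cnorm_ge0.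
Qed.

Lemma ps_powE u r h j : `|h| <= r -> cabs u r ->
  ps (ps_pow u j) h = ps u h ^+ j.
Proof.
move=> hr cu; have r0 : 0 <= r by rewrite (le_trans _ hr).
elim: j => [|j IH] /=.
  rewrite /ps (summ_single (k0 := mi0) _).2; last first.
    by move=> k /negbTE ->; rewrite mul0r.
  by rewrite eqxx monomial0 mulr1.
rewrite (ps_mul (summ_ps hr cu) (summ_ps hr (cabs_pow j r0 cu).1)).2.
by rewrite IH exprS.
Qed.

Lemma ps_norm c h r : `|h| <= r -> cabs c r -> `|ps c h| <= cnorm c r.
Proof.
move=> hr cc; have r0 : 0 <= r by rewrite (le_trans _ hr).
apply: asum_norm_le; last exact: cabs_norm.
by move=> k; rewrite normrM ler_wpM2l// monomial_le.
Qed.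

Lemma asum_norm_monomial c h r : `|h| <= r -> cabs c r ->
  asum (fun k => `|c k * monomial h k|) <= cnorm c r.
Proof.
move=> hr cc; have r0 : 0 <= r by rewrite (le_trans _ hr).
apply: ler_asum.
- exact: summ_norm (summ_ps hr cc).
- exact: cabs_norm.
- by move=> k; rewrite normrM ler_wpM2l// monomial_le.
Qed.

(** The Neumann series, rearranged by powers of the variable. *)
Lemma ps_inv u r : 0 < r -> cabs u r -> cnorm u r < 1 ->
  exists e, cabs e r /\ forall h, `|h| <= r -> ps e h = (1 - ps u h)^-1.
Proof.
move=> r0 cu u1; have r0' := ltW r0.
pose F h (j : nat) k := ps_pow u j k * monomial h k.
have q1 : `|cnorm u r| < 1 by rewrite ger0_norm// cnorm_ge0.
have sF h : `|h| <= r -> summ (fun jk : nat * K => F h jk.1 jk.2).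
  move=> hr; apply: (summ_pair (G := fun j => cnorm u r ^+ j)).
  - by move=> j; exact: summ_ps hr (cabs_pow j r0' cu).1.
  - move=> j; apply: le_trans (cabs_pow j r0' cu).2.
    exact: asum_norm_monomial (cabs_pow j r0' cu).1.
  - exact: (asum_geometric q1).1.
pose g k := asum (fun j => ps_pow u j k).
have cr : `|cvec r : V| <= r by exact: cvec_norm.
have sp k : summ (fun j => ps_pow u j k).
  have := summ_col (sF _ cr) k; rewrite /F.
  move=> /(summZ (r ^+ deg k)^-1); congr summ; apply/funext => j.
  by rewrite monomial_cvec mulrC mulfK// expf_neq0// gt_eqF.
have col h k : asum (fun j => F h j k) = g k * monomial h k.
  by rewrite mulrC -asumZ//; congr asum; apply/funext => j; rewrite mulrC.
exists g; split.
  have := summ_marginal (sF _ cr); congr summ; apply/funext => k.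
  by rewrite col monomial_cvec.
move=> h hr; have h1 : `|ps u h| < 1 by exact: le_lt_trans (ps_norm hr cu) u1.
rewrite -(asum_geometric h1).2 /ps; under eq_fun do rewrite -col.
rewrite -(asum_exchange (sF h hr)); congr asum; apply/funext => j.
exact: ps_powE hr cu.
Qed.

(** Without constant term, the norm tends to 0 with the radius. *)
Lemma cnorm_small u r : 0 < r -> cabs u r -> u mi0 = 0 ->
  exists2 r', 0 < r' <= r & cnorm u r' < 1.
Proof.
move=> r0 cu u0; have C0 := cnorm_ge0 u (ltW r0).
pose t := (cnorm u r + 1)^-1.
have C1 : 0 < cnorm u r + 1 by rewrite ltr_wpDl.
have t0 : 0 < t by rewrite invr_gt0.
have t1 : t <= 1 by rewrite invf_le1// lerDr.
have tr0 : 0 <= t * r by rewrite mulr_ge0// ltW.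
have tr : t * r <= r by rewrite ler_piMl// ltW.
exists (t * r); first by rewrite mulr_gt0.
apply: (@le_lt_trans _ _ (t * cnorm u r)); last first.
  by rewrite mulrC ltr_pdivrMr// mul1r ltrDl.
have cn := cabs_norm (ltW r0) cu.
rewrite /cnorm -asumZ//; apply: ler_asum.
- by apply: cabs_norm => //; apply: cabs_le cu; rewrite tr0.
- exact: summZ.
- move=> k; have [->|k0] := eqVneq k mi0; first by rewrite u0 normr0 !mul0r mulr0.
  have : (0 < deg k)%N.
    by rewrite lt0n; apply: contraNneq k0 => /deg_eq0 ->.
  case: (deg k) => // e _; rewrite mulrCA ler_wpM2l// exprMn.
  apply: ler_wpM2r; first by rewrite exprn_ge0// ltW.
  have t0' := ltW t0; rewrite exprS; apply: ler_piMr => //; exact: exprn_ile1.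
Qed.

(** Up to the factor f a, the function is 1 - u for a series u without constant
    term, to which the Neumann series applies on a small polydisc. *)
Lemma anaV a f : ana a f -> f a != 0 -> ana a (fun v => (f v)^-1).
Proof.
move=> [c [r H]] fa0; have [r0 cc E] := H.
have c0 : c mi0 = f a by rewrite -ps_at0 -E ?normr0// addr0.
pose u (k : K) := if k == mi0 then 0 else - (f a)^-1 * c k.
have uE : u = fun k => (k == mi0)%:R + - (f a)^-1 * c k.
  apply/funext => k; rewrite /u; case: eqP => [->|_]; last by rewrite add0r.
  by rewrite c0 mulNr mulVf// subrr.
have z (k : K) r' : k != mi0 -> (k == mi0)%:R * r' = 0 :> R.
  by move=> /negbTE ->; rewrite mul0r.
have cu : cabs u r.
  rewrite /cabs uE; under eq_fun do rewrite mulrDl -mulrA.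
  by apply: summD; [exact: (summ_single (fun k => z k _)).1|exact: summZ].
have u0 : u mi0 = 0 by rewrite /u eqxx.
have [r' /andP[r'0 rr] u1] := cnorm_small r0 cu u0.
have cu' : cabs u r' by apply: cabs_le cu; rewrite ltW.
have [g [cg Eg]] := ps_inv r'0 cu' u1.
apply: (@ana_ext _ _ _ (fun v => (f a)^-1 * (f v * (f a)^-1)^-1)).
  by apply: (near_of_ball ltr01) => h _; rewrite invfM invrK mulrA mulrAC mulVf// mul1r.
apply: anaM; first exact: ana_cst.
exists g, r'; split=> // h hr; rewrite Eg ?ltW// E; last exact: lt_le_trans hr rr.
congr (_^-1); rewrite {2}/ps uE.
have sc := summ_ps (ltW (lt_le_trans hr rr)) cc.
under [X in _ = 1 - asum X]eq_fun do rewrite mulrDl -mulrA.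
rewrite asumD; [|exact: (summ_single (fun k => z k _)).1|exact: summZ].
rewrite (summ_single (fun k => z k _)).2 asumZ// eqxx monomial0 mulr1.
rewrite -/(ps c h) [true%:R]mulr1n; ring.
Qed.

Lemma ana_det p (M : V -> 'M[R]_p) a :
  (forall i j, ana a (fun v => M v i j)) -> ana a (fun v => \det (M v)).
Proof.
move=> aM; rewrite /determinant; apply: ana_sum => s.
by apply: anaM; [exact: ana_cst|apply: ana_prod => i].
Qed.

Lemma ana_unitmx_near p (M : V -> 'M[R]_p) a :
  (forall i j, ana a (fun v => M v i j)) -> M a \in unitmx ->
  \near a, M a \in unitmx.
Proof.
move=> aM; rewrite unitmxE unitfE => d0.
have dc := differentiable_continuous (ana_differentiable (ana_det aM)).
have : \forall v \near a, \det (M v) != 0 by exact: cvgr_neq0 dc d0.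
by apply: filterS => v /=; rewrite unitmxE unitfE.
Qed.

(** Cramer's rule reduces the inverse matrix to determinants and one inverse. *)
Lemma ana_invmx p (M : V -> 'M[R]_p) a i j :
  (forall i j, ana a (fun v => M v i j)) -> M a \in unitmx ->
  ana a (fun v => invmx (M v) i j).
Proof.
move=> aM Ma; apply: (@ana_ext _ _ _ (fun v => (\det (M v))^-1 * (\adj (M v)) i j)).
  have := ana_unitmx_near aM Ma.
  by apply: filterS => v Mv; rewrite /invmx Mv [RHS]mxE.
apply: anaM; first by apply: anaV; [exact: ana_det|rewrite -unitfE -unitmxE].
under eq_fun do rewrite mxE /cofactor.
apply: anaM; first exact: ana_cst.
apply: ana_det => k l; under eq_fun do rewrite !mxE; exact: aM.
Qed.

End Inverse.

(** ** Vector-valued analytic maps and smooth maps *)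

Section Smooth.
Context {R : realType} {n : nat}.
Notation V := 'cV[R]_n.
Implicit Types (U : set V) (a h v w : V).

Lemma cvg_mxE p q (T : Type) (F : set_system T) {FF : Filter F}
    (f : T -> 'M[R]_(p, q)) (L : 'M[R]_(p, q)) :
  (forall i j, f x i j @[x --> F] --> L i j) -> f @ F --> L.
Proof.
move=> H; apply/cvgrPdist_le => e e0; near=> x.
apply: mxnorm_le; first exact: ltW.
move=> i j; rewrite !mxE; move: i j; near: x.
apply: filter_forall => i; apply: filter_forall => j.
exact: (cvgrPdist_le _ _).1 (H i j) _ e0.
Unshelve. all: by end_near. Qed.

Lemma cvg_mx_entry p q (T : Type) (F : set_system T)
    (f : T -> 'M[R]_(p, q)) (L : 'M[R]_(p, q)) i j :
  f @ F --> L -> f x i j @[x --> F] --> L i j.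
Proof.
move=> fL; have := @coord_continuous R p q i j L.
exact: cvg_comp fL.
Qed.

Lemma box_sum_entry p q (F : {ffun 'I_n -> nat} -> 'M[R]_(p, q)) N i j :
  box_sum F N i j = box_sum (fun k => F k i j) N.
Proof. by rewrite /box_sum summxE. Qed.

Let eq_box_cvg (f g : {ffun 'I_n -> nat} -> R) : (forall k, f k = g k) ->
  cvgn (box_sum f) -> cvgn (box_sum g).
Proof. by move=> /funext ->. Qed.

(** The entries of a matrix are bounded by its norm and the norm by the sum of the
    entries, so convergence of box sums in norm is summability of every entry. *)
Lemma real_analytic_mxP U p q (F : V -> 'M[R]_(p, q)) :
  real_analytic U F <-> forall a, U a -> forall i j, ana a (fun v => F v i j).
Proof.
split=> [H a Ua i j|H a Ua].
  have [c [r [r0 Hc]]] := H a Ua.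
  have r20 : 0 < r / 2 by rewrite divr_gt0.
  have r2 : r / 2 < r by rewrite gtr_pMr// invf_lt1// ltr1n.
  (* The corner of the polydisc of radius r lies outside the open polydisc of the
     hypothesis; the corner of the one of radius r / 2 does not. *)
  exists (fun k => c k i j), (r / 2); split=> // [|h hr].
    have hc : `|cvec (r / 2) : V| < r by apply: le_lt_trans r2; apply: cvec_norm; exact: ltW.
    have [cv _] := Hc _ hc.
    have : summ (fun k => `|monomial (cvec (r / 2)) k *: c k|).
      by apply: summ_of_cvg_box; apply: eq_box_cvg cv => k; rewrite normr_id.
    apply: summ_le => k; rewrite -monomial_cvec mulrC.
    by have := ler_mxnorm (monomial (cvec (r / 2)) k *: c k) i j; rewrite mxE.
  have [cv lim] := Hc h (lt_trans hr r2).
  have sf : summ (fun k => c k i j * monomial h k).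
    apply: (@summ_le _ _ _ (fun k => `|monomial h k *: c k|)).
      move=> k; rewrite mulrC.
      by have := ler_mxnorm (monomial h k *: c k) i j; rewrite mxE.
    by apply: summ_of_cvg_box; apply: eq_box_cvg cv => k; rewrite normr_id.
  have A := cvg_mx_entry (i := i) (j := j) lim.
  rewrite -(cvg_lim (@Rhausdorff R) A); apply: (cvg_lim (@Rhausdorff R)).
  rewrite (_ : (fun x => _) = box_sum (fun k => c k i j * monomial h k)).
    exact: (box_sum_cvg sf).2.
  apply/funext => N; rewrite box_sum_entry.
  by congr box_sum; apply/funext => k; rewrite mxE mulrC.
have /choice[c0 Hc0] : forall ij : 'I_p * 'I_q, exists cr :
    ({ffun 'I_n -> nat} -> R) * R, has_ps a cr.2 cr.1 (fun v => F v ij.1 ij.2).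
  by move=> [i j]; have [c [r Hc]] := H a Ua i j; exists (c, r).
pose r := \big[Num.min/1]_ij (c0 ij).2.
have r0 : 0 < r.
  apply: (big_ind (fun x : R => 0 < x)) => // [x y x0 y0|ij _].
    by rewrite lt_min x0.
  by have [] := Hc0 ij.
have Hr ij : has_ps a r (c0 ij).1 (fun v => F v ij.1 ij.2).
  by apply: has_ps_le (Hc0 ij); rewrite r0/=; exact: bigmin_le.
exists (fun k => \matrix_(i, j) (c0 (i, j)).1 k), r; split=> // h hr.
have sf i j : summ (fun k => (c0 (i, j)).1 k * monomial h k).
  by have [_ cc _] := Hr (i, j); exact: summ_ps (ltW hr) cc.
set G := fun k => _.
have GE k i j : G k i j = (c0 (i, j)).1 k * monomial h k by rewrite !mxE mulrC.
split.
  have : summ (fun k => `|G k|).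
    apply: (@summ_le _ _ _ (fun k => \sum_i \sum_j `|G k i j|)).
      move=> k; rewrite normr_id; apply: mxnorm_le => [|i j].
        by apply: sumr_ge0 => i _; exact: sumr_ge0.
      rewrite (bigD1 i)//= (bigD1 j)//= -addrA lerDl addr_ge0//.
        by rewrite sumr_ge0.
      by apply: sumr_ge0 => *; exact: sumr_ge0.
    apply: summ_bigsum => i; apply: summ_bigsum => j.
    by under eq_fun do rewrite GE; exact: summ_norm.
  by move=> /box_sum_cvg[+ _]; apply: eq_box_cvg => k; rewrite normr_id.
apply: cvg_mxE => i j.
have [_ _ E] := Hr (i, j); have /= -> := E h hr.
rewrite (_ : (fun x => _) = box_sum (fun k => (c0 (i, j)).1 k * monomial h k)).
  exact: (box_sum_cvg (sf i j)).2.
apply/funext => N; rewrite box_sum_entry.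
by congr box_sum; apply/funext => k; rewrite GE.
Qed.

Lemma differentiable_mx p q (F : V -> 'M[R]_(p, q)) a :
  (forall i j, differentiable (fun v => F v i j) a) -> differentiable F a.
Proof.
move=> dF.
have -> : F = \sum_(i < p) \sum_(j < q) (fun v => F v i j *: delta_mx i j).
  apply/funext => v; rewrite fct_sumE {1}[F v]matrix_sum_delta.
  by apply: eq_bigr => i _; rewrite fct_sumE.
apply: differentiable_sum => i; apply: differentiable_sum => j.
exact: differentiableZl.
Qed.

Lemma differentiable_entry p q (F : V -> 'M[R]_(p, q)) a i j :
  differentiable F a -> differentiable (fun v => F v i j) a.
Proof.
move=> dF; apply: (@differentiable_comp _ _ _ _ F (fun M : 'M[R]_(p, q) => M i j)) => //.
exact: differentiable_coord.
Qed.

Lemma derive_entry p q (F : V -> 'M[R]_(p, q)) a w i j : differentiable F a ->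
  'D_w F a i j = 'D_w (fun v => F v i j) a.
Proof. by move=> dF; rewrite derive_mx ?mxE//; exact: diff_derivable. Qed.

Lemma near_open U a : open U -> U a -> \near a, U a.
Proof. by move=> oU Ua; exact: open_nbhs_nbhs. Qed.

Lemma near_eq_differentiable (W : normedModType R) (f g : V -> W) a :
  (\near a, f a = g a) -> differentiable f a -> differentiable g a.
Proof.
move=> fg df; have Ea : f a = g a by exact: nbhs_singleton fg.
have E : g \o shift a = cst (g a) + 'd f a +o_ (0 : V) id.
  have /eqaddoP H := diff_locally df.
  apply/eqaddoP => e e0; have := H e e0.
  have /near_ball[r r0 Hr] := fg.
  have : \forall h \near (0 : V), f (h + a) = g (h + a).
    by apply: (near_of_ball r0) => h hr; rewrite add0r [h + a]addrC Hr.
  apply: filterS2 => h /= E1; rewrite !fctE /= /cst -E1 Ea; exact.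
have D : 'd g a = 'd f a :> (V -> W).
  by apply: diff_unique => //; exact: diff_continuous.
apply/diff_locallyP; rewrite D; split=> //; exact: diff_continuous.
Qed.

Section Ck.
Variables (U : set V) (oU : open U).

Lemma eq_Ck (W : normedModType R) k (f g : V -> W) :
  (forall v, U v -> f v = g v) -> Ck k U f -> Ck k U g.
Proof.
have near_eq (f' g' : V -> W) v : (forall v, U v -> f' v = g' v) -> U v ->
    \near v, f' v = g' v.
  by move=> E Uv; apply: filterS (near_open oU Uv) => u /E.
elim: k f g => [|k IH] f g fg /=.
  move=> cf v Uv; have fv := cf v Uv; change (f @ v --> f v) in fv.
  change (g @ v --> g v); rewrite -fg//; apply: cvg_trans fv.
  have E : {near nbhs v, f =1 g} by apply: filterS (near_open oU Uv) => u /fg.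
  exact: (near_eq_cvg E).
move=> [df Df]; split=> [v Uv|w].
  exact: near_eq_differentiable (near_eq _ _ v fg Uv) (df v Uv).
apply: IH (Df w) => v Uv; apply: near_eq_derive; exact: near_eq.
Qed.

Lemma CkS (W : normedModType R) k (f : V -> W) : Ck k.+1 U f -> Ck k U f.
Proof.
elim: k f => [|k IH] f [df Df].
  by move=> v Uv; exact: differentiable_continuous (df v Uv).
by split=> // w; apply: IH; exact: Df.
Qed.

Lemma Ck_cst (W : normedModType R) k (x : W) : Ck k U (cst x).
Proof.
elim: k x => [|k IH] x; first by move=> v _; exact: cst_continuous.
split=> [v _|w]; first exact: differentiable_cst.
by apply: (eq_Ck (f := cst 0)) => // v _; rewrite derive_cst.
Qed.

Lemma CkD k (f g : V -> R) : Ck k U f -> Ck k U g -> Ck k U (fun v => f v + g v).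
Proof.
elim: k f g => [|k IH] f g.
  by move=> cf cg v Uv; apply: continuousD; [exact: cf|exact: cg].
move=> [df Df] [dg Dg]; split=> [v Uv|w].
  by apply: differentiableD; [exact: df|exact: dg].
apply: (eq_Ck (f := fun v => 'D_w f v + 'D_w g v)); last exact: IH (Df w) (Dg w).
by move=> v Uv; rewrite deriveD//; apply: diff_derivable; [exact: df|exact: dg].
Qed.

Lemma CkM k (f g : V -> R) : Ck k U f -> Ck k U g -> Ck k U (fun v => f v * g v).
Proof.
elim: k f g => [|k IH] f g.
  by move=> cf cg v Uv; apply: continuousM; [exact: cf|exact: cg].
move=> kf kg; have [kf' kg'] := (CkS kf, CkS kg).
case: kf kg => df Df [dg Dg]; split=> [v Uv|w].
  by apply: differentiableM; [exact: df|exact: dg].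
apply: (eq_Ck (f := fun v => f v * 'D_w g v + g v * 'D_w f v)).
  by move=> v Uv; rewrite deriveM//; apply: diff_derivable; [exact: df|exact: dg].
by apply: CkD; [exact: IH (Dg w)|exact: IH (Df w)].
Qed.

Lemma Ck_mxP p q k (F : V -> 'M[R]_(p, q)) :
  Ck k U F <-> forall i j, Ck k U (fun v => F v i j).
Proof.
elim: k F => [|k IH] F.
  split=> [cF i j v Uv|cF v Uv]; first exact: cvg_mx_entry (cF v Uv).
  by apply: (@cvg_mxE _ _ _ (nbhs v)) => i j; exact: cF.
split=> [[dF DF] i j|H].
  split=> [v Uv|w]; first exact: differentiable_entry (dF v Uv).
  apply: eq_Ck ((IH _).1 (DF w) i j) => v Uv.
  by rewrite derive_entry//; exact: dF.
have dF v : U v -> differentiable F v.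
  by move=> Uv; apply: differentiable_mx => i j; exact: (H i j).1.
split=> // w; apply/IH => i j; apply: eq_Ck ((H i j).2 w) => v Uv.
by rewrite derive_entry//; exact: dF.
Qed.

Lemma ana_Ck k (f : V -> R) : (forall a, U a -> ana a f) -> Ck k U f.
Proof.
elim: k f => [|k IH] f af.
  move=> v Uv; exact: differentiable_continuous (ana_differentiable (af v Uv)).
split=> [v Uv|w]; first exact: ana_differentiable (af v Uv).
by apply: IH => a Ua; apply: ana_derive; exact: af.
Qed.

End Ck.

End Smooth.

(** * Calculus along rays and linear differential equations *)

Section Calculus.
Context {R : realType}.

Lemma is_derive_mx {V : normedModType R} p q (M : V -> 'M[R]_(p, q)) x v (dM : 'M[R]_(p, q)) :
  (forall i j, is_derive x v (fun u => M u i j) (dM i j)) -> is_derive x v M dM.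
Proof.
move=> H; have dvM : derivable M x v by apply/derivable_mxP => i j; exact: ex_derive.
apply: DeriveDef => //; rewrite derive_mx//; apply/matrixP => i j; rewrite mxE.
exact: derive_val.
Qed.

Lemma is_derive_entry {V : normedModType R} p q (M : V -> 'M[R]_(p, q)) x v
    (dM : 'M[R]_(p, q)) i j :
  is_derive x v M dM -> is_derive x v (fun u => M u i j) (dM i j).
Proof.
move=> [dvM <-]; apply: DeriveDef; first exact: (derivable_mxP M x v).1.
by rewrite derive_mx// mxE.
Qed.

Lemma is_derive_bigsum {V W : normedModType R} (I : Type) (r : seq I)
    (F : I -> V -> W) (dF : I -> W) x v :
  (forall i, is_derive x v (F i) (dF i)) ->
  is_derive x v (fun u => \sum_(i <- r) F i u) (\sum_(i <- r) dF i).
Proof.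
move=> H; elim: r => [|i r IH].
  rewrite big_nil; under eq_fun do rewrite big_nil; exact: is_derive_cst.
by rewrite big_cons; under eq_fun do rewrite big_cons; exact: is_deriveD.
Qed.

Lemma is_derive_mulr {V : normedModType R} (f g : V -> R) x v (df dg : R) :
  is_derive x v f df -> is_derive x v g dg ->
  is_derive x v (fun u => f u * g u) (df * g x + f x * dg).
Proof.
move=> Hf Hg; apply: is_derive_eq (is_deriveM Hf Hg) _.
by rewrite addrC mulrC; congr (_ + _); rewrite [RHS]mulrC.
Qed.

Lemma is_derive_mulmx {V : normedModType R} p q s (M : V -> 'M[R]_(p, q))
    (N : V -> 'M[R]_(q, s)) x v (dM : 'M[R]_(p, q)) (dN : 'M[R]_(q, s)) :
  is_derive x v M dM -> is_derive x v N dN ->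
  is_derive x v (fun u => M u *m N u) (dM *m N x + M x *m dN).
Proof.
move=> HM HN; apply: is_derive_mx => i j; under eq_fun do rewrite mxE.
rewrite !mxE -big_split; apply: is_derive_bigsum => k.
by apply: is_derive_mulr; exact: is_derive_entry.
Qed.

Lemma is_derive_addmx {V : normedModType R} p q (M N : V -> 'M[R]_(p, q)) x v
    (dM dN : 'M[R]_(p, q)) :
  is_derive x v M dM -> is_derive x v N dN ->
  is_derive x v (fun u => M u + N u) (dM + dN).
Proof. by move=> HM HN; exact: is_deriveD. Qed.

Lemma is_derive_scalemx {V : normedModType R} p q (f : V -> R)
    (M : V -> 'M[R]_(p, q)) x v (df : R) (dM : 'M[R]_(p, q)) :
  is_derive x v f df -> is_derive x v M dM ->
  is_derive x v (fun u => f u *: M u) (df *: M x + f x *: dM).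
Proof.
move=> Hf HM; apply: is_derive_mx => i j; under eq_fun do rewrite mxE.
by rewrite !mxE; apply: is_derive_mulr; exact: is_derive_entry.
Qed.

Lemma is_derive_scalet p q (M : R -> 'M[R]_(p, q)) (t : R) (dM : 'M[R]_(p, q)) :
  is_derive t 1 M dM -> is_derive t 1 (fun s => s *: M s) (M t + t *: dM).
Proof.
move=> HM; rewrite -[M t]scale1r.
exact: is_derive_scalemx (is_derive_id t 1) HM.
Qed.

Lemma is_derive_ray {V W : normedModType R} (f : V -> W) (v : V) (t : R) :
  derivable f (t *: v) v ->
  is_derive t 1 (fun s : R => f (s *: v)) ('D_v f (t *: v)).
Proof.
have E : (fun h : R => h^-1 *: (((fun s : R => f (s *: v)) \o shift t) (h *: (1 : R)) - f (t *: v))) =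
         (fun h : R => h^-1 *: ((f \o shift (t *: v)) (h *: v) - f (t *: v))).
  by apply/funext => h /=; rewrite scalerDl [h *: 1]mulr1.
move=> df; apply: DeriveDef; first by rewrite /derivable E.
by rewrite /derive E.
Qed.

Lemma is_derive_continuous {W : normedModType R} (f : R -> W) (t : R) (df : W) :
  is_derive t 1 f df -> {for t, continuous f}.
Proof.
by move=> [d _]; apply: differentiable_continuous; apply/derivable1_diffP.
Qed.

Lemma within_continuous01 (f : R -> R) :
  (forall t, 0 <= t <= 1 -> {for t, continuous f}) -> {within `[0, 1], continuous f}.
Proof.
move=> cf; apply: continuous_in_subspaceT => t; rewrite inE/= in_itv/=.
exact: cf.
Qed.

Lemma bounded01 (f : R -> R) :
  (forall t, 0 <= t <= 1 -> {for t, continuous f}) ->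
  exists M, forall t, 0 <= t <= 1 -> `|f t| <= M.
Proof.
move=> cf; have c1 := within_continuous01 cf.
have c2 : {within `[0, 1], continuous (fun t => - f t)}.
  by apply: within_continuous01 => t t01; apply: continuousN; exact: cf.
have [a _ Ha] := EVT_max ler01 c1.
have [b _ Hb] := EVT_max ler01 c2.
exists (Num.max (f a) (- f b)) => t t01.
rewrite ler_norml lerNl !le_max Ha ?Hb ?orbT//; by rewrite in_itv.
Qed.

(** Gronwall: the sum of squares, damped by an exponential, does not increase. *)
Lemma gronwall_zero (T : finType) (y dy : T -> R -> R) (C : R) :
  (forall i (t : R), 0 <= t <= 1 -> {for t, continuous (y i)}) ->
  (forall i (t : R), 0 < t < 1 -> is_derive t 1 (y i) (dy i t)) ->
  (forall i (t : R), 0 < t < 1 -> `|dy i t| <= C * \sum_j `|y j t|) ->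
  (forall i, y i 0 = 0) ->
  forall i (t : R), 0 <= t <= 1 -> y i t = 0.
Proof.
move=> cy Hd Hb y0.
wlog C0 : C Hb / 0 <= C.
  move=> H; apply: (H `|C|) => // i t t01; apply: le_trans (Hb i t t01) _.
  by rewrite ler_wpM2r ?ler_norm// sumr_ge0.
pose k := 2 * C * #|T|%:R.
pose phi (t : R) := \sum_i y i t * y i t.
pose psi (t : R) := phi t * expR (- k * t).
have phi0 t : 0 <= phi t by apply: sumr_ge0 => i _; rewrite -expr2 sqr_ge0.
have dexp (t : R) : is_derive t 1 (fun s => expR (- k * s)) (- k * expR (- k * t)).
  have h : is_derive t 1 (fun s : R => - k * s) (- k).
    apply: is_derive_eq (is_derive_mulr (is_derive_cst (- k) t 1) (is_derive_id t 1)) _.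
    by rewrite mul0r add0r mulr1.
  apply: is_derive_eq (is_derive1_comp (is_derive_expR _) h) _.
  exact: mulrC.
have dphi (t : R) : 0 < t < 1 -> is_derive t 1 phi (\sum_i (dy i t * y i t + y i t * dy i t)).
  by move=> t01; apply: is_derive_bigsum => i; apply: is_derive_mulr; exact: Hd.
have dpsi (t : R) : 0 < t < 1 -> is_derive t 1 psi
    ((\sum_i (dy i t * y i t + y i t * dy i t)) * expR (- k * t) +
     phi t * (- k * expR (- k * t))).
  by move=> t01; apply: is_derive_mulr; exact: dphi.
have le0 (t : R) : 0 < t < 1 -> derive1 psi t <= 0.
  move=> t01; rewrite derive1E (@derive_val _ _ _ _ _ _ _ (dpsi t t01)).
  rewrite mulrA -mulrDl pmulr_lle0 ?expR_gt0// mulrN subr_le0.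
  (* The inequality 2 |a b| <= a^2 + b^2 for each pair of components; counting the
     pairs gives the constant k. *)
  apply: (@le_trans _ _ (\sum_i \sum_j C * (y i t * y i t + y j t * y j t))).
    apply: ler_sum => i _; rewrite [y i t * _]mulrC -mulr2n -mulr_natl.
    apply: (@le_trans _ _ (2 * (C * \sum_j `|y j t|) * `|y i t|)).
      rewrite -mulrA ler_wpM2l//; apply: le_trans (ler_norm _) _.
      by rewrite normrM ler_wpM2r// Hb.
    rewrite -!mulrA mulrCA -mulr_sumr ler_wpM2l// mulrC mulr_suml mulr_suml.
    apply: ler_sum => j _.
    have := sqr_ge0 (`|y i t| - `|y j t|).
    rewrite sqrrB !real_normK ?num_real// => H.
    rewrite -!expr2; lra.
  rewrite le_eqVlt; apply/orP; left; apply/eqP.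
  under eq_bigr do rewrite -mulr_sumr big_split/=.
  rewrite -mulr_sumr big_split/= -/(phi t).
  under eq_bigr do rewrite sumr_const -mulr_natl.
  rewrite -mulr_sumr -/(phi t) sumr_const /k -mulr_natl; ring.
have cpsi : {within `[0, 1], continuous psi}.
  apply: within_continuous01 => t t01; apply: continuousM; last first.
    exact: is_derive_continuous (dexp t).
  rewrite /phi; have -> : (fun t => \sum_i y i t * y i t) = \sum_i (fun t => y i t * y i t).
    by rewrite fct_sumE.
  apply: (big_ind (fun f : R -> R => {for t, continuous f})).
  - exact: cst_continuous.
  - by move=> f g cf cg; exact: continuousD.
  - by move=> j _; apply: continuousM; exact: cy.
have d01 s : s \in `]0, 1[%R -> derivable psi s 1.
  by rewrite in_itv/= => s01; have [] := dpsi s s01.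
have n01 s : s \in `]0, 1[%R -> derive1 psi s <= 0.
  by rewrite in_itv/=; exact: le0.
have mono := ler0_derive1_le_cc d01 n01 cpsi.
move=> i t /[dup] t01 /andP[t0 t1].
have : psi t <= psi 0.
  by apply: mono => //; rewrite ?in_itv/= ?lexx ?ler01// t0 t1.
have -> : psi 0 = 0.
  by rewrite /psi /phi big1 ?mul0r// => j _; rewrite y0 mulr0.
rewrite /psi pmulr_lle0 ?expR_gt0// => phit.
have /eqP : phi t = 0 by apply/eqP; rewrite eq_le phit phi0.
rewrite psumr_eq0 => [/allP/(_ i)|j _]; last by rewrite -expr2 sqr_ge0.
by rewrite mem_index_enum => /(_ isT); rewrite mulf_eq0 orbb => /eqP.
Qed.

Definition mx_continuous01 p q (M : R -> 'M[R]_(p, q)) : Prop :=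
  forall t, 0 <= t <= 1 -> {for t, continuous M}.

Lemma mx_bounded01 p q (M : R -> 'M[R]_(p, q)) : mx_continuous01 M ->
  exists C, 0 <= C /\ forall t, 0 <= t <= 1 -> forall i j, `|M t i j| <= C.
Proof.
move=> cM.
have /choice[C HC] : forall ij : 'I_p * 'I_q, exists C,
    forall t, 0 <= t <= 1 -> `|M t ij.1 ij.2| <= C.
  move=> [i j]; apply: bounded01 => t t01.
  exact: cvg_mx_entry (cM t t01).
exists (\big[Num.max/0]_ij C ij); split; first exact: bigmax_ge_id.
by move=> t t01 i j; apply: le_trans (HC (i, j) t t01) _; exact: le_bigmax.
Qed.

(** A homogeneous linear system with zero initial value only has the zero
    solution; the equation is only asked for in the open interval, so that it
    applies to equations obtained after dividing by t. *)
Lemma linear_system_zero m p (Y Z : R -> 'M[R]_(m, p)) (A B C D : R -> 'M[R]_m) :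
  mx_continuous01 A -> mx_continuous01 B ->
  mx_continuous01 C -> mx_continuous01 D ->
  mx_continuous01 Y -> mx_continuous01 Z ->
  (forall t : R, 0 < t < 1 -> is_derive t 1 Y (A t *m Y t + B t *m Z t)) ->
  (forall t : R, 0 < t < 1 -> is_derive t 1 Z (C t *m Y t + D t *m Z t)) ->
  Y 0 = 0 -> Z 0 = 0 -> forall t : R, 0 <= t <= 1 -> Y t = 0 /\ Z t = 0.
Proof.
move=> cA cB cC cD cY cZ dY dZ Y0 Z0.
have [a [a0 Ha]] := mx_bounded01 cA; have [b [b0 Hb]] := mx_bounded01 cB.
have [c [c0 Hc]] := mx_bounded01 cC; have [d [d0 Hd]] := mx_bounded01 cD.
pose k := a + b + c + d.
pose T := (bool * ('I_m * 'I_p))%type.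
pose y (x : T) (t : R) := if x.1 then Y t x.2.1 x.2.2 else Z t x.2.1 x.2.2.
pose dy (x : T) (t : R) := if x.1 then (A t *m Y t + B t *m Z t) x.2.1 x.2.2
  else (C t *m Y t + D t *m Z t) x.2.1 x.2.2.
have key (t : R) (M : R -> 'M[R]_m) (X : bool) e i j : 0 <= e ->
    (forall i j, `|M t i j| <= e) ->
    `|(M t *m (if X then Y t else Z t)) i j| <=
      e * \sum_(k0 : 'I_m * 'I_p) `|y (X, k0) t|.
  move=> e0 He; rewrite mxE (le_trans (ler_norm_sum _ _ _))//.
  apply: (@le_trans _ _ (e * \sum_l `|y (X, (l, j)) t|)).
    rewrite mulr_sumr; apply: ler_sum => l _; rewrite normrM /y/=.
    by case: (X); rewrite ler_wpM2r.
  rewrite ler_wpM2l// -(pair_bigA _ (fun i j => `|y (X, (i, j)) t|))/=.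
  apply: ler_sum => l _; rewrite (bigD1 j)//= lerDl; exact: sumr_ge0.
have sumT (t : R) : \sum_(x : T) `|y x t| =
    \sum_(k0 : 'I_m * 'I_p) `|y (true, k0) t| +
    \sum_(k0 : 'I_m * 'I_p) `|y (false, k0) t|.
  rewrite -(pair_bigA _ (fun b k0 => `|y (b, k0) t|))/= big_bool/=//.
have Hy : forall x t, 0 <= t <= 1 -> y x t = 0.
  apply: (@gronwall_zero T y dy k).
  - move=> [[] [i j]] t t01; rewrite /y/=.
      exact: cvg_mx_entry (cY t t01).
    exact: cvg_mx_entry (cZ t t01).
  - move=> [[] [i j]] t t01; rewrite /y /dy/=.
      exact: is_derive_entry (dY t t01).
    exact: is_derive_entry (dZ t t01).
  - move=> [bb [i j]] t /andP[t0 t1].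
    have t01 : 0 <= t <= 1 by rewrite !ltW.
    have p1 : 0 <= \sum_(k0 : 'I_m * 'I_p) `|y (true, k0) t| by apply: sumr_ge0.
    have p2 : 0 <= \sum_(k0 : 'I_m * 'I_p) `|y (false, k0) t| by apply: sumr_ge0.
    have KA := key t A true a i j a0 (Ha t t01).
    have KB := key t B false b i j b0 (Hb t t01).
    have KC := key t C true c i j c0 (Hc t t01).
    have KD := key t D false d i j d0 (Hd t t01).
    rewrite /dy/= sumT.
    set s1 := \sum_k0 _ in p1 KA KC *; set s2 := \sum_k0 _ in p2 KB KD *.
    have Hk : a * s1 + b * s2 <= k * (s1 + s2) /\ c * s1 + d * s2 <= k * (s1 + s2).
      by rewrite /k; split; nra.
    case: bb; rewrite mxE (le_trans (ler_normD _ _))//.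
      by apply: le_trans Hk.1; exact: lerD.
    by apply: le_trans Hk.2; exact: lerD.
  - by move=> [[] [i j]]; rewrite /y/= ?Y0 ?Z0 mxE.
move=> t t01; split; apply/matrixP => i j; rewrite mxE.
  exact: (Hy (true, (i, j))).
exact: (Hy (false, (i, j))).
Qed.

Lemma mx_continuous01_cst p q (M : 'M[R]_(p, q)) : mx_continuous01 (fun=> M).
Proof. by move=> t _; exact: cst_continuous. Qed.

Lemma linear_ode_zero m p (Y : R -> 'M[R]_(m, p)) (A : R -> 'M[R]_m) :
  mx_continuous01 A -> mx_continuous01 Y ->
  (forall t : R, 0 < t < 1 -> is_derive t 1 Y (A t *m Y t)) ->
  Y 0 = 0 -> forall t : R, 0 <= t <= 1 -> Y t = 0.
Proof.
move=> cA cY dY Y0 t t01.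
have c0 (M : 'M[R]_m) := @mx_continuous01_cst m m M.
have cz := @mx_continuous01_cst m p 0.
apply: (proj1 (linear_system_zero cA (c0 0) (c0 0) (c0 0) cY cz _ _ Y0 erefl t01)).
- by move=> s s01; rewrite mulmx0 addr0; exact: dY.
- by move=> s s01; rewrite mulmx0 mul0mx addr0; exact: is_derive_cst.
Qed.

Lemma derive0_zero m p (Y : R -> 'M[R]_(m, p)) : mx_continuous01 Y ->
  (forall t : R, 0 < t < 1 -> is_derive t 1 Y 0) ->
  Y 0 = 0 -> forall t : R, 0 <= t <= 1 -> Y t = 0.
Proof.
move=> cY dY; apply: (linear_ode_zero (@mx_continuous01_cst m m 0) cY) => t t01.
by rewrite mul0mx; exact: dY.
Qed.

End Calculus.

(** ** Radial integration *)

Section RadialIntegral.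
Context {R : realType} {n : nat}.
Notation V := 'cV[R]_n.
Notation K := {ffun 'I_n -> nat}.
Implicit Types (c : K -> R) (v w : V) (f : V -> R).

Lemma Rintegral_derive01 (g G : R -> R) :
  (forall t : R, 0 <= t <= 1 -> {for t, continuous g}) ->
  (forall t : R, 0 <= t <= 1 -> is_derive t 1 G (g t)) ->
  \int[lebesgue_measure]_(t in `[0, 1]) g t = G 1 - G 0.
Proof.
move=> cg dG; rewrite /Rintegral.
rewrite (@continuous_FTC2 R g G 0 1 ltr01)//; first exact: within_continuous01.
  split=> [t|| ].
  - by rewrite in_itv/= => /andP[t0 t1]; have [] := dG t _ => //; rewrite !ltW.
  - by apply: cvg_at_right_filter; apply: is_derive_continuous; apply: dG; rewrite lexx ler01.
  - by apply: cvg_at_left_filter; apply: is_derive_continuous; apply: dG; rewrite lexx ler01.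
move=> t; rewrite in_itv/= => /andP[t0 t1]; rewrite derive1E.
by have [_ <-] : is_derive t 1 G (g t) by apply: dG; rewrite !ltW.
Qed.

(** The integral of t^d over the unit interval is 1 / (d + 1). *)
Definition radial_coef c : K -> R := fun k => c k / (deg k).+1%:R.

Lemma cabs_radial c r : 0 <= r -> cabs c r -> cabs (radial_coef c) r.
Proof.
move=> r0 /cabs_norm - /(_ r0); apply: summ_le => k.
rewrite normrM (ger0_norm (exprn_ge0 _ r0)) ler_wpM2r ?exprn_ge0//.
rewrite normrM ler_piMr// ger0_norm ?invr_ge0// invf_le1// ler1n//.
Qed.

(** The Euler operator multiplies the terms of degree d by d; together with the
    identity this cancels the factor 1 / (d + 1). *)
Lemma radial_euler c r v : 0 < r -> cabs c r -> `|v| < r ->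
  'D_v (ps (radial_coef c)) v + ps (radial_coef c) v = ps c v.
Proof.
move=> r0 cc vr; set b := radial_coef c.
have cb : cabs b r by exact: cabs_radial (ltW r0) cc.
have H : has_ps 0 r b (ps b) by split=> // h _; rewrite add0r.
have := has_ps_deriveE v vr H; rewrite add0r => ->.
have T i := tcoef_mi1 i vr cb.
under eq_bigr => i _.
  have [_ <- _ ->] := T i; over.
rewrite -asum_bigsum; last by move=> i; have [] := T i.
rewrite /ps -asumD; first last.
- exact: summ_ps (ltW vr) cb.
- by apply: summ_bigsum => i; have [] := T i.
congr asum; apply/funext => k.
rewrite -mulr_suml -mulr_sumr -natr_sum -/(deg k) -mulrDl -[X in _ + X]mulr1 -mulrDr.
by rewrite natr1 /b /radial_coef mulfVK// pnatr_eq0.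
Qed.

(** By radial_euler, t * ps (radial_coef c) (t v) is a primitive of f (t v). *)
Lemma radial_integral c r f v : has_ps 0 r c f -> `|v| < r ->
  \int[lebesgue_measure]_(t in `[0, 1]) f (t *: v) = ps (radial_coef c) v.
Proof.
move=> [r0 cc E] vr; set b := radial_coef c.
have cb : cabs b r by exact: cabs_radial (ltW r0) cc.
have H : has_ps 0 r b (ps b) by split=> // h _; rewrite add0r.
have tv (t : R) : 0 <= t <= 1 -> `|t *: v| < r.
  move=> /andP[t0 t1]; apply: le_lt_trans vr.
  by rewrite normrZ ger0_norm// ler_piMl.
have fE h : `|h| < r -> f h = ps c h by move=> hr; rewrite -E// add0r.
have an h : `|h| < r -> ana h (ps b) /\ ana h f.
  move=> hr; split; rewrite -[h]add0r.
    by exists (tcoef b h), (r - `|h|); exact: has_ps_translate.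
  by exists (tcoef c h), (r - `|h|); exact: has_ps_translate.
have dray (F : V -> R) (t : R) : ana (t *: v) F -> is_derive t 1 (fun s : R => F (s *: v)) ('D_v F (t *: v)).
  by move=> aF; apply: is_derive_ray; apply: diff_derivable; exact: ana_differentiable.
have cg (t : R) : 0 <= t <= 1 -> {for t, continuous (fun t : R => f (t *: v))}.
  by move=> t01; apply: is_derive_continuous (dray f t _); have [] := an _ (tv t t01).
have dG (t : R) : 0 <= t <= 1 -> is_derive t 1 (fun t => t * ps b (t *: v)) (f (t *: v)).
  move=> t01; have [ab af] := an _ (tv t t01).
  apply: is_derive_eq (is_derive_mulr (is_derive_id t 1) (dray _ _ ab)) _.
  rewrite mul1r fE ?tv// -(radial_euler r0 cc (tv t t01)) addrC; congr (_ + _).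
  have dab := ana_differentiable ab.
  by rewrite !deriveE// linearZ.
by rewrite (Rintegral_derive01 cg dG) scale1r mul1r mul0r subr0.
Qed.

Definition radial_int f v : R := \int[lebesgue_measure]_(t in `[0, 1]) f (t *: v).

Lemma radial_int_ana c r f v : has_ps 0 r c f -> `|v| < r ->
  ana v (radial_int f) /\ 'D_v (radial_int f) v + radial_int f v = f v.
Proof.
move=> H vr; have [r0 cc E] := H.
have near_eq : \near v, ps (radial_coef c) v = radial_int f v.
  have e0 : 0 < r - `|v| by rewrite subr_gt0.
  apply: (near_of_ball e0) => h hr; rewrite -(radial_integral H)//.
  by apply: le_lt_trans (ler_normD _ _) _; rewrite -ltrBrDl.
split.
  apply: ana_ext near_eq _; exists (tcoef (radial_coef c) v), (r - `|v|).
  rewrite -{1}[v]add0r; apply: has_ps_translate => //; split=> //.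
    exact: cabs_radial (ltW r0) cc.
  by move=> h _; rewrite add0r.
rewrite -(near_eq_derive v near_eq) -(nbhs_singleton near_eq).
by rewrite (radial_euler r0 cc vr) -E// add0r.
Qed.

End RadialIntegral.

(** * Connections in coordinates *)

Section Christoffel.
Context {R : realType} {n : nat}.
Notation V := 'cV[R]_n.
Variables (U : set V) (oU : open U).
Implicit Types (X Y Z : V -> V) (v x y : V) (f g : V -> R).

Lemma smooth_cst {W : normedModType R} (a : W) : smooth U (cst a).
Proof. by move=> k; exact: Ck_cst. Qed.

Lemma smoothD f g : smooth U f -> smooth U g -> smooth U (fun v => f v + g v).
Proof. by move=> sf sg k; exact: CkD. Qed.

Lemma smoothM f g : smooth U f -> smooth U g -> smooth U (fun v => f v * g v).
Proof. by move=> sf sg k; exact: CkM. Qed.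

Lemma smooth_sum (I : Type) (r : seq I) (F : I -> V -> R) :
  (forall i, smooth U (F i)) -> smooth U (fun v => \sum_(i <- r) F i v).
Proof.
move=> sF; elim: r => [|i r IH].
  by under eq_fun do rewrite big_nil; exact: smooth_cst.
by under eq_fun do rewrite big_cons; exact: smoothD.
Qed.

Lemma smooth_mx p q (F : V -> 'M[R]_(p, q)) :
  (forall i j, smooth U (fun v => F v i j)) -> smooth U F.
Proof. by move=> sF k; apply/(Ck_mxP oU) => i j; exact: sF. Qed.

Lemma smooth_entry p q (F : V -> 'M[R]_(p, q)) i j :
  smooth U F -> smooth U (fun v => F v i j).
Proof. by move=> sF k; exact: ((Ck_mxP oU k F).1 (sF k) i j). Qed.

Lemma eq_smooth {W : normedModType R} (F G : V -> W) :
  (forall v, U v -> F v = G v) -> smooth U F -> smooth U G.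
Proof. by move=> FG sF k; apply: eq_Ck (sF k). Qed.

Lemma smooth_differentiable {W : normedModType R} (F : V -> W) v :
  smooth U F -> U v -> differentiable F v.
Proof. by move=> sF; exact: (sF 1%N).1. Qed.

Lemma smooth_derive {W : normedModType R} (F : V -> W) w :
  smooth U F -> smooth U (fun v => 'D_w F v).
Proof. by move=> sF k; exact: ((sF k.+1).2 w). Qed.

Lemma ana_smooth f : (forall a, U a -> ana a f) -> smooth U f.
Proof. by move=> af k; exact: ana_Ck. Qed.

Lemma cV_sum_delta x : x = \sum_i x i 0 *: delta_mx i 0.
Proof.
apply/colP => i; rewrite summxE (bigD1 i)//= !mxE !eqxx mulr1 big1 ?addr0// => j.
by rewrite !mxE eq_sym => /negbTE ->; rewrite mulr0.
Qed.

Lemma derive_delta_sum X v w : differentiable X v ->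
  'D_w X v = \sum_i 'D_w (fun u => X u i 0) v *: delta_mx i 0.
Proof.
move=> dX; rewrite [LHS]cV_sum_delta; apply: eq_bigr => i _.
by rewrite derive_entry.
Qed.

(** The Christoffel symbols in the direction x, as a matrix. *)
Definition chris (nabla : (V -> V) -> (V -> V) -> V -> V) v x : 'M[R]_n :=
  \matrix_(i, j) nabla (cst x) (cst (delta_mx j 0)) v i 0.

Section Connection.
Variables (nabla : (V -> V) -> (V -> V) -> V -> V).
Hypothesis cn : connection U nabla.

Let smooth_part X (r : seq 'I_n) : smooth U X ->
  smooth U (fun u => \sum_(i <- r) X u i 0 *: (delta_mx i 0 : V)).
Proof.
move=> sX; apply: smooth_mx => i j; under eq_fun do rewrite summxE.
apply: smooth_sum => k; under eq_fun do rewrite mxE.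
by apply: smoothM; [exact: smooth_entry|exact: smooth_cst].
Qed.

Let smooth_term X i : smooth U X ->
  smooth U (fun u => X u i 0 *: (delta_mx i 0 : V)).
Proof.
by move=> /(@smooth_part _ [:: i]); under eq_fun do rewrite big_seq1.
Qed.

Let nabla_l X Z v (r : seq 'I_n) : smooth U X -> smooth U Z -> U v ->
  nabla (fun u => \sum_(i <- r) X u i 0 *: (delta_mx i 0 : V)) Z v =
  \sum_(i <- r) X v i 0 *: nabla (cst (delta_mx i 0)) Z v.
Proof.
have [_ addl scall _ _] := cn.
move=> sX sZ Uv; elim: r => [|i r IH].
  under eq_fun do rewrite big_nil.
  have -> : (fun=> 0 : V) = fun u : V => cst 0 u *: (cst 0 : V -> V) u.
    by apply/funext => u; rewrite scale0r.
  by rewrite scall ?big_nil ?scale0r//; exact: smooth_cst.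
under eq_fun do rewrite big_cons.
rewrite (addl (fun u => X u i 0 *: delta_mx i 0)); first last.
- exact: Uv.
- exact: sZ.
- exact: smooth_part.
- exact: smooth_term.
rewrite IH big_cons (scall (fun u => X u i 0) (cst (delta_mx i 0)))//.
  exact: smooth_entry.
exact: smooth_cst.
Qed.

Let nabla_r X Y v (r : seq 'I_n) : smooth U X -> smooth U Y -> U v ->
  nabla X (fun u => \sum_(i <- r) Y u i 0 *: (delta_mx i 0 : V)) v =
  \sum_(i <- r) ('D_(X v) (fun u => Y u i 0) v *: delta_mx i 0 +
     Y v i 0 *: nabla X (cst (delta_mx i 0)) v).
Proof.
have [_ _ _ addr leib] := cn.
move=> sX sY Uv; elim: r => [|i r IH].
  under eq_fun do rewrite big_nil.
  have -> : (fun=> 0 : V) = fun u : V => cst 0 u *: (cst 0 : V -> V) u.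
    by apply/funext => u; rewrite scale0r.
  by rewrite leib ?big_nil ?scale0r ?scaler0 ?addr0//; exact: smooth_cst.
under eq_fun do rewrite big_cons.
rewrite (addr X (fun u => Y u i 0 *: delta_mx i 0)); first last.
- exact: Uv.
- exact: smooth_part.
- exact: smooth_term.
- exact: sX.
rewrite IH big_cons (leib (fun u => Y u i 0) X (cst (delta_mx i 0)))//.
  exact: smooth_entry.
exact: smooth_cst.
Qed.

Let expand X : X = fun u => \sum_i X u i 0 *: (delta_mx i 0 : V).
Proof. by apply/funext => u; exact: cV_sum_delta. Qed.

Let nabla_tensor X Z v : smooth U X -> smooth U Z -> U v ->
  nabla X Z v = \sum_i X v i 0 *: nabla (cst (delta_mx i 0)) Z v.
Proof. by move=> sX sZ Uv; rewrite {1}(expand X) nabla_l. Qed.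

Lemma chris_col v x j : nabla (cst x) (cst (delta_mx j 0)) v = col j (chris nabla v x).
Proof. by apply/colP => i; rewrite !mxE. Qed.

(** Tensoriality in the first and Leibniz' rule in the second argument reduce
    the connection to its values on the constant basis fields. *)
Lemma connection_chris X Y v : smooth U X -> smooth U Y -> U v ->
  nabla X Y v = 'D_(X v) Y v + chris nabla v (X v) *m Y v.
Proof.
move=> sX sY Uv; rewrite {1}(expand Y) nabla_r// big_split/=.
rewrite -derive_delta_sum; last exact: smooth_differentiable.
congr (_ + _); apply/colP => i; rewrite summxE mxE; apply: eq_bigr => j _.
rewrite mxE mulrC nabla_tensor//; last exact: smooth_cst.
rewrite -(nabla_tensor (X := cst (X v)))//; [|exact: smooth_cst|exact: smooth_cst].
by rewrite chris_col !mxE.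
Qed.

Lemma chris_linear v : U v -> linear (chris nabla v).
Proof.
move=> Uv a x y; apply/matrixP => i j; rewrite !mxE.
have sc (z : V) := @smooth_cst V z.
rewrite !(nabla_tensor (sc _) (sc _) Uv) !summxE mulr_sumr -big_split/=.
by apply: eq_bigr => k _; rewrite !mxE; ring.
Qed.

Lemma chris_smooth x : smooth U (fun v => chris nabla v x).
Proof.
have [sn _ _ _ _] := cn; apply: smooth_mx => i j; under eq_fun do rewrite mxE.
by apply: smooth_entry; apply: sn; exact: smooth_cst.
Qed.

Lemma chris_sum v x : U v -> chris nabla v x = \sum_i x i 0 *: chris nabla v (delta_mx i 0).
Proof.
move=> Uv; apply/matrixP => i j; rewrite summxE !mxE.
rewrite nabla_tensor//; [|exact: smooth_cst|exact: smooth_cst].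
by rewrite summxE; apply: eq_bigr => k _; rewrite !mxE.
Qed.

Lemma curvature_chris v x y : U v ->
  curvature_at nabla v x y =
    'D_x (fun u => chris nabla u y) v - 'D_y (fun u => chris nabla u x) v
    + chris nabla v x *m chris nabla v y - chris nabla v y *m chris nabla v x.
Proof.
move=> Uv.
have half (a b : V) j : nabla (cst a) (nabla (cst b) (cst (delta_mx j 0))) v =
    col j ('D_a (fun u => chris nabla u b) v + chris nabla v a *m chris nabla v b).
  have [sn _ _ _ _] := cn.
  rewrite connection_chris//; [|exact: smooth_cst|apply: sn; exact: smooth_cst].
  have -> : nabla (cst b) (cst (delta_mx j 0)) = fun u => col j (chris nabla u b).
    by apply/funext => u; rewrite chris_col.
  rewrite linearD/=; congr (_ + _); last by rewrite !colE mulmxA.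
  have dc := smooth_differentiable (chris_smooth b) Uv.
  apply/colP => i; rewrite derive_entry; last first.
    apply: differentiable_mx => k l; under eq_fun do rewrite mxE.
    exact: differentiable_entry.
  by rewrite mxE derive_entry//; congr ('D_a _ v); apply/funext => u; rewrite mxE.
have br : lie_bracket (cst x) (cst y) = cst 0.
  by apply/funext => u; rewrite /lie_bracket !derive_cst subrr.
apply/matrixP => i j; rewrite mxE /curvature !half br.
rewrite connection_chris//; [|exact: smooth_cst|exact: smooth_cst].
rewrite /cst derive0.
have -> : chris nabla v 0 = 0.
  by rewrite chris_sum// big1// => k _; rewrite mxE scale0r.
rewrite mul0mx addr0 !mxE; ring.
Qed.

Lemma torsion_free_chris : torsion_free U nabla ->
  forall v x y, U v -> chris nabla v x *m y = chris nabla v y *m x.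
Proof.
move=> tf v x y Uv.
have sc (z : V) := @smooth_cst V z.
have := tf _ _ (sc x) (sc y) v Uv.
rewrite !connection_chris// /lie_bracket !derive_cst !add0r oppr0.
by move=> /subr0_eq.
Qed.

Lemma derive1_radial v (t : R) : is_derive t 1 (radial_curve v) v.
Proof.
have did : derivable (id : V -> V) (t *: v) v by exact: derivable_id.
by have := is_derive_ray did; rewrite derive_id.
Qed.

Lemma parallel_radialP v (W : R -> V) : star_shaped U -> U v ->
  parallel_along nabla (radial_curve v) W <->
  forall t : R, 0 <= t <= 1 -> is_derive t 1 W (- (chris nabla (t *: v) v *m W t)).
Proof.
move=> [_ stU] Uv.
have E (t : R) : 0 <= t <= 1 -> cov_deriv_along nabla (radial_curve v) W t =
    'D_1 W t + chris nabla (t *: v) v *m W t.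
  move=> t01; rewrite /cov_deriv_along !derive1E; congr (_ + _).
  have Ut := stU v t Uv t01.
  rewrite connection_chris//; [|exact: smooth_cst|exact: smooth_cst].
  rewrite derive_cst add0r.
  by rewrite (@derive_val _ _ _ _ _ _ _ (derive1_radial v t)).
split=> [H t t01|H t t01].
  have [dW cW] := H t t01; apply: DeriveDef => //.
  by move: cW; rewrite E// => /eqP; rewrite addr_eq0 => /eqP.
have [dW eW] := H t t01; split=> //.
by rewrite E// eW addNr.
Qed.

Lemma geodesic_radialP v : star_shaped U -> U v ->
  geodesic nabla (radial_curve v) <->
  forall t : R, 0 <= t <= 1 -> chris nabla (t *: v) v *m v = 0.
Proof.
move=> sU Uv.
have E : derive1 (radial_curve v) = cst v.
  by apply/funext => t; rewrite derive1E (@derive_val _ _ _ _ _ _ _ (derive1_radial v t)).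
rewrite /geodesic E; split=> [[_ /(parallel_radialP _ sU Uv) H] t t01|H].
  have [_] := H t t01; rewrite derive_cst => /eqP.
  by rewrite eq_sym oppr_eq0 => /eqP.
split=> [t _|]; first by have [] := derive1_radial v t.
apply/(parallel_radialP _ sU Uv) => t t01.
by rewrite /cst H// oppr0; exact: is_derive_cst.
Qed.

End Connection.

End Christoffel.

Section ConnectionOf.
Context {R : realType} {n : nat}.
Notation V := 'cV[R]_n.
Variables (U : set V) (oU : open U) (Gam : V -> V -> 'M[R]_n).
Hypothesis Gam_linear : forall v, U v -> linear (Gam v).
Implicit Types (X Y : V -> V) (v x y : V).

Definition connection_of X Y v : V := 'D_(X v) Y v + Gam v (X v) *m Y v.

Lemma chris_connection_of v x : chris connection_of v x = Gam v x.
Proof.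
apply/matrixP => i j; rewrite !mxE derive_cst mxE add0r.
rewrite (bigD1 j)//= !mxE !eqxx mulr1 big1 ?addr0// => k kj.
by rewrite !mxE (negbTE kj) mulr0.
Qed.

Section LinearMap.
Context {W : lmodType R} (f : V -> W).
Hypothesis lf : linear f.

Lemma linfD a b : f (a + b) = f a + f b.
Proof. by have := lf 1 a b; rewrite !scale1r. Qed.

Lemma linf0 : f 0 = 0.
Proof. by apply: (addrI (f 0)); rewrite -linfD !addr0. Qed.

Lemma linfZ (t : R) a : f (t *: a) = t *: f a.
Proof. by have := lf t a 0; rewrite linf0 !addr0. Qed.

End LinearMap.

Lemma linear_sum_delta {W : lmodType R} (f : V -> W) x : linear f ->
  f x = \sum_i x i 0 *: f (delta_mx i 0).
Proof.
move=> lf.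
rewrite {1}[x]cV_sum_delta (big_morph f (linfD lf) (linf0 lf)).
by apply: eq_bigr => i _; exact: linfZ.
Qed.

Lemma derive_sum_delta {W : normedModType R} (F : V -> W) v x : differentiable F v ->
  'D_x F v = \sum_i x i 0 *: 'D_(delta_mx i 0) F v.
Proof.
move=> dF; rewrite deriveE//.
have lF : linear ('d F v) by move=> a u w; rewrite linearP.
rewrite (linear_sum_delta x lF).
by apply: eq_bigr => i _; rewrite deriveE.
Qed.

(** A polynomial in entries and their first derivatives, from which smoothness and
    analyticity can be read off. *)
Lemma connection_ofE X Y v i : U v -> differentiable Y v ->
  connection_of X Y v i 0 =
    \sum_k X v k 0 * 'D_(delta_mx k 0) (fun u => Y u i 0) v +
    \sum_j \sum_k X v k 0 * Gam v (delta_mx k 0) i j * Y v j 0.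
Proof.
move=> Uv dY; rewrite /connection_of mxE derive_sum_delta// summxE; congr (_ + _).
  by apply: eq_bigr => k _; rewrite mxE derive_entry.
rewrite mxE; apply: eq_bigr => j _.
rewrite (linear_sum_delta _ (Gam_linear Uv)) summxE mulr_suml.
by apply: eq_bigr => k _; rewrite mxE.
Qed.

Lemma connection_of_connection : (forall x, smooth U (fun v => Gam v x)) ->
  connection U connection_of.
Proof.
move=> sG; split.
- move=> X Y sX sY; apply: smooth_mx => // i j; rewrite [j]ord1.
  apply: (eq_smooth oU (F := fun v =>
    \sum_k X v k 0 * 'D_(delta_mx k 0) (fun u => Y u i 0) v +
    \sum_j \sum_k X v k 0 * Gam v (delta_mx k 0) i j * Y v j 0)).
    move=> v Uv; rewrite connection_ofE//.
    exact: (smooth_differentiable sY Uv).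
  apply: smoothD => //; first apply: smooth_sum => // k.
    apply: smoothM => //; first exact: smooth_entry.
    by apply: smooth_derive; exact: smooth_entry.
  apply: smooth_sum => // l; apply: smooth_sum => // k.
  by apply: smoothM => //; [apply: smoothM => //|]; exact: smooth_entry.
- move=> X X' Y sX sX' sY v Uv; have dY := smooth_differentiable sY Uv.
  rewrite /connection_of !deriveE// linearD/=.
  by rewrite (linfD (Gam_linear Uv)) mulmxDl addrACA.
- move=> f X Y sf sX sY v Uv; have dY := smooth_differentiable sY Uv.
  rewrite /connection_of !deriveE// linearZ/=.
  by rewrite (linfZ (Gam_linear Uv)) scalerDr scalemxAl.
- move=> X Y Y' sX sY sY' v Uv.
  have dY := smooth_differentiable sY Uv; have dY' := smooth_differentiable sY' Uv.
  rewrite /connection_of mulmxDr addrACA; congr (_ + _).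
  by rewrite deriveD//; exact: diff_derivable.
- move=> f X Y sf sX sY v Uv.
  have dY := smooth_differentiable sY Uv; have df := smooth_differentiable sf Uv.
  rewrite /connection_of -scalemxAr scalerDr addrA; congr (_ + _).
  have dfY : differentiable (fun u => f u *: Y u) v.
    apply: differentiable_mx => i j; under eq_fun do rewrite mxE.
    by apply: differentiableM => //; exact: differentiable_entry.
  apply/colP => i; rewrite derive_entry// mxE [in RHS]mxE [X in _ = _ + X]mxE.
  under eq_fun do rewrite mxE.
  rewrite derive_entry// deriveM//; first last.
  - exact/diff_derivable/differentiable_entry.
  - exact: diff_derivable.
  by rewrite addrC; congr (_ + _); exact: mulrC.
Qed.

Lemma connection_of_real_analytic :
  (forall x i j a, U a -> ana a (fun v => Gam v x i j)) ->
  real_analytic_connection U connection_of.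
Proof.
move=> aG X Y /real_analytic_mxP aX /real_analytic_mxP aY.
apply/real_analytic_mxP => a Ua i j; rewrite [j]ord1.
apply: (@ana_ext _ _ _ (fun v =>
    \sum_k X v k 0 * 'D_(delta_mx k 0) (fun u => Y u i 0) v +
    \sum_j \sum_k X v k 0 * Gam v (delta_mx k 0) i j * Y v j 0)).
  apply: filterS (near_open oU Ua) => v Uv; rewrite connection_ofE//.
  by apply: differentiable_mx => k l; exact: ana_differentiable (aY v Uv k l).
apply: anaD; first apply: ana_sum => k.
  by apply: anaM; [exact: aX|apply: ana_derive; exact: aY].
apply: ana_sum => l; apply: ana_sum => k.
by apply: anaM; [apply: anaM; [exact: aX|exact: aG]|exact: aY].
Qed.

Lemma connection_of_torsion_free :
  (forall v x y, U v -> Gam v x *m y = Gam v y *m x) ->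
  torsion_free U connection_of.
Proof.
move=> symG X Y sX sY v Uv; rewrite /connection_of /lie_bracket (symG v (X v))//.
by rewrite opprD addrACA subrr addr0.
Qed.

End ConnectionOf.

(** * The Jacobi equation for the coframe *)

Section MatrixAnalytic.
Context {R : realType} {n : nat}.
Notation V := 'cV[R]_n.
Implicit Types (a v w x y : V).

Definition anam p q a (F : V -> 'M[R]_(p, q)) : Prop :=
  forall i j, ana a (fun u => F u i j).

Lemma anam_differentiable p q a (F : V -> 'M[R]_(p, q)) : anam a F -> differentiable F a.
Proof. by move=> aF; apply: differentiable_mx => i j; exact: ana_differentiable. Qed.

Lemma anam_near p q a (F : V -> 'M[R]_(p, q)) : anam a F -> \near a, anam a F.
Proof.
move=> aF; near=> u => i j; move: i j; near: u.
apply: filter_forall => i; apply: filter_forall => j.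
exact: ana_near.
Unshelve. all: by end_near. Qed.

Lemma anam_ext p q a (F G : V -> 'M[R]_(p, q)) :
  (\near a, F a = G a) -> anam a F -> anam a G.
Proof.
by move=> FG aF i j; apply: ana_ext (aF i j); apply: filterS FG => u ->.
Qed.

Lemma anam_cst p q a (M : 'M[R]_(p, q)) : anam a (fun=> M).
Proof. by move=> i j; exact: ana_cst. Qed.

Lemma anamD p q a (F G : V -> 'M[R]_(p, q)) :
  anam a F -> anam a G -> anam a (fun u => F u + G u).
Proof. by move=> aF aG i j; under eq_fun do rewrite mxE; exact: anaD. Qed.

Lemma anam_mulmx p q r a (F : V -> 'M[R]_(p, q)) (G : V -> 'M[R]_(q, r)) :
  anam a F -> anam a G -> anam a (fun u => F u *m G u).
Proof.
move=> aF aG i j; under eq_fun do rewrite mxE.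
by apply: ana_sum => k; exact: anaM.
Qed.

Lemma anam_derive p q a (F : V -> 'M[R]_(p, q)) w :
  anam a F -> anam a (fun u => 'D_w F u).
Proof.
move=> aF i j; apply: ana_ext (ana_derive w (aF i j)).
apply: filterS (anam_near aF) => u /anam_differentiable dF.
by rewrite derive_entry.
Qed.

Lemma anam_deriveC p q a (F : V -> 'M[R]_(p, q)) w w' : anam a F ->
  'D_w (fun u => 'D_w' F u) a = 'D_w' (fun u => 'D_w F u) a.
Proof.
move=> aF; apply/matrixP => i j.
have E z : \near a, ('D_z F a) i j = 'D_z (fun v => F v i j) a.
  by apply: filterS (anam_near aF) => u /anam_differentiable dF; rewrite derive_entry.
have D z z' : ('D_z (fun u => 'D_z' F u) a) i j =
    'D_z (fun u => 'D_z' (fun v => F v i j) u) a.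
  rewrite -(near_eq_derive z (E z')).
  exact: derive_entry (anam_differentiable (anam_derive z' aF)).
exact: etrans (D w w') (etrans (ana_deriveC w w' (aF i j)) (esym (D w' w))).
Qed.

Lemma anam_invmx p a (F : V -> 'M[R]_p) : anam a F -> F a \in unitmx ->
  anam a (fun u => invmx (F u)).
Proof. by move=> aF Fa i j; exact: ana_invmx. Qed.

Lemma anam_is_derive p q a (F : V -> 'M[R]_(p, q)) w : anam a F ->
  is_derive a w F ('D_w F a).
Proof.
by move=> aF; apply: derivableP; apply: diff_derivable; exact: anam_differentiable.
Qed.

Lemma is_derive_coord v w i : is_derive v w (fun u : V => u i 0 : R) (w i 0).
Proof. exact: (@is_derive_entry _ V n 1 id v w w i 0 (is_derive_id v w)). Qed.

Lemma deriveZdir (W : normedModType R) (F : V -> W) a (t : R) v :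
  differentiable F a -> 'D_(t *: v) F a = t *: 'D_v F a.
Proof. by move=> dF; rewrite !deriveE// linearZ. Qed.

Lemma deriveDdir (W : normedModType R) (F : V -> W) a v w :
  differentiable F a -> 'D_(v + w) F a = 'D_v F a + 'D_w F a.
Proof. by move=> dF; rewrite !deriveE// linearD. Qed.

(** The Euler field and a constant field x have the bracket x, up to sign. *)
Lemma is_derive_euler p q a (F : V -> 'M[R]_(p, q)) x : anam a F ->
  is_derive a x (fun u => 'D_u F u) ('D_x F a + 'D_a (fun u => 'D_x F u) a).
Proof.
move=> aF.
have E : \forall u \near a,
      \sum_i (u : V) i 0 *: 'D_(delta_mx i 0) F u = 'D_u F u.
  apply: filterS (anam_near aF) => u /anam_differentiable dF.
  by rewrite [RHS]derive_sum_delta.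
apply: (near_eq_is_derive E).
have dx : differentiable (fun u => 'D_x F u) a.
  by apply: anam_differentiable; exact: anam_derive.
have -> : 'D_x F a + 'D_a (fun u => 'D_x F u) a =
    \sum_i (x i 0 *: 'D_(delta_mx i 0) F a +
            a i 0 *: 'D_x (fun u => 'D_(delta_mx i 0) F u) a).
  rewrite big_split; congr (_ + _).
    exact: derive_sum_delta x (anam_differentiable aF).
  apply: etrans (derive_sum_delta a dx) _; apply: eq_bigr => i _.
  exact: (congr1 (fun M => a i 0 *: M) (anam_deriveC (delta_mx i 0) x aF)).
apply: is_derive_bigsum => i; apply: is_derive_scalemx.
  exact: is_derive_coord.
by apply: anam_is_derive; exact: anam_derive.
Qed.

Lemma ray_is_derive p q (F : V -> 'M[R]_(p, q)) v (t : R) : anam (t *: v) F ->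
  is_derive t 1 (fun s : R => F (s *: v)) ('D_v F (t *: v)).
Proof.
by move=> aF; apply: is_derive_ray; apply: diff_derivable; exact: anam_differentiable.
Qed.

Lemma ray_continuous01 p q (F : V -> 'M[R]_(p, q)) v :
  (forall t : R, 0 <= t <= 1 -> anam (t *: v) F) ->
  mx_continuous01 (fun t : R => F (t *: v)).
Proof. by move=> aF t t01; apply: is_derive_continuous (ray_is_derive (aF t t01)). Qed.

Lemma linear_matrixE (f : V -> V) y : linear f ->
  (\matrix_(i, j) f (delta_mx j 0) i 0) *m y = f y.
Proof.
move=> lf; rewrite [RHS](linear_sum_delta _ lf); apply/colP => i.
by rewrite mxE summxE; apply: eq_bigr => j _; rewrite !mxE mulrC.
Qed.

Lemma eq_mulmx (A B : 'M[R]_n) : (forall x : V, A *m x = B *m x) -> A = B.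
Proof.
move=> AB; apply/matrixP => i j; have := AB (delta_mx j 0).
by rewrite -!colE => /colP/(_ i); rewrite !mxE.
Qed.

(** The flow consists of homotheties, so the pullback by it is s * eta (s v) w
    with s = expR t. *)
Lemma lie_eulerE (U : set V) (eta : V -> V -> V) v w : open U -> U v ->
  one_form U eta -> differentiable (fun u => eta u w) v ->
  lie_euler eta v w = 'D_v (fun u => eta u w) v + eta v w.
Proof.
move=> oU Uv le dg; set g := fun u => eta u w.
pose psi (s : R) := s *: g (s *: v).
have dpsi : is_derive (1 : R) 1 psi (g v + 'D_v g v).
  have := @is_derive_scalet R n 1 (fun s : R => g (s *: v)) 1 ('D_v g (1 *: v)).
  rewrite !scale1r; apply; rewrite -{2}[v]scale1r; apply: is_derive_ray.
  by rewrite scale1r; exact: diff_derivable.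
have near0 : \forall t \near (0 : R), psi (expR t) = pullback (euler_flow t) eta v w.
  have cont : (fun t : R => expR t *: v) @ (0 : R) --> v.
    rewrite -[X in _ --> X]scale1r -expR0; apply: cvgZr_tmp.
    exact: continuous_expR.
  have nU : \forall t \near (0 : R), U (expR t *: v) := cont _ (near_open oU Uv).
  apply: filterS nU => t Ut.
  rewrite /pullback /euler_flow.
  have -> : 'd (fun v : V => expR t *: v) v w = expR t *: w.
    by have -> := @diff_val _ _ _ _ _ _ _ (is_diff_scaler (expR t) v).
  by rewrite (linfZ (le _ Ut)).
rewrite /lie_euler derive1E -(near_eq_derive (1 : R) near0).
have : is_derive (0 : R) 1 (fun t => psi (expR t)) (g v + 'D_v g v).
  apply: is_derive_mx => i j.
  have e1 := is_derive_expR (0 : R).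
  have d1 : is_derive (expR (0 : R)) 1 (fun s => psi s i j) ((g v + 'D_v g v) i j).
    by rewrite expR0; exact: is_derive_entry.
  by apply: is_derive_eq (is_derive1_comp d1 e1) _; rewrite expR0 mulr1.
by case=> _ ->; rewrite addrC.
Qed.

End MatrixAnalytic.

Section Jacobi.
Context {R : realType} {n : nat}.
Notation V := 'cV[R]_n.
Variables (U : set V) (S : V -> V -> V -> 'M[R]_n) (theta : V -> V -> V).
Hypotheses (oU : open U) (sU : star_shaped U)
  (hS : forall v, U v -> curvature_tensors (S v))
  (aS : forall x y, real_analytic U (fun v => S v x y))
  (ltheta : one_form U theta) (atheta : real_analytic_form U theta)
  (ode : forall v, U v -> forall w,
     lie_euler (fun u z => lie_euler theta u z - theta u z) v w =
     S_euler S theta v w *m v)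
  (theta0 : forall w, theta 0 w = w).
Implicit Types (u v w x y z : V) (t : R).

Definition coframe v : 'M[R]_n := \matrix_(i, j) theta v (delta_mx j 0) i 0.

(** The Jacobi operator y |-> S (x, y) x. *)
Definition jacobi_op v x : 'M[R]_n := \matrix_(i, j) (S v x (delta_mx j 0) *m x) i 0.

Local Notation Th := coframe.

Lemma coframeE v w : U v -> theta v w = Th v *m w.
Proof. by move=> Uv; rewrite linear_matrixE//; exact: ltheta. Qed.

Lemma jacobi_opE v x y : U v -> jacobi_op v x *m y = S v x y *m x.
Proof.
move=> /hS[l1 _ _ _]; apply: (linear_matrixE (f := fun y => S v x y *m x)).
by move=> a b c; rewrite l1 mulmxDl scalemxAl.
Qed.

Lemma S_linearr v x : U v -> linear (S v x).
Proof. by move=> /hS[]. Qed.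

Lemma S_linearl v y : U v -> linear (fun x => S v x y).
Proof. by move=> /hS[_ l2 _ _]; exact: l2. Qed.

Lemma S_alt v x : U v -> S v x x = 0.
Proof. by move=> /hS[_ _ l3 _]; exact: l3. Qed.

Lemma S_skew v x y : U v -> S v y x = - S v x y.
Proof.
move=> Uv; have := S_alt (x + y) Uv.
rewrite (linfD (S_linearr (x + y) Uv)).
rewrite (linfD (S_linearl x Uv)) (linfD (S_linearl y Uv)) !S_alt// add0r addr0.
by move/eqP; rewrite addr_eq0 => /eqP.
Qed.

Lemma S_bianchi v x y z : U v ->
  S v x y *m z + S v y z *m x + S v z x *m y = 0.
Proof. by move=> /hS[_ _ _ l4]; exact: l4. Qed.

Lemma coframe_ana v : U v -> anam v Th.
Proof.
move=> Uv i j; have /real_analytic_mxP/(_ v Uv i 0) := atheta (delta_mx j 0).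
by apply: ana_ext; apply: (near_of_ball ltr01) => h _; rewrite mxE.
Qed.

Lemma S_ana v x y : U v -> anam v (fun u => S u x y).
Proof. by move=> Uv; have /real_analytic_mxP/(_ v Uv) := aS x y. Qed.

Lemma jacobi_op_ana v x : U v -> anam v (fun u => jacobi_op u x).
Proof.
move=> Uv i j.
have := anam_mulmx (S_ana x (delta_mx j 0) Uv) (anam_cst v x) i 0.
by apply: ana_ext; apply: (near_of_ball ltr01) => h _; rewrite [RHS]mxE.
Qed.

Lemma in_ray v t : U v -> 0 <= t <= 1 -> U (t *: v).
Proof. by have [_ st] := sU; exact: st. Qed.

Lemma coframe0 : Th 0 = 1%:M.
Proof.
have [U0 _] := sU.
by apply: eq_mulmx => x; rewrite -coframeE// theta0 mul1mx.
Qed.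

Let lie_theta u z : U u -> lie_euler theta u z - theta u z = 'D_u Th u *m z.
Proof.
move=> Uu; have aTh := coframe_ana Uu.
have E : \near u, Th u *m z = theta u z.
  by apply: filterS (near_open oU Uu) => p Up; rewrite coframeE.
have dz : is_derive u u (fun p => Th p *m z) ('D_u Th u *m z).
  have := is_derive_mulmx (anam_is_derive u aTh) (is_derive_cst z u u).
  by rewrite mulmx0 addr0.
have dth : differentiable (fun p => theta p z) u.
  apply: near_eq_differentiable E _; apply: anam_differentiable.
  exact: anam_mulmx aTh (anam_cst u z).
rewrite (lie_eulerE oU Uu ltheta dth) addrK.
by rewrite -(near_eq_derive u E); case: dz.
Qed.

(** The singular equation, written with the second derivatives of the coframe
    matrix along the Euler field. *)
Lemma coframe_jacobi v : U v ->
  'D_v (fun u => 'D_v Th u) v + ('D_v Th v + 'D_v Th v) = jacobi_op v v *m Th v.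
Proof.
move=> Uv; have aTh := coframe_ana Uv; apply: eq_mulmx => w.
have E : \forall u \near v, 'D_u Th u *m w = lie_euler theta u w - theta u w.
  by apply: filterS (near_open oU Uv) => u Uu; rewrite lie_theta.
have lz : one_form U (fun u z => lie_euler theta u z - theta u z).
  by move=> u Uu a x y; rewrite !lie_theta// mulmxDr scalemxAr.
have dE := is_derive_mulmx (is_derive_euler v aTh) (is_derive_cst w v v).
have dz : differentiable (fun u => lie_euler theta u w - theta u w) v.
  apply: near_eq_differentiable E _; apply: anam_differentiable.
  apply: (@anam_ext _ _ _ _ _ (fun u : V => (\sum_i u i 0 *: 'D_(delta_mx i 0) Th u) *m w)).
    apply: filterS (near_open oU Uv) => u Uu; congr (_ *m w).
    exact/esym/(derive_sum_delta u (anam_differentiable (coframe_ana Uu))).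
  apply: anam_mulmx; last exact: anam_cst.
  move=> i j; under eq_fun do rewrite summxE.
  apply: ana_sum => k; under eq_fun do rewrite mxE.
  by apply: anaM; [exact: ana_coord|exact: anam_derive].
have := ode Uv w; rewrite (lie_eulerE oU Uv lz dz) -(near_eq_derive v E).
have -> : 'D_v (fun u => 'D_u Th u *m w) v =
    ('D_v Th v + 'D_v (fun u => 'D_v Th u) v) *m w.
  by have [_ ->] := dE; rewrite mulmx0 addr0.
rewrite lie_theta// /S_euler coframeE// -jacobi_opE// mulmxA => <-.
by rewrite -mulmxDl; congr (_ *m w); rewrite addrC addrAC.
Qed.

(** Along the ray through v, the matrix t * Th (t v) is a Jacobi field. *)
Definition jac v t : 'M[R]_n := t *: Th (t *: v).
Definition djac v t : 'M[R]_n := Th (t *: v) + t *: 'D_v Th (t *: v).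

Lemma jac_is_derive v t : U v -> 0 <= t <= 1 -> is_derive t 1 (jac v) (djac v t).
Proof.
move=> Uv t01; apply: is_derive_scalet; apply: ray_is_derive.
exact: coframe_ana (in_ray Uv t01).
Qed.

Lemma djac_derivable v t : U v -> 0 <= t <= 1 ->
  exists D, is_derive t 1 (djac v) D.
Proof.
move=> Uv t01; have aTh := coframe_ana (in_ray Uv t01).
have d1 := ray_is_derive aTh.
have d2 := is_derive_scalet (ray_is_derive (anam_derive v aTh)).
by eexists; exact: is_derive_addmx d1 d2.
Qed.

(** The singular equation at the point t v, divided by t. *)
Lemma djac_is_derive v t : U v -> 0 < t < 1 ->
  is_derive t 1 (djac v) (jacobi_op (t *: v) v *m jac v t).
Proof.
move=> Uv /andP[t0 t1]; have t01 : 0 <= t <= 1 by rewrite !ltW.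
have Ut := in_ray Uv t01; have aTh := coframe_ana Ut.
have d1 := ray_is_derive aTh.
have d2 := is_derive_scalet (ray_is_derive (anam_derive v aTh)).
apply: is_derive_eq (is_derive_addmx d1 d2) _.
have tn0 : t != 0 by rewrite gt_eqF.
apply: (scalerI tn0).
have := coframe_jacobi Ut.
have E (F : V -> 'M[R]_n) : anam (t *: v) F -> 'D_(t *: v) F (t *: v) = t *: 'D_v F (t *: v).
  by move=> aF; apply: deriveZdir; exact: anam_differentiable.
rewrite (E _ (anam_derive _ aTh)) (E _ aTh).
have -> : 'D_v (fun u => 'D_(t *: v) Th u) (t *: v) =
    t *: 'D_v (fun u => 'D_v Th u) (t *: v).
  rewrite (anam_deriveC v (t *: v) aTh).
  exact: E (anam_derive v aTh).
have -> : jacobi_op (t *: v) (t *: v) = (t * t) *: jacobi_op (t *: v) v.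
  apply: eq_mulmx => x; rewrite -scalemxAl !jacobi_opE//.
  rewrite (linfZ (S_linearl x Ut)) -scalemxAl -scalemxAr scalerA//.
rewrite /jac => H; rewrite -scalemxAr scalerA scalemxAl -H.
by rewrite !scalerDr addrA addrC.
Qed.

Lemma jacobi_op_continuous v x : U v -> mx_continuous01 (fun t => jacobi_op (t *: v) x).
Proof.
move=> Uv; apply: (ray_continuous01 (F := fun u => jacobi_op u x)) => t t01.
exact: jacobi_op_ana (in_ray Uv t01).
Qed.

(** Both sides are Jacobi fields along the ray with the same initial data:
    the Jacobi operator kills the radial direction. *)
Lemma coframe_radial v : U v -> Th v *m v = v.
Proof.
move=> Uv; pose Y t : V := jac v t *m v - t *: v; pose Z t : V := djac v t *m v - v.
have cst0 (t : R) (M : V) : is_derive t 1 (fun=> M) (0 : V) := is_derive_cst M t 1.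
have dtv t : is_derive t 1 (fun s : R => s *: v) v.
  have := is_derive_scalet (cst0 t v).
  by rewrite scaler0 addr0.
have dY t : 0 <= t <= 1 -> is_derive t 1 Y (Z t).
  move=> t01; have dJ := is_derive_mulmx (jac_is_derive Uv t01) (cst0 t v).
  by apply: is_derive_eq (is_deriveB dJ (dtv t)) _; rewrite mulmx0 addr0.
have dZ t : 0 < t < 1 -> is_derive t 1 Z (jacobi_op (t *: v) v *m Y t).
  move=> /[dup] t01 /andP[t0 t1].
  have dJ := is_derive_mulmx (djac_is_derive Uv t01) (cst0 t v).
  apply: is_derive_eq (is_deriveB dJ (cst0 t v)) _.
  have Ut : U (t *: v) by apply: in_ray => //; rewrite !ltW.
  have J0 : jacobi_op (t *: v) v *m v = 0 by rewrite jacobi_opE// S_alt// mul0mx.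
  rewrite mulmx0 addr0 subr0 /Y; move: (jac v t) (jacobi_op _ _) J0 => A B J0.
  by rewrite mulmxBr -scalemxAr J0 scaler0 subr0 mulmxA.
have cY : mx_continuous01 Y by move=> t t01; exact: is_derive_continuous (dY t t01).
have cZ : mx_continuous01 Z.
  move=> t t01; have [D dD] := djac_derivable Uv t01.
  exact: is_derive_continuous (is_deriveB (is_derive_mulmx dD (cst0 t v)) (cst0 t v)).
have c0 (M : 'M[R]_n) := @mx_continuous01_cst R n n M.
have dY1 t : 0 < t < 1 -> is_derive t 1 Y (0 *m Y t + 1%:M *m Z t).
  by move=> /andP[t0 t1]; rewrite mul0mx add0r mul1mx; apply: dY; rewrite !ltW.
have dZ1 t : 0 < t < 1 -> is_derive t 1 Z (jacobi_op (t *: v) v *m Y t + 0 *m Z t).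
  by move=> t01; rewrite mul0mx addr0; exact: dZ.
have Y0 : Y 0 = 0 by rewrite /Y /jac !scale0r mul0mx subr0.
have Z0 : Z 0 = 0.
  by rewrite /Z /djac !scale0r addr0 coframe0 mul1mx subrr.
have i1 : 0 <= (1 : R) <= 1 by rewrite ler01 lexx.
have [+ _] := linear_system_zero (c0 0) (c0 1%:M) (jacobi_op_continuous (x := v) Uv)
  (c0 0) cY cZ dY1 dZ1 Y0 Z0 i1.
by rewrite /Y /jac !scale1r => /subr0_eq.
Qed.

End Jacobi.

(** * The connection form near the origin *)

Section ConnectionForm.
Context {R : realType} {n : nat}.
Notation V := 'cV[R]_n.
Notation K := {ffun 'I_n -> nat}.
Variables (U : set V) (S : V -> V -> V -> 'M[R]_n) (theta : V -> V -> V).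
Hypotheses (oU : open U) (sU : star_shaped U)
  (hS : forall v, U v -> curvature_tensors (S v))
  (aS : forall x y, real_analytic U (fun v => S v x y))
  (ltheta : one_form U theta) (atheta : real_analytic_form U theta)
  (ode : forall v, U v -> forall w,
     lie_euler (fun u z => lie_euler theta u z - theta u z) v w =
     S_euler S theta v w *m v)
  (theta0 : forall w, theta 0 w = w).
Implicit Types (u v w x y z : V) (t : R).

Local Notation Th := (coframe theta).

Definition conn_form : V -> V -> 'M[R]_n := integration_map (S_euler S theta).

Local Notation om := conn_form.

Lemma S_euler_linear v : U v -> linear (S_euler S theta v).
Proof.
by move=> Uv a x y; rewrite /S_euler (ltheta Uv) (S_linearr hS _ Uv).
Qed.

Lemma S_eulerE v w : U v -> S_euler S theta v w = S v v (Th v *m w).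
Proof. by move=> Uv; rewrite /S_euler (coframeE ltheta). Qed.

Lemma S_euler_ana v w : U v -> anam v (fun u => S_euler S theta u w).
Proof.
move=> Uv; have aTh := coframe_ana atheta Uv.
have E : \forall u \near v, \sum_p \sum_q
    ((u : V) p 0 * (Th u *m w) q 0) *: S u (delta_mx p 0) (delta_mx q 0) = S_euler S theta u w.
  apply: filterS (near_open oU Uv) => u Uu; rewrite S_eulerE//.
  rewrite [RHS](linear_sum_delta _ (S_linearl hS _ Uu)); apply: eq_bigr => p _.
  rewrite [in RHS](linear_sum_delta _ (S_linearr hS _ Uu)) scaler_sumr.
  by apply: eq_bigr => q _; rewrite scalerA.
apply: anam_ext E _ => i j; under eq_fun do rewrite summxE.
apply: ana_sum => p; under eq_fun do rewrite summxE.
apply: ana_sum => q; under eq_fun do rewrite mxE.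
apply: anaM; last exact: S_ana.
by apply: anaM; [exact: ana_coord|exact: (anam_mulmx aTh (anam_cst v w))].
Qed.

Section Ball.
Variables (r : R) (c : 'I_n -> 'I_n -> 'I_n -> K -> R).
Hypotheses (r0 : 0 < r) (rU : forall v, `|v| < r -> U v)
  (Hc : forall p i j,
    has_ps 0 r (c p i j) (fun u => S_euler S theta u (delta_mx p 0) i j)).

Let eta_ps w i j : has_ps 0 r (fun k => \sum_p w p 0 * c p i j k)
  (fun u => S_euler S theta u w i j).
Proof.
split=> // [|h hr].
  rewrite /cabs; under eq_fun do rewrite mulr_suml.
  apply: summ_bigsum => p; under eq_fun do rewrite -mulrA.
  by apply: summZ; have [] := Hc p i j.
rewrite add0r (linear_sum_delta _ (S_euler_linear (rU hr))) summxE /ps.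
under [X in _ = asum X]eq_fun do rewrite mulr_suml.
have sc p : summ (fun k => c p i j k * monomial h k).
  by have [_ cc _] := Hc p i j; exact: summ_ps (ltW hr) cc.
rewrite asum_bigsum; last first.
  by move=> p; under eq_fun do rewrite -mulrA; exact: summZ.
apply: eq_bigr => p _; under [X in _ = asum X]eq_fun do rewrite -mulrA.
rewrite asumZ// mxE; congr (_ * _).
by have [_ _ E] := Hc p i j; rewrite -[h]add0r E// add0r.
Qed.

Let om_entry v w i j : om v w i j = radial_int (fun u => S_euler S theta u w i j) v.
Proof. by rewrite mxE. Qed.

Lemma conn_form_ana v w : `|v| < r -> anam v (fun u => om u w).
Proof.
move=> vr i j; under eq_fun do rewrite om_entry.
exact: (radial_int_ana (eta_ps w i j) vr).1.
Qed.

Lemma conn_form_euler v w : `|v| < r ->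
  'D_v (fun u => om u w) v + om v w = S v v (Th v *m w).
Proof.
move=> vr; rewrite -(S_eulerE w (rU vr)); apply/matrixP => i j.
rewrite mxE derive_entry; last exact/anam_differentiable/conn_form_ana.
rewrite om_entry; under eq_fun do rewrite om_entry.
exact: (radial_int_ana (eta_ps w i j) vr).2.
Qed.

(** Linearity of the integral is read off the power series, which spares the
    integrability of the entries. *)
Lemma conn_form_linear v : `|v| < r -> linear (om v).
Proof.
move=> vr.
have E w i j : om v w i j = \sum_p w p 0 * ps (radial_coef (c p i j)) v.
  rewrite om_entry /radial_int (radial_integral (eta_ps w i j) vr) /ps.
  have sc p : summ (fun k => radial_coef (c p i j) k * monomial v k).
    have [_ cc _] := Hc p i j.
    exact: summ_ps (ltW vr) (cabs_radial (ltW r0) cc).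
  have -> : (fun k => radial_coef (fun k => \sum_p w p 0 * c p i j k) k * monomial v k) =
      fun k => \sum_p w p 0 * (radial_coef (c p i j) k * monomial v k).
    apply/funext => k; rewrite /radial_coef !mulr_suml.
    by apply: eq_bigr => p _; rewrite !mulrA.
  rewrite asum_bigsum; last by move=> p; exact: summZ.
  by apply: eq_bigr => p _; rewrite asumZ.
move=> a x y; apply/matrixP => i j; rewrite !mxE -!/(om _ _ _ _).
have := (E (a *: x + y) i j, E x i j, E y i j).
rewrite !mxE => -[[-> ->] ->]; rewrite mulr_sumr -big_split/=.
by apply: eq_bigr => p _; rewrite !mxE; ring.
Qed.

(** The Jacobi equation integrated once along the ray. The identity says that the
    contraction of the torsion with the Euler field vanishes. *)
Lemma coframe_first_integral v w : `|v| < r ->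
  'D_v Th v *m w + Th v *m w = w + om v w *m v.
Proof.
move=> vr; have Uv := rU vr.
have inr t : 0 <= t <= 1 -> `|t *: v| < r.
  move=> /andP[t0 t1]; apply: le_lt_trans vr.
  by rewrite normrZ ger0_norm// ler_piMl.
pose O t := t *: om (t *: v) w.
pose Y t : V := djac theta v t *m w - w - O t *m v.
have cst0 t (M : V) : is_derive t 1 (fun=> M) (0 : V) := is_derive_cst M t 1.
have dO t : 0 <= t <= 1 -> is_derive t 1 O (S (t *: v) (t *: v) (Th (t *: v) *m w)).
  move=> t01; have aom := conn_form_ana w (inr t t01).
  apply: is_derive_eq (is_derive_scalet (ray_is_derive aom)) _.
  rewrite -(conn_form_euler _ (inr t t01)) addrC; congr (_ + _).
  exact/esym/deriveZdir/anam_differentiable.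
have dY t (D : 'M[R]_n) : 0 <= t <= 1 -> is_derive t 1 (djac theta v) D ->
    is_derive t 1 Y (D *m w - S (t *: v) (t *: v) (Th (t *: v) *m w) *m v).
  move=> t01 dD.
  have d1 := is_deriveB (is_derive_mulmx dD (cst0 t w)) (cst0 t w).
  have d2 := is_derive_mulmx (dO t t01) (cst0 t v).
  by apply: is_derive_eq (is_deriveB d1 d2) _; rewrite !mulmx0 !addr0 subr0.
have cY : mx_continuous01 Y.
  move=> t t01; have [D dD] := djac_derivable sU atheta Uv t01.
  exact: is_derive_continuous (dY t D t01 dD).
have dY0 t : 0 < t < 1 -> is_derive t 1 Y 0.
  move=> t01; have dJ := djac_is_derive oU sU hS ltheta atheta ode Uv t01.
  have t01' : 0 <= t <= 1 by case/andP: t01 => t0 t1; rewrite !ltW.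
  have Ut := in_ray sU Uv t01'.
  apply: is_derive_eq (dY t _ t01' dJ) _.
  rewrite /jac -scalemxAr -scalemxAl -mulmxA (jacobi_opE hS _ _ Ut).
  rewrite (linfZ (S_linearl hS _ Ut)) -scalemxAl.
  exact: subrr.
have Y0 : Y 0 = 0.
  rewrite /Y /O /djac !scale0r mul0mx subr0 addr0.
  by rewrite (coframe0 sU ltheta theta0) mul1mx subrr.
have := derive0_zero cY dY0 Y0 (t := 1); rewrite ler01 lexx => /(_ isT).
rewrite /Y /O /djac !scale1r mulmxDl => /eqP.
by rewrite subr_eq0 subr_eq addrC => /eqP ->; rewrite addrC.
Qed.

End Ball.

(** Finitely many germs of power series at the origin have a common radius. *)
Lemma exists_common_ball : exists (r : R) (c : 'I_n -> 'I_n -> 'I_n -> K -> R),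
  [/\ 0 < r, forall v, `|v| < r -> U v, forall v, `|v| < r -> Th v \in unitmx &
      forall p i j, has_ps 0 r (c p i j)
        (fun u => S_euler S theta u (delta_mx p 0) i j)].
Proof.
have [U0 _] := sU.
have /near_ball[r1 r10 H1] := near_open oU U0.
have T0 : Th 0 \in unitmx by rewrite (coframe0 sU ltheta theta0) unitmx1.
have /near_ball[r2 r20 H2] := ana_unitmx_near (coframe_ana atheta U0) T0.
have /choice[c0 Hc0] : forall pij : 'I_n * ('I_n * 'I_n), exists cr : (K -> R) * R,
    has_ps 0 cr.2 cr.1 (fun u => S_euler S theta u (delta_mx pij.1 0) pij.2.1 pij.2.2).
  move=> [p [i j]]; have [c [r H]] := S_euler_ana (delta_mx p 0) U0 i j.
  by exists (c, r).
pose r := Num.min (Num.min r1 r2) (\big[Num.min/1]_pij (c0 pij).2).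
have r0 : 0 < r.
  rewrite !lt_min r10 r20/=; apply: (big_ind (fun x : R => 0 < x)) => // [x y x0 y0|pij _].
    by rewrite lt_min x0.
  by have [] := Hc0 pij.
exists r, (fun p i j => (c0 (p, (i, j))).1); split=> //.
- move=> v vr; rewrite -[v]add0r; apply: H1; apply: lt_le_trans vr _.
  by rewrite !ge_min lexx.
- move=> v vr; rewrite -[v]add0r; apply: H2; apply: lt_le_trans vr _.
  by rewrite !ge_min lexx orbT.
- move=> p i j; apply: has_ps_le (Hc0 (p, (i, j))); rewrite r0/= ge_min.
  by apply/orP; right; exact: bigmin_le.
Qed.

End ConnectionForm.

(** * The structure equations *)

(* The algebra behind the differentiation of the structure equations. The names
   tell what the arbitrary matrices stand for: A is a first and A2, D12 a second
   derivative of T = Th, o and O are values and derivatives of the connection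
   form, G and DG those of the Christoffel matrices. *)
Section StructureAlgebra.
Context {R : realType} {n : nat}.
Notation V := 'cV[R]_n.
Notation M := 'M[R]_n.

Lemma mx_addE p q (A B : 'M[R]_(p, q)) i j : (A + B) i j = A i j + B i j.
Proof. by rewrite mxE. Qed.

Lemma mx_oppE p q (A : 'M[R]_(p, q)) i j : (- A) i j = - A i j.
Proof. by rewrite mxE. Qed.

Lemma mx_scaleE p q t (A : 'M[R]_(p, q)) i j : (t *: A) i j = t * A i j.
Proof. by rewrite mxE. Qed.

Definition mx_linE := (mx_addE, mx_oppE, mx_scaleE).

Lemma first_integral_algebra (A A2 T T' O o : M) (v w x : V) :
  (A + A2) *m w + T' *m 0 + (A *m w + T *m 0) = 0 + (O *m v + o *m x) ->
  A2 *m w + (A *m w + A *m w) = O *m v + o *m x.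
Proof.
by rewrite !mulmx0 !addr0 add0r => <-; rewrite mulmxDl addrAC addrC.
Qed.

Lemma frame_torsion_algebra (Ax2 Ay2 Ax Ay Av T ox oy Dvox Dvoy Dxoy Dyox Sx Sy Sxy : M)
    (v x y : V) :
  Ax2 *m y + (Ax *m y + Ax *m y) = Dxoy *m v + oy *m x ->
  Ay2 *m x + (Ay *m x + Ay *m x) = Dyox *m v + ox *m y ->
  Dvox + ox = Sx -> Dvoy + oy = Sy ->
  Av *m x + T *m x = x + ox *m v -> Av *m y + T *m y = y + oy *m v ->
  (Dxoy - Dyox) + (ox *m oy - oy *m ox) = Sxy ->
  Sxy *m v + (- Sy) *m (T *m x) + Sx *m (T *m y) = 0 ->
  (Ax2 *m y + Ax *m 0) - (Ay2 *m x + Ay *m 0) +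
    ((Dvox *m (T *m y) + ox *m (Av *m y + T *m 0)) -
     (Dvoy *m (T *m x) + oy *m (Av *m x + T *m 0))) =
  - ((Ax *m y - Ay *m x + (ox *m (T *m y) - oy *m (T *m x))) +
     (Ax *m y - Ay *m x + (ox *m (T *m y) - oy *m (T *m x)))).
Proof.
move=> F1 F2 <- <- /(canRL (addrK _)) Tx /(canRL (addrK _)) Ty <-.
rewrite !mulmx0 !addr0 Tx Ty {Tx Ty}.
rewrite !(mulmxDr, mulmxDl, mulmxN, mulNmx, opprD) -!mulmxA => Bi.
apply/colP => i; move: Bi F1 F2 => /colP/(_ i) Bi /colP/(_ i) F1 /colP/(_ i) F2.
move: Bi F1 F2; rewrite !mx_linE [(0 : V) i 0]mxE; lra.
Qed.

Lemma curvature_algebra (T DG1 DG2 Gx Gy D12 Dxoy Dyox ox oy Ax Ay Sxy : M) :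
  Ax *m Gy + T *m DG1 = D12 + (Dxoy *m T + oy *m Ax) ->
  Ay *m Gx + T *m DG2 = D12 + (Dyox *m T + ox *m Ay) ->
  T *m Gx = Ax + ox *m T -> T *m Gy = Ay + oy *m T ->
  (Dxoy - Dyox) + (ox *m oy - oy *m ox) = Sxy ->
  T *m (DG1 - DG2 + Gx *m Gy - Gy *m Gx) = Sxy *m T.
Proof.
move=> E1 E2 Ex Ey <-.
rewrite !mulmxDr !mulmxN !mulmxA Ex Ey !(mulmxDl, mulNmx) -!mulmxA Ex Ey !mulmxDr.
apply/matrixP => i j; move: E1 E2 => /matrixP/(_ i j) E1 /matrixP/(_ i j) E2.
move: E1 E2; rewrite !mx_linE; lra.
Qed.

Lemma euler_degree_algebra (t : R) (F D : V) : t *: D = - (F + F) ->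
  (1 * t + t * 1) *: F + (t * t) *: D = 0.
Proof.
move=> H; rewrite mul1r mulr1 -scalerA H scalerN scalerDr scalerDl.
exact: addrN.
Qed.

End StructureAlgebra.

Section Structure.
Context {R : realType} {n : nat}.
Notation V := 'cV[R]_n.
Implicit Types (u v w x y z : V) (t : R).
Variables (B : set V) (S : V -> V -> V -> 'M[R]_n)
  (Th : V -> 'M[R]_n) (om : V -> V -> 'M[R]_n).
Hypotheses (oB : open B) (sB : star_shaped B)
  (hS : forall v, B v -> curvature_tensors (S v))
  (aTh : forall v, B v -> anam v Th)
  (uTh : forall v, B v -> Th v \in unitmx)
  (aom : forall v w, B v -> anam v (fun u => om u w))
  (lom : forall v, B v -> linear (om v))
  (om_euler : forall v w, B v ->
    'D_v (fun u => om u w) v + om v w = S v v (Th v *m w))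
  (first_integral : forall v w, B v ->
    'D_v Th v *m w + Th v *m w = w + om v w *m v)
  (consistent : forall v x y, B v ->
    ext_d om v x y + wedge_sq om v x y = S v (Th v *m x) (Th v *m y))
  (radial : forall v, B v -> Th v *m v = v).

Lemma is_derive_near_unique p q (F G : V -> 'M[R]_(p, q)) v x (dF dG : 'M[R]_(p, q)) :
  (\forall u \near v, F u = G u) ->
  is_derive v x F dF -> is_derive v x G dG -> dF = dG.
Proof. by move=> E [_ <-] [_ <-]; exact: near_eq_derive. Qed.

Let cst0 p q v x (M : 'M[R]_(p, q)) : is_derive v x (fun=> M) (0 : 'M[R]_(p, q)).
Proof. exact: is_derive_cst. Qed.

Lemma first_integral_derive v x w : B v ->
  'D_v (fun u => 'D_x Th u) v *m w + ('D_x Th v *m w + 'D_x Th v *m w) =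
  'D_x (fun u => om u w) v *m v + om v w *m x.
Proof.
move=> Bv; have aT := aTh Bv.
have E : \forall u \near v, 'D_u Th u *m w + Th u *m w = w + om u w *m u.
  by apply: filterS (near_open oB Bv) => u Bu; exact: first_integral.
have dl := is_derive_addmx (is_derive_mulmx (is_derive_euler x aT) (cst0 v x w))
  (is_derive_mulmx (anam_is_derive x aT) (cst0 v x w)).
have dr := is_derive_addmx (cst0 v x w)
  (is_derive_mulmx (anam_is_derive x (aom w Bv)) (is_derive_id v x)).
exact: first_integral_algebra (is_derive_near_unique E dl dr).
Qed.

(** The torsion, read in the frame dual to Th: it is d theta + om /\ theta. *)
Definition frame_torsion v x y : V :=
  ('D_x Th v *m y - 'D_y Th v *m x) +
  (om v x *m (Th v *m y) - om v y *m (Th v *m x)).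

(** The torsion is homogeneous of degree -2 along rays: the curvature terms that
    come from the derivatives of om and of the first integral form a cyclic sum,
    which vanishes by the Bianchi identity. *)
Lemma frame_torsion_euler v x y : B v ->
  is_derive v v (fun u => frame_torsion u x y)
    (- (frame_torsion v x y + frame_torsion v x y)).
Proof.
move=> Bv; have aT := aTh Bv.
have dT z w := is_derive_mulmx (anam_is_derive v (anam_derive z aT)) (cst0 v v w).
have dO z w := is_derive_mulmx (anam_is_derive v (aom z Bv))
  (is_derive_mulmx (anam_is_derive v aT) (cst0 v v w)).
have d := is_derive_addmx (is_deriveB (dT x y) (dT y x)) (is_deriveB (dO x y) (dO y x)).
apply: is_derive_eq d _.
have Bi := S_bianchi hS (Th v *m x) (Th v *m y) v Bv.
rewrite (S_skew hS v (Th v *m y) Bv) in Bi.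
exact: frame_torsion_algebra (first_integral_derive x y Bv)
  (first_integral_derive y x Bv) (om_euler x Bv) (om_euler y Bv)
  (first_integral x Bv) (first_integral y Bv) (consistent x y Bv) Bi.
Qed.

(** By homogeneity t^2 times the torsion is constant along rays, and it vanishes at
    the origin. *)
Lemma frame_torsion_eq0 v x y : B v -> frame_torsion v x y = 0.
Proof.
move=> Bv; pose Y t : V := (t * t) *: frame_torsion (t *: v) x y.
have Bt t : 0 <= t <= 1 -> B (t *: v) by exact: in_ray.
have aF t : 0 <= t <= 1 -> differentiable (fun u => frame_torsion u x y) (t *: v).
  move=> /Bt Btv; have aT := aTh Btv; apply: anam_differentiable.
  have aN p q (F : V -> 'M[R]_(p, q)) : anam (t *: v) F -> anam (t *: v) (fun u => - F u).
    by move=> aF i j; under eq_fun do rewrite mxE; exact: anaN.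
  apply: anamD; apply: anamD; try apply: aN.
  - exact: anam_mulmx (anam_derive _ aT) (anam_cst _ _).
  - exact: anam_mulmx (anam_derive _ aT) (anam_cst _ _).
  - exact: anam_mulmx (aom x Btv) (anam_mulmx aT (anam_cst _ _)).
  - exact: anam_mulmx (aom y Btv) (anam_mulmx aT (anam_cst _ _)).
have dY t : 0 <= t <= 1 -> is_derive t 1 Y 0.
  move=> t01; have df := aF t t01.
  have dv : derivable (fun u => frame_torsion u x y) (t *: v) v.
    exact: diff_derivable.
  have dr := is_derive_ray dv.
  have dtt := is_derive_mulr (is_derive_id t (1 : R)) (is_derive_id t (1 : R)).
  apply: is_derive_eq (is_derive_scalemx dtt dr) _.
  apply: euler_degree_algebra; apply: etrans (esym (deriveZdir t v df)) _.
  by have [_] := frame_torsion_euler x y (Bt t t01).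
have cY : mx_continuous01 Y by move=> t t01; exact: is_derive_continuous (dY t t01).
have dY0 t : 0 < t < 1 -> is_derive t 1 Y 0.
  by move=> /andP[t0 t1]; apply: dY; rewrite !ltW.
have Y0 : Y 0 = 0 by rewrite /Y mulr0 scale0r.
have i1 : 0 <= (1 : R) <= 1 by rewrite ler01 lexx.
by have := derive0_zero cY dY0 Y0 i1; rewrite /Y mulr1 !scale1r.
Qed.

Lemma om_zero w : om 0 w = 0.
Proof.
have [B0 _] := sB; have := om_euler w B0.
by rewrite derive0 add0r (linf0 (S_linearl hS _ B0)).
Qed.

(** As Th fixes radial vectors and S is alternating, t * om (t v) v has derivative
    S (t v, v) = 0. *)
Lemma om_radial v t : B v -> 0 <= t <= 1 -> om (t *: v) v = 0.
Proof.
move: v t; have diag u : B u -> om u u = 0.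
  move: u => v Bv; pose Y (s : R) : 'M[R]_n := s *: om (s *: v) v.
  have Bt (s : R) : 0 <= s <= 1 -> B (s *: v) by exact: in_ray.
  have dY (s : R) : 0 <= s <= 1 -> is_derive s 1 Y (S (s *: v) (s *: v) (Th (s *: v) *m v)).
    move=> s01; have ao := aom v (Bt s s01).
    apply: is_derive_eq (is_derive_scalet (ray_is_derive ao)) _.
    rewrite -(om_euler _ (Bt s s01)) addrC; congr (_ + _).
    exact/esym/deriveZdir/anam_differentiable.
  have dY0 (s : R) : 0 < s < 1 -> is_derive s 1 Y 0.
    move=> /andP[s0 s1]; have s01 : 0 <= s <= 1 by rewrite !ltW.
    apply: is_derive_eq (dY s s01) _.
    have sn0 : s != 0 by rewrite gt_eqF.
    have -> : Th (s *: v) *m v = v.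
      by apply: (scalerI sn0); rewrite scalemxAr radial//; exact: Bt.
    by rewrite (linfZ (S_linearl hS _ (Bt s s01))) (S_alt hS _ (Bt s s01)) scaler0.
  have cY : mx_continuous01 Y by move=> s s01; exact: is_derive_continuous (dY s s01).
  have Y0 : Y 0 = 0 by rewrite /Y scale0r.
  have i1 : 0 <= (1 : R) <= 1 by rewrite ler01 lexx.
  by have := derive0_zero cY dY0 Y0 i1; rewrite /Y !scale1r.
move=> v t Bv t01; have [->|tn0] := eqVneq t 0; first by rewrite scale0r om_zero.
have Bt : B (t *: v) by exact: in_ray.
by apply: (scalerI tn0); rewrite -(linfZ (lom Bt)) diag// scaler0.
Qed.

Lemma coframe_derive_radial v t : B v -> 0 <= t <= 1 -> 'D_v Th (t *: v) *m v = 0.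
Proof.
move=> Bv t01; have Bt : B (t *: v) by exact: in_ray.
(* At the origin, where the first integral cannot be divided by t, its derivative
   takes its place. *)
have [t0|tn0] := eqVneq t 0.
  rewrite t0 scale0r in Bt *.
  have := first_integral_derive v v Bt.
  rewrite derive0 mul0mx add0r mulmx0 add0r om_zero mul0mx -mulr2n.
  by move/eqP; rewrite -scaler_nat scaler_eq0 pnatr_eq0/= => /eqP.
have := first_integral v Bt; rewrite om_radial// mul0mx addr0.
have -> : Th (t *: v) *m v = v.
  by apply: (scalerI tn0); rewrite scalemxAr radial.
rewrite deriveZdir; last by apply: anam_differentiable; exact: aTh.
rewrite -[X in _ = X]add0r => /addIr/eqP.
by rewrite -scalemxAl scaler_eq0 (negbTE tn0)/= => /eqP.
Qed.

(** The connection form om in the frame dual to Th, transformed to the constant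
    frame. *)
Definition frame_chris v x : 'M[R]_n :=
  invmx (Th v) *m ('D_x Th v + om v x *m Th v).

Local Notation G := frame_chris.

Lemma frame_chrisE v x : B v -> Th v *m G v x = 'D_x Th v + om v x *m Th v.
Proof. by move=> Bv; rewrite mulmxA mulmxV ?uTh// mul1mx. Qed.

Lemma frame_chris_linear v : B v -> linear (G v).
Proof.
move=> Bv a x y; have dT := anam_differentiable (aTh Bv).
have dE : 'D_(a *: x + y) Th v = a *: 'D_x Th v + 'D_y Th v.
  by rewrite deriveDdir// deriveZdir.
rewrite /G dE (lom Bv) mulmxDl -scalemxAl addrACA -scalerDr mulmxDr.
by rewrite -scalemxAr.
Qed.

Lemma frame_chris_ana v x : B v -> anam v (fun u => G u x).
Proof.
move=> Bv; apply: anam_mulmx; first by apply: anam_invmx; [exact: aTh|exact: uTh].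
by apply: anamD; [apply: anam_derive; exact: aTh|apply: anam_mulmx; [exact: aom|exact: aTh]].
Qed.

Lemma frame_chris_sym v x y : B v -> G v x *m y = G v y *m x.
Proof.
move=> Bv; rewrite /G -!mulmxA; congr (_ *m _); rewrite !mulmxDl -!mulmxA.
apply/subr0_eq; rewrite opprD addrACA.
exact: frame_torsion_eq0.
Qed.

(** Cartan's second structure equation: in the frame dual to Th the curvature is
    the left-hand side of the consistency relation. *)
Lemma frame_chris_curvature v x y : B v ->
  Th v *m ('D_x (fun u => G u y) v - 'D_y (fun u => G u x) v
    + G v x *m G v y - G v y *m G v x) =
  S v (Th v *m x) (Th v *m y) *m Th v.
Proof.
move=> Bv; have aT := aTh Bv.
have dG a b : 'D_a Th v *m G v b + Th v *m 'D_a (fun u => G u b) v =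
    'D_a (fun u => 'D_b Th u) v + ('D_a (fun u => om u b) v *m Th v +
      om v b *m 'D_a Th v).
  have E : \forall u \near v, Th u *m G u b = 'D_b Th u + om u b *m Th u.
    by apply: filterS (near_open oB Bv) => u Bu; exact: frame_chrisE.
  have dl := is_derive_mulmx (anam_is_derive a aT) (anam_is_derive a (frame_chris_ana b Bv)).
  have dr := is_derive_addmx (anam_is_derive a (anam_derive b aT))
    (is_derive_mulmx (anam_is_derive a (aom b Bv)) (anam_is_derive a aT)).
  exact: is_derive_near_unique E dl dr.
have d2 := dG y x; rewrite -(anam_deriveC x y aT) in d2.
exact: curvature_algebra (dG x y) d2 (frame_chrisE x Bv) (frame_chrisE y Bv)
  (consistent x y Bv).
Qed.

End Structure.

(** * Uniqueness of the connection *)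

Section UniquenessAlgebra.
Context {R : realType} {n : nat}.
Notation M := 'M[R]_n.
Implicit Types (t : R).

(* Here N, N' are the radial Christoffel matrix and its derivative, W the
   parallel frame, A the curvature and J, J1 the Jacobi field with derivative. *)
Lemma jacobi_difference_algebra t (N W J J1 : M) :
  (- (N *m W)) *m J + W *m J1 - 1%:M =
  - N *m (W *m J - t *: 1%:M) + 1%:M *m (W *m J1 - 1%:M - t *: N).
Proof.
rewrite mul1mx mulmxBr !mulNmx -scalemxAr mulmx1 !mulmxA opprK.
apply/matrixP => i j; rewrite !mx_linE; ring.
Qed.

Lemma jacobi_difference_derive_algebra t (N N' W J J1 A Jop : M) :
  t *: A = t *: N' + (N + N) + t *: (N *m N) ->
  W *m (Jop *m J) = A *m (W *m J) ->
  (- (N *m W)) *m J1 + W *m (Jop *m J) - (N + t *: N') =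
  A *m (W *m J - t *: 1%:M) + (- N) *m (W *m J1 - 1%:M - t *: N).
Proof.
move=> E ->; rewrite !mulmxBr -!scalemxAr !mulmx1 E !mulNmx -!scalerN -!mulmxA.
apply/matrixP => i j; rewrite !mx_linE; ring.
Qed.

Lemma commutator_algebra t (d d' N W : M) :
  t *: d' + d + t *: (N *m d - d *m N) = 0 ->
  (d + t *: d') *m W + (t *: d) *m (- (N *m W)) = - N *m ((t *: d) *m W).
Proof.
move=> H; rewrite -!scalemxAl !mulmxN !mulmxDl -!scalemxAl !mulNmx -!scalemxAr.
have := congr1 (fun A => A *m W) H.
rewrite mul0mx !mulmxDl -!scalemxAl mulmxBl -!mulmxA => {}H.
apply/matrixP => i j; move: H => /matrixP/(_ i j).
rewrite !mx_linE [(0 : M) i j]mxE; lra.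
Qed.

End UniquenessAlgebra.

Section Uniqueness.
Context {R : realType} {n : nat}.
Notation V := 'cV[R]_n.
Notation M := 'M[R]_n.
Implicit Types (u v w x y z : V) (t s : R).

Lemma is_derive_rescale (W : R -> M) s t (dW : M) : is_derive (t * s) 1 W dW ->
  is_derive t 1 (fun r => W (r * s)) (s *: dW).
Proof.
move=> [dw <-]; have df : differentiable W (t * s) by exact/derivable1_diffP.
have dr : derivable W (t *: s) s by exact: diff_derivable.
apply: is_derive_eq (is_derive_ray dr) _.
by rewrite -[X in 'D_X W _](mulr1 s) !deriveE// -linearZ.
Qed.

Variables (D : set V) (oD : open D) (sD : star_shaped D).

Lemma smooth_is_derive p q (F : V -> 'M[R]_(p, q)) v x : smooth D F -> D v ->
  is_derive v x F ('D_x F v).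
Proof.
by move=> sF Dv; apply: derivableP; apply: diff_derivable; exact: smooth_differentiable.
Qed.

Lemma smooth_ray p q (F : V -> 'M[R]_(p, q)) v t : smooth D F -> D v ->
  0 <= t <= 1 -> is_derive t 1 (fun s : R => F (s *: v)) ('D_v F (t *: v)).
Proof.
move=> sF Dv t01; apply: is_derive_ray; apply: diff_derivable.
exact: smooth_differentiable sF (in_ray sD Dv t01).
Qed.

Lemma smooth_mulmx p q r (F : V -> 'M[R]_(p, q)) (G : V -> 'M[R]_(q, r)) :
  smooth D F -> smooth D G -> smooth D (fun u => F u *m G u).
Proof.
move=> sF sG; apply: smooth_mx => // i j; under eq_fun do rewrite mxE.
by apply: smooth_sum => // k; apply: smoothM => //; exact: smooth_entry.
Qed.

Lemma smooth_addmx p q (F G : V -> 'M[R]_(p, q)) :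
  smooth D F -> smooth D G -> smooth D (fun u => F u + G u).
Proof.
move=> sF sG; apply: smooth_mx => // i j; under eq_fun do rewrite mxE.
by apply: smoothD => //; exact: smooth_entry.
Qed.

Lemma smooth_oppmx p q (F : V -> 'M[R]_(p, q)) :
  smooth D F -> smooth D (fun u => - F u).
Proof.
move=> sF; apply: smooth_mx => // i j.
have -> : (fun u => (- F u) i j) = fun u => cst (- 1) u * F u i j.
  by apply/funext => u; rewrite mxE mulN1r.
by apply: smoothM => //; [exact: smooth_cst|exact: smooth_entry].
Qed.

Section Bilinear.
Variables (Gam : V -> V -> M).
Hypotheses (lG : forall v, D v -> linear (Gam v))
  (sG : forall x, smooth D (fun v => Gam v x)).

Lemma derive_linZ v w x t : D v ->
  'D_w (fun u => Gam u (t *: x)) v = t *: 'D_w (fun u => Gam u x) v.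
Proof.
move=> Dv.
have E : \forall u \near v, t *: Gam u x = Gam u (t *: x).
  by apply: filterS (near_open oD Dv) => u Du; rewrite (linfZ (lG Du)).
rewrite -(near_eq_derive w E).
have := is_derive_scalemx (is_derive_cst t v w) (smooth_is_derive w (sG x) Dv).
by case=> _ ->; rewrite scale0r add0r.
Qed.

Lemma is_derive_diag v w : D v ->
  is_derive v w (fun u => Gam u u) ('D_w (fun u => Gam u v) v + Gam v w).
Proof.
move=> Dv.
have E (z : V -> V) : \forall u \near v, \sum_i z u i 0 *: Gam u (delta_mx i 0) = Gam u (z u).
  by apply: filterS (near_open oD Dv) => u Du; rewrite -(linear_sum_delta _ (lG Du)).
apply: near_eq_is_derive (E id) _.
have d1 i := is_derive_scalemx (is_derive_coord v w i)
  (smooth_is_derive w (sG (delta_mx i 0)) Dv).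
have d2 i := is_derive_scalemx (is_derive_cst (v i 0) v w)
  (smooth_is_derive w (sG (delta_mx i 0)) Dv).
apply: is_derive_eq (is_derive_bigsum (index_enum 'I_n) d1) _.
rewrite big_split /= [RHS]addrC.
congr (_ + _); first by rewrite [RHS](linear_sum_delta _ (lG Dv)).
have [_ d2v] := is_derive_bigsum (index_enum 'I_n) d2.
apply: esym; apply: etrans (esym (near_eq_derive w (E (cst v)))) _.
apply: etrans d2v _; apply: eq_bigr => i _; rewrite scale0r; exact: add0r.
Qed.

End Bilinear.

End Uniqueness.

Section SingleConnection.
Context {R : realType} {n : nat}.
Notation V := 'cV[R]_n.
Notation M := 'M[R]_n.
Implicit Types (u v w x y z : V) (t s : R).
Variables (D : set V) (S : V -> V -> V -> M) (theta : V -> V -> V).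
Variables (Gam : V -> V -> M) (Rc : V -> V -> V -> M).

Local Notation Th := (coframe theta).

Definition parallel_frame v (W : R -> M) : Prop :=
  (forall t, 0 <= t <= 1 -> is_derive t 1 W (- (Gam (t *: v) v *m W t))) /\
  W 0 = 1%:M.

Hypotheses (oD : open D) (sD : star_shaped D)
  (lG : forall v, D v -> linear (Gam v))
  (sG : forall x, smooth D (fun v => Gam v x))
  (symG : forall v x y, D v -> Gam v x *m y = Gam v y *m x)
  (geo : forall v t, D v -> 0 <= t <= 1 -> Gam (t *: v) v *m v = 0)
  (RcE : forall v x y, D v ->
    Rc v x y = 'D_x (fun u => Gam u y) v - 'D_y (fun u => Gam u x) v
      + Gam v x *m Gam v y - Gam v y *m Gam v x)
  (frames : forall v, D v -> exists W, [/\ parallel_frame v W, W 1 \in unitmx &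
    forall x y, S v x y = act_inv (W 1) (Rc v) x y])
  (jacD : forall v t, D v -> 0 <= t <= 1 ->
    is_derive t 1 (jac theta v) (djac theta v t))
  (djacD : forall v t, D v -> 0 <= t <= 1 ->
    exists E : M, is_derive t 1 (djac theta v) E)
  (jacJ : forall v t, D v -> 0 < t < 1 ->
    is_derive t 1 (djac theta v) (jacobi_op S (t *: v) v *m jac theta v t))
  (opE : forall v x y, D v -> jacobi_op S v x *m y = S v x y *m x)
  (Th0 : Th 0 = 1%:M).

Let Dt v t : D v -> 0 <= t <= 1 -> D (t *: v).
Proof. exact: in_ray. Qed.

Let i1 : 0 <= (1 : R) <= 1.
Proof. by rewrite ler01 lexx. Qed.

Let GamD x v t : D v -> 0 <= t <= 1 ->
  is_derive t 1 (fun s => Gam (s *: v) x) ('D_v (fun u => Gam u x) (t *: v)).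
Proof. by move=> Dv t01; exact: (smooth_ray sD (sG x)). Qed.

Let GamC x v : D v -> mx_continuous01 (fun t => Gam (t *: v) x).
Proof. by move=> Dv t t01; exact: is_derive_continuous (GamD x Dv t01). Qed.

Let in01 t : 0 < t < 1 -> 0 <= t <= 1.
Proof. by move=> /andP[t0 t1]; rewrite !ltW. Qed.

Let oppC p q (F : R -> 'M[R]_(p, q)) : mx_continuous01 F -> mx_continuous01 (fun t => - F t).
Proof. by move=> cF t t01; apply: continuousN; exact: cF. Qed.

Lemma parallel_frame_unique v W1 W2 : D v -> parallel_frame v W1 ->
  parallel_frame v W2 -> forall t, 0 <= t <= 1 -> W1 t = W2 t.
Proof.
move=> Dv [d1 e1] [d2 e2] t t01; apply/subr0_eq; move: t t01.
pose Y t := W1 t - W2 t.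
have dY t : 0 <= t <= 1 -> is_derive t 1 Y (- Gam (t *: v) v *m Y t).
  move=> t01; apply: is_derive_eq (is_deriveB (d1 t t01) (d2 t t01)) _.
  by rewrite mulmxBr !mulNmx.
have cY : mx_continuous01 Y by move=> t t01; exact: is_derive_continuous (dY t t01).
have Y0 : Y 0 = 0 by rewrite /Y e1 e2 subrr.
have dY' t : 0 < t < 1 -> is_derive t 1 Y (- Gam (t *: v) v *m Y t).
  by move=> /in01; exact: dY.
have H := linear_ode_zero (oppC (GamC (x := v) Dv)) cY dY' Y0.
by move=> t t01; exact: H.
Qed.

Lemma parallel_frame_rescale v W s : D v -> 0 <= s <= 1 ->
  parallel_frame v W -> parallel_frame (s *: v) (fun t => W (t * s)).
Proof.
move=> Dv s01 [dW W0]; split; last by rewrite mul0r.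
move=> t t01.
have ts : 0 <= t * s <= 1.
  move: t01 s01 => /andP[t0 t1] /andP[s0 s1].
  by rewrite mulr_ge0//= mulr_ile1.
apply: is_derive_eq (is_derive_rescale (dW _ ts)) _.
have Dp := Dt Dv ts.
by rewrite scalerA (linfZ (lG Dp)) scalerN scalemxAl.
Qed.

(** The parallel frame along a ray, reparametrised, is the parallel frame along its
    initial segments; so it carries S to the curvature at every point of the ray. *)
Lemma frame_curvature v W s : D v -> parallel_frame v W -> 0 <= s <= 1 ->
  W s \in unitmx /\ forall x y, S (s *: v) x y = act_inv (W s) (Rc (s *: v)) x y.
Proof.
move=> Dv fW s01; have [W' [fW' uW' SW']] := frames (Dt Dv s01).
have := parallel_frame_unique (Dt Dv s01) (parallel_frame_rescale Dv s01 fW) fW' i1.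
by rewrite mul1r => ->.
Qed.

Lemma frame_radial v W t : D v -> parallel_frame v W -> 0 <= t <= 1 -> W t *m v = v.
Proof.
move=> Dv [dW W0] t01; apply/subr0_eq; move: t t01.
pose Y t := W t *m v - v.
have dY t : 0 <= t <= 1 -> is_derive t 1 Y (- Gam (t *: v) v *m Y t).
  move=> t01.
  apply: is_derive_eq (is_deriveB (is_derive_mulmx (dW t t01) (is_derive_cst v t 1)) (is_derive_cst v t 1)) _.
  by rewrite mulmx0 addr0 subr0 mulmxBr !mulNmx geo// oppr0 subr0 mulmxA.
have cY : mx_continuous01 Y by move=> t t01; exact: is_derive_continuous (dY t t01).
have Y0 : Y 0 = 0 by rewrite /Y W0 mul1mx subrr.
have dY' t : 0 < t < 1 -> is_derive t 1 Y (- Gam (t *: v) v *m Y t).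
  by move=> /in01; exact: dY.
have H := linear_ode_zero (oppC (GamC (x := v) Dv)) cY dY' Y0.
by move=> t t01; exact: H.
Qed.

(** The radial Riccati equation: the curvature identity applied to the Euler
    field, using that radial lines are geodesics in every direction. *)
Lemma radial_riccati v t w : D v -> 0 < t -> t <= 1 ->
  t *: (Rc (t *: v) v w *m v) =
  t *: ('D_v (fun u => Gam u v) (t *: v) *m w) +
  (Gam (t *: v) v *m w + Gam (t *: v) v *m w) +
  t *: (Gam (t *: v) v *m (Gam (t *: v) v *m w)).
Proof.
move=> Dv t0 t1; have t01 : 0 <= t <= 1 by rewrite t1 ltW.
set p := t *: v; have Dp : D p by exact: Dt.
have near_D (P : V -> Prop) : (forall u, D u -> P u) -> \forall u \near p, P u.
  by move=> H; apply: filterS (near_open oD Dp) => u; exact: H.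
have A : 'D_v (fun u => Gam u w) p *m v = 'D_v (fun u => Gam u v) p *m w.
  have E := near_D _ (fun u Du => symG w v Du).
  have d1 := is_derive_mulmx (smooth_is_derive v (sG w) Dp) (is_derive_cst v p v).
  have d2 := is_derive_mulmx (smooth_is_derive v (sG v) Dp) (is_derive_cst w p v).
  by have := is_derive_near_unique E d1 d2; rewrite !mulmx0 !addr0.
have Bq : t *: ('D_w (fun u => Gam u v) p *m v) + (Gam p v *m w + Gam p v *m w) = 0.
  have E : \forall u \near p, Gam u u *m u = 0.
    by apply: near_D => u Du; have := geo Du i1; rewrite scale1r.
  have d1 := is_derive_mulmx (is_derive_diag oD lG sG w Dp) (is_derive_id p w).
  have := is_derive_near_unique E d1 (is_derive_cst (0 : V) p w).
  rewrite (derive_linZ oD lG sG w v t Dp) /= -/p {2 3}/p.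
  rewrite (linfZ (lG Dp)) -scalemxAr -scalemxAl -scalerDr => /eqP.
  rewrite scaler_eq0 gt_eqF//= => /eqP <-.
  by rewrite mulmxDl -scalemxAl (symG w v Dp) addrA.
move: Bq => /(canRL (addrK _)); rewrite sub0r => Bq.
rewrite RcE// !(mulmxDl, mulNmx) !scalerDr A scalerN Bq opprK -!mulmxA.
by rewrite (geo Dv t01) mulmx0 oppr0 scaler0 addr0 (symG w v Dp).
Qed.

(* The radial curvature operator y |-> R (v, y) v at the point t v. *)
Let Rm v t : M := \matrix_(i, j) (Rc (t *: v) v (delta_mx j 0) *m v) i 0.

Let RmE v t : D v -> 0 < t -> t <= 1 ->
  t *: Rm v t = t *: 'D_v (fun u => Gam u v) (t *: v) +
    (Gam (t *: v) v + Gam (t *: v) v) + t *: (Gam (t *: v) v *m Gam (t *: v) v).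
Proof.
move=> Dv t0 t1; apply/matrixP => i j.
have := radial_riccati (delta_mx j 0) Dv t0 t1.
rewrite mulmxA -!colE => /colP/(_ i).
by rewrite !mx_linE !mxE => <-.
Qed.

Let Rm_act v t y : D v -> 0 < t -> t <= 1 -> Rm v t *m y = Rc (t *: v) v y *m v.
Proof.
move=> Dv t0 t1; have tn0 : t != 0 by rewrite gt_eqF.
apply: (scalerI tn0); rewrite scalemxAl RmE// radial_riccati//.
by rewrite !mulmxDl -!scalemxAl !mulmxA.
Qed.

Let RmC v : D v -> mx_continuous01 (Rm v).
Proof.
move=> Dv; pose F (u : V) : M := \matrix_(i, j) (Rc u v (delta_mx j 0) *m v) i 0.
have sF : smooth D F.
  apply: smooth_mx => // i j; under eq_fun do rewrite mxE.
  apply: smooth_entry => //; apply: smooth_mulmx => //; last exact: smooth_cst.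
  set y := delta_mx j 0.
  apply: (eq_smooth oD (F := fun u => 'D_v (fun u => Gam u y) u
    + - 'D_y (fun u => Gam u v) u + Gam u v *m Gam u y + - (Gam u y *m Gam u v))).
    by move=> u Du; rewrite RcE.
  apply: smooth_addmx => //; last by apply: smooth_oppmx => //; exact: smooth_mulmx.
  apply: smooth_addmx => //; last exact: smooth_mulmx.
  apply: smooth_addmx => //; first exact: smooth_derive.
  by apply: smooth_oppmx => //; exact: smooth_derive.
move=> t t01; exact: is_derive_continuous (smooth_ray sD sF Dv t01).
Qed.

(** Both t * W t *m Th (t v) and t * id solve the Jacobi equation of the connection
    with the same initial data, so they agree; their covariant derivatives give the
    radial Christoffel matrix. *)
Lemma frame_coframe v W : D v -> parallel_frame v W ->
  W 1 *m Th v = 1%:M /\ Gam v v = W 1 *m (Th v + 'D_v Th v) - 1%:M.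
Proof.
move=> Dv fW; have [dW W0] := fW.
pose N t := Gam (t *: v) v.
pose Y t : M := W t *m jac theta v t - t *: 1%:M.
pose Z t : M := W t *m djac theta v t - 1%:M - t *: N t.
have d1 t : is_derive t 1 (fun=> 1%:M : M) (0 : M) := is_derive_cst _ t 1.
have dY t : 0 <= t <= 1 -> is_derive t 1 Y (- N t *m Y t + 1%:M *m Z t).
  move=> t01; have d := is_deriveB (is_derive_mulmx (dW t t01) (jacD Dv t01))
    (is_derive_scalet (d1 t)).
  apply: is_derive_eq d _; rewrite scaler0 addr0.
  exact: jacobi_difference_algebra.
have dZ t (E : M) : 0 <= t <= 1 -> is_derive t 1 (djac theta v) E ->
    is_derive t 1 Z ((- (N t *m W t)) *m djac theta v t + W t *m E
      - (N t + t *: 'D_v (fun u => Gam u v) (t *: v))).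
  move=> t01 dE; have dn := is_derive_scalet (GamD v Dv t01).
  have d := is_deriveB (is_deriveB (is_derive_mulmx (dW t t01) dE) (d1 t)) dn.
  by apply: is_derive_eq d _; rewrite subr0.
have dZ1 t : 0 < t < 1 -> is_derive t 1 Z (Rm v t *m Y t + (- N t) *m Z t).
  move=> /[dup] t01 /andP[t0 t1].
  apply: is_derive_eq (dZ t _ (in01 t01) (jacJ Dv t01)) _.
  apply: jacobi_difference_derive_algebra; first by apply: RmE => //; exact: ltW.
  have [uW SW] := frame_curvature Dv fW (in01 t01).
  apply: eq_mulmx => x; rewrite -!mulmxA (Rm_act _ Dv t0 (ltW t1)).
  rewrite (opE _ _ (Dt Dv (in01 t01))) SW /act_inv.
  have Wv := frame_radial Dv fW (in01 t01).
  by rewrite !mulmxA mulmxV// mul1mx Wv -mulmxA Wv.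
have cY : mx_continuous01 Y by move=> t t01; exact: is_derive_continuous (dY t t01).
have cZ : mx_continuous01 Z.
  move=> t t01; have [E dE] := djacD Dv t01.
  exact: is_derive_continuous (dZ t E t01 dE).
have Y0 : Y 0 = 0 by rewrite /Y /jac !scale0r mulmx0 subrr.
have Z0 : Z 0 = 0.
  by rewrite /Z /djac W0 !scale0r addr0 Th0 mulmx1 subrr subr0.
have cN := oppC (GamC (x := v) Dv).
have H := linear_system_zero cN (@mx_continuous01_cst R n n 1%:M) (RmC Dv) cN cY cZ
  (fun t h => dY t (in01 h)) dZ1 Y0 Z0 i1.
move: H; rewrite /Y /Z /N /jac /djac !scale1r => -[/subr0_eq H1 /subr0_eq H2].
by split=> //; rewrite -H2.
Qed.

(** The parallel frame at the end of the ray is the inverse of Th, by frame_coframe;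
    so theta and S determine the curvature and the radial part of the connection. *)
Lemma single_connection v : D v ->
  [/\ Th v \in unitmx, Gam v v = invmx (Th v) *m 'D_v Th v &
      forall x y, Rc v x y = invmx (Th v) *m S v (Th v *m x) (Th v *m y) *m Th v].
Proof.
move=> Dv; have [W [fW uW SW]] := frames Dv.
have [WT GW] := frame_coframe Dv fW.
have [_ uT] := mulmx1_unit WT.
have WE : W 1 = invmx (Th v).
  by rewrite -[W 1]mulmx1 -(mulmxV uT) mulmxA WT mul1mx.
split=> // [|x y].
  by rewrite GW mulmxDr WT addrAC subrr add0r WE.
rewrite SW /act_inv WE invmxK !mulmxA mulVmx// !mul1mx.
by rewrite -!mulmxA mulVmx// mulmx1.
Qed.

End SingleConnection.

Section TwoConnections.
Context {R : realType} {n : nat}.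
Notation V := 'cV[R]_n.
Notation M := 'M[R]_n.
Implicit Types (u v w x y z : V) (t s : R).
Variables (D : set V) (Gam1 Gam2 : V -> V -> M).
Hypotheses (oD : open D) (sD : star_shaped D)
  (l1 : forall v, D v -> linear (Gam1 v)) (l2 : forall v, D v -> linear (Gam2 v))
  (s1 : forall x, smooth D (fun v => Gam1 v x))
  (s2 : forall x, smooth D (fun v => Gam2 v x))
  (diag : forall v, D v -> Gam1 v v = Gam2 v v)
  (curv : forall v x y, D v ->
    'D_x (fun u => Gam1 u y) v - 'D_y (fun u => Gam1 u x) v
      + Gam1 v x *m Gam1 v y - Gam1 v y *m Gam1 v x =
    'D_x (fun u => Gam2 u y) v - 'D_y (fun u => Gam2 u x) v
      + Gam2 v x *m Gam2 v y - Gam2 v y *m Gam2 v x)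
  (frames : forall v, D v -> exists2 W, parallel_frame Gam1 v W & W 1 \in unitmx).

(* At the point p = t v the letters stand, for each connection, for the derivative
   a of Gam y along v, the derivative b of Gam v along y, the derivative c of
   Gam p along y, and for N = Gam v and g = Gam y. *)
Let difference_algebra t (a1 b1 c1 N g1 a2 b2 c2 N2 g2 : M) : N2 = N ->
  a1 - b1 + N *m g1 - g1 *m N = a2 - b2 + N2 *m g2 - g2 *m N2 ->
  c1 = t *: b1 -> c2 = t *: b2 -> c1 + g1 = c2 + g2 ->
  t *: (a1 - a2) + (g1 - g2) + t *: (N *m (g1 - g2) - (g1 - g2) *m N) = 0.
Proof.
move=> -> A -> -> B; rewrite mulmxBr mulmxBl.
move: (N *m g1) (N *m g2) (g1 *m N) (g2 *m N) A => p1 p2 q1 q2 A.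
have -> : a1 - a2 = b1 - p1 + q1 - b2 + p2 - q2.
  apply/matrixP => i j; move: A => /matrixP/(_ i j).
  by rewrite !mx_linE; lra.
apply/matrixP => i j; move: B => /matrixP/(_ i j).
rewrite !mx_linE [(0 : M) i j]mxE => B.
have -> : g1 i j = t * b2 i j + g2 i j - t * b1 i j by lra.
ring.
Qed.

(** Let H be the difference of the matrices of y. The derivative of the common
    radial part in the direction y expresses b1 - b2, in the notation of
    difference_algebra, by H; the common curvature then gives the equation
    D_E H + H + [Gam1 E, H] = 0. The parallel frame turns it into a linear
    equation for t * H along the ray. *)
Lemma two_connections v y : D v -> Gam1 v y = Gam2 v y.
Proof.
move=> Dv; have [W fW uW] := frames Dv; have [dW W0] := fW.
pose H u := Gam1 u y - Gam2 u y.
have Dt t : 0 <= t <= 1 -> D (t *: v) by exact: in_ray.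
have dH t : 0 <= t <= 1 -> is_derive t 1 (fun s => H (s *: v))
    ('D_v (fun u => Gam1 u y) (t *: v) - 'D_v (fun u => Gam2 u y) (t *: v)).
  move=> t01.
  exact: is_deriveB (smooth_ray sD (s1 y) Dv t01) (smooth_ray sD (s2 y) Dv t01).
pose Y t : M := (t *: H (t *: v)) *m W t.
have dY t : 0 <= t <= 1 -> is_derive t 1 Y _ :=
  fun t01 => is_derive_mulmx (is_derive_scalet (dH t t01)) (dW t t01).
have dY1 t : 0 < t < 1 -> is_derive t 1 Y (- Gam1 (t *: v) v *m Y t).
  move=> /andP[t0 t1]; have t01 : 0 <= t <= 1 by rewrite !ltW.
  apply: is_derive_eq (dY t t01) _; apply: commutator_algebra.
  have Dp := Dt t t01; have tn0 : t != 0 by rewrite gt_eqF.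
  have NN : Gam2 (t *: v) v = Gam1 (t *: v) v.
    by apply: (scalerI tn0); rewrite -(linfZ (l1 Dp)) -(linfZ (l2 Dp)) diag.
  have E : \forall u \near t *: v, Gam1 u u = Gam2 u u.
    by apply: filterS (near_open oD Dp) => u; exact: diag.
  exact: difference_algebra NN (curv v y Dp) (derive_linZ oD l1 s1 y v t Dp)
    (derive_linZ oD l2 s2 y v t Dp) (is_derive_near_unique E
      (is_derive_diag oD l1 s1 y Dp) (is_derive_diag oD l2 s2 y Dp)).
have cY : mx_continuous01 Y by move=> t t01; exact: is_derive_continuous (dY t t01).
have cN : mx_continuous01 (fun t => - Gam1 (t *: v) v).
  move=> t t01; apply: continuousN.
  exact: is_derive_continuous (smooth_ray sD (s1 v) Dv t01).
have Y0 : Y 0 = 0 by rewrite /Y scale0r mul0mx.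
have i1 : 0 <= (1 : R) <= 1 by rewrite ler01 lexx.
have := linear_ode_zero cN cY dY1 Y0 i1; rewrite /Y !scale1r => HW.
apply/subr0_eq; rewrite -/(H v) -[H v]mulmx1 -(mulmxV uW) mulmxA HW.
exact: mul0mx.
Qed.

End TwoConnections.

(** * Existence and uniqueness of the prescribed connection *)

Section Prescribed.
Context {R : realType} {n : nat}.
Notation V := 'cV[R]_n.
Notation M := 'M[R]_n.
Implicit Types (u v w x y z : V) (t s : R).
Variables (D : set V) (S : V -> V -> V -> M).
Hypotheses (oD : open D) (sD : star_shaped D).

(** The columns of the frame are the parallel fields that start at the basis
    vectors. *)
Lemma prescribed_frame nabla v : connection D nabla ->
  radially_prescribed D S nabla -> D v ->
  exists W, [/\ parallel_frame (chris nabla) v W, W 1 \in unitmx &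
    forall x y, S v x y = act_inv (W 1) (curvature_at nabla v) x y].
Proof.
move=> cn rp Dv; have [_ [P [PT uP SP]]] := rp v Dv.
have /choice[W0 HW] := fun j : 'I_n => PT (delta_mx j 0).
pose W t : M := \matrix_(i, j) W0 j t i 0.
have W1 : W 1 = P.
  by apply/matrixP => i j; rewrite mxE; have [_ _ ->] := HW j; rewrite -colE mxE.
exists W; rewrite W1; split=> // [|x y]; last first.
  by rewrite SP /radial_curve scale1r.
split; last first.
  apply/matrixP => i j; rewrite mxE; have [_ -> _] := HW j.
  by rewrite !mxE eqxx andbT eq_sym.
move=> t t01; apply: is_derive_mx => i j.
have -> : (fun u : R => W u i j) = fun u : R => W0 j u i 0.
  by apply/funext => u; rewrite mxE.
have [/(parallel_radialP oD cn _ sD Dv) pW _ _] := HW j.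
apply: is_derive_eq (@is_derive_entry _ _ _ _ _ _ _ _ i 0 (pW t t01)) _.
rewrite [LHS]mxE [RHS]mxE; congr (- _); rewrite [LHS]mxE [RHS]mxE.
by apply: eq_bigr => k _; rewrite [W t _ _]mxE.
Qed.

Lemma prescribed_geodesic nabla v t : connection D nabla ->
  radially_prescribed D S nabla -> D v -> 0 <= t <= 1 ->
  chris nabla (t *: v) v *m v = 0.
Proof.
move=> cn rp Dv t01; have [gv _] := rp v Dv.
exact: (geodesic_radialP oD cn sD Dv).1.
Qed.

Section FromFrame.
Variables (Th : V -> M) (om : V -> V -> M) (B : set V).
Hypotheses (DB : D `<=` B) (oB : open B) (sB : star_shaped B)
  (hS : forall v, B v -> curvature_tensors (S v))
  (aTh : forall v, B v -> anam v Th)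
  (uTh : forall v, B v -> Th v \in unitmx)
  (Th0 : Th 0 = 1%:M)
  (aom : forall v w, B v -> anam v (fun u => om u w))
  (lom : forall v, B v -> linear (om v))
  (om_euler : forall v w, B v ->
    'D_v (fun u => om u w) v + om v w = S v v (Th v *m w))
  (first_integral : forall v w, B v ->
    'D_v Th v *m w + Th v *m w = w + om v w *m v)
  (consistent : forall v x y, B v ->
    ext_d om v x y + wedge_sq om v x y = S v (Th v *m x) (Th v *m y))
  (radial : forall v, B v -> Th v *m v = v).

Local Notation G := (frame_chris Th om).

Definition frame_connection : (V -> V) -> (V -> V) -> V -> V := connection_of G.

Local Notation nabla := frame_connection.

Let lG v : D v -> linear (G v).
Proof. by move=> /DB Bv; exact: (frame_chris_linear aTh lom Bv). Qed.

Let aG x v : D v -> anam v (fun u => G u x).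
Proof. by move=> /DB Bv; exact: (frame_chris_ana aTh uTh aom x Bv). Qed.

Let chrisE : chris nabla = G.
Proof. by apply/funext => v; apply/funext => x; exact: chris_connection_of. Qed.

Lemma frame_connection_connection : connection D nabla.
Proof.
apply: connection_of_connection => // x; apply: smooth_mx => // i j.
by apply: ana_smooth => // a Da; exact: aG.
Qed.

Lemma frame_connection_real_analytic : real_analytic_connection D nabla.
Proof. by apply: connection_of_real_analytic => // x i j a Da; exact: aG. Qed.

Lemma frame_connection_torsion_free : torsion_free D nabla.
Proof.
apply: connection_of_torsion_free => v x y /DB Bv.
exact: (frame_chris_sym oB sB hS aTh aom om_euler first_integral consistent).
Qed.

(* As om vanishes on radial vectors, the derivative of Th^-1 along the ray is
   - G v Th^-1: the frame dual to Th is parallel. *)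
Let G_radial v t : D v -> 0 <= t <= 1 ->
  G (t *: v) v = invmx (Th (t *: v)) *m 'D_v Th (t *: v).
Proof.
move=> /DB Bv t01; rewrite /G (om_radial sB hS aom lom om_euler radial)//.
by rewrite mul0mx addr0.
Qed.

Let inverse_is_derive v t : D v -> 0 <= t <= 1 ->
  is_derive t 1 (fun s => invmx (Th (s *: v)))
    (- (G (t *: v) v *m invmx (Th (t *: v)))).
Proof.
move=> Dv t01; have Bt : B (t *: v) by apply: DB; exact: in_ray.
have aT := aTh Bt; have uT := uTh Bt.
have aI := anam_invmx aT uT.
have E : \forall u \near t *: v, Th u *m invmx (Th u) = 1%:M.
  by apply: filterS (near_open oB Bt) => u Bu; rewrite mulmxV ?uTh.
have dp := is_derive_mulmx (anam_is_derive v aT) (anam_is_derive v aI).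
have := is_derive_near_unique E dp (is_derive_cst (1%:M : M) _ v).
rewrite addrC => /eqP; rewrite addr_eq0 => /eqP H.
apply: is_derive_eq (ray_is_derive aI) _.
rewrite G_radial// -!mulmxA -mulmxN -H mulmxA mulVmx//.
by rewrite mul1mx.
Qed.

Lemma frame_connection_prescribed : radially_prescribed D S nabla.
Proof.
have cn := frame_connection_connection.
move=> v Dv; have Bv := DB Dv; split.
  apply/(geodesic_radialP oD cn sD Dv) => t t01; rewrite chrisE G_radial// -mulmxA.
  by rewrite (coframe_derive_radial oB sB hS aTh aom lom om_euler first_integral radial)// mulmx0.
exists (invmx (Th v)); split; last 2 first.
- by rewrite unitmx_inv uTh.
- move=> x y; rewrite /radial_curve scale1r /act_inv (curvature_chris oD cn)//.
  have -> : (fun u => chris nabla u (invmx (Th v) *m y)) = (fun u => G u (invmx (Th v) *m y)).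
    by rewrite chrisE.
  have -> : (fun u => chris nabla u (invmx (Th v) *m x)) = (fun u => G u (invmx (Th v) *m x)).
    by rewrite chrisE.
  rewrite chrisE invmxK.
  rewrite (frame_chris_curvature oB aTh uTh aom consistent)//.
  by rewrite !mulmxA mulmxV ?uTh// !mul1mx -mulmxA mulmxV ?uTh// mulmx1.
move=> w; exists (fun t => invmx (Th (t *: v)) *m w); split.
- apply/(parallel_radialP oD cn _ sD Dv) => t t01.
  have d := is_derive_mulmx (inverse_is_derive Dv t01) (is_derive_cst w t 1).
  by apply: is_derive_eq d _; rewrite chrisE mulmx0 addr0 mulNmx mulmxA.
- by rewrite scale0r Th0 invmx1 mul1mx.
- by rewrite scale1r.
Qed.

End FromFrame.

Section Compare.
Variables (theta : V -> V -> V).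
Local Notation Th := (coframe theta).
Hypotheses
  (jacD : forall v t, D v -> 0 <= t <= 1 ->
    is_derive t 1 (jac theta v) (djac theta v t))
  (djacD : forall v t, D v -> 0 <= t <= 1 ->
    exists E : M, is_derive t 1 (djac theta v) E)
  (jacJ : forall v t, D v -> 0 < t < 1 ->
    is_derive t 1 (djac theta v) (jacobi_op S (t *: v) v *m jac theta v t))
  (opE : forall v x y, D v -> jacobi_op S v x *m y = S v x y *m x)
  (Th0 : Th 0 = 1%:M).

Let single nabla : connection D nabla -> torsion_free D nabla ->
  radially_prescribed D S nabla -> forall v, D v ->
  chris nabla v v = invmx (Th v) *m 'D_v Th v /\
  forall x y, curvature_at nabla v x y =
    invmx (Th v) *m S v (Th v *m x) (Th v *m y) *m Th v.
Proof.
move=> cn tf rp v Dv.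
have [] // := @single_connection R n D S theta (chris nabla) (curvature_at nabla)
  oD sD _ _ _ _ _ _ jacD djacD jacJ opE Th0 v Dv.
- by move=> u Du; exact: (chris_linear oD cn Du).
- by move=> x; exact: (chris_smooth oD cn).
- by move=> u x y Du; exact: (torsion_free_chris oD cn tf).
- by move=> u t Du t01; exact: (prescribed_geodesic cn rp).
- by move=> u x y Du; exact: (curvature_chris oD cn).
- by move=> u Du; exact: (prescribed_frame cn rp).
Qed.

(** By single_connection both connections have the radial part and the curvature
    that theta and S determine, and two_connections compares them. *)
Lemma prescribed_unique nabla nabla' :
  connection D nabla -> torsion_free D nabla -> radially_prescribed D S nabla ->
  connection D nabla' -> torsion_free D nabla' -> radially_prescribed D S nabla' ->
  forall X Y, smooth D X -> smooth D Y ->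
  forall v, D v -> nabla' X Y v = nabla X Y v.
Proof.
move=> cn tf rp cn' tf' rp' X Y sX sY v Dv.
rewrite (connection_chris oD cn)// (connection_chris oD cn')//.
congr (_ + _ *m _).
have H1 := single cn tf rp; have H2 := single cn' tf' rp'.
apply: (two_connections oD sD) => //.
- by move=> u Du; exact: (chris_linear oD cn' Du).
- by move=> u Du; exact: (chris_linear oD cn Du).
- by move=> x; exact: (chris_smooth oD cn').
- by move=> x; exact: (chris_smooth oD cn).
- by move=> u Du; rewrite (H1 u Du).1 (H2 u Du).1.
- move=> u x y Du; apply: etrans (esym (curvature_chris oD cn' x y Du)) _.
  apply: etrans _ (curvature_chris oD cn x y Du).
  by rewrite (H1 u Du).2 (H2 u Du).2.
- move=> u Du; have [W [fW uW _]] := prescribed_frame cn' rp' Du.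
  by exists W.
Qed.

End Compare.

End Prescribed.

Unset Implicit Arguments.

Theorem theorem1 (R : realType) (n : nat) (U : set 'cV[R]_n)
    (S : 'cV[R]_n -> 'cV[R]_n -> 'cV[R]_n -> 'M[R]_n)
    (theta : 'cV[R]_n -> 'cV[R]_n -> 'cV[R]_n) :
  open U -> star_shaped U ->
  (forall v, U v -> curvature_tensors (S v)) ->
  (forall x y, real_analytic U (fun v => S v x y)) ->
  one_form U theta -> real_analytic_form U theta ->
  (forall v, U v -> forall w,
     lie_euler (fun u z => lie_euler theta u z - theta u z) v w =
     S_euler S theta v w *m v) ->
  (forall w, theta 0 w = w) ->
  (forall x y, ext_d theta 0 x y = 0) ->
  (let omega := integration_map (S_euler S theta) in
   forall v, U v -> forall x y,
     ext_d omega v x y + wedge_sq omega v x y = S v (theta v x) (theta v y)) ->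
  exists U0 : set 'cV[R]_n,
    [/\ open U0, star_shaped U0, U0 `<=` U &
      forall U' : set 'cV[R]_n, open U' -> star_shaped U' -> U' `<=` U0 ->
        exists nabla : ('cV[R]_n -> 'cV[R]_n) -> ('cV[R]_n -> 'cV[R]_n) ->
                       'cV[R]_n -> 'cV[R]_n,
          [/\ connection U' nabla, real_analytic_connection U' nabla,
              torsion_free U' nabla & radially_prescribed U' S nabla] /\
          forall nabla',
            [/\ connection U' nabla', real_analytic_connection U' nabla',
                torsion_free U' nabla' & radially_prescribed U' S nabla'] ->
            forall X Y, smooth U' X -> smooth U' Y ->
              forall v, U' v -> nabla' X Y v = nabla X Y v].
Proof.
move=> oU sU hS aS ltheta atheta ode theta0 _ consist.
have [r [c [r0 rU rT Hc]]] := exists_common_ball oU sU hS aS ltheta atheta theta0.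
pose U0 := [set v : 'cV[R]_n | `|v| < r].
have oU0 : open U0.
  move=> v /= vr; have e0 : 0 < r - `|v| by rewrite subr_gt0.
  apply: (near_of_ball e0) => h hr; apply: le_lt_trans (ler_normD _ _) _.
  by rewrite -ltrBrDl.
have sU0 : star_shaped U0.
  split=> [|v t vr /andP[t0 t1]]; first by rewrite /U0/= normr0.
  apply: le_lt_trans vr; rewrite normrZ ger0_norm// ler_piMl//.
exists U0; split=> // D oD sD DU0.
have DU v : D v -> U v by move=> /DU0; exact: rU.
pose Th := coframe theta; pose om := conn_form S theta.
have hS0 v : U0 v -> curvature_tensors (S v) by move=> /rU; exact: hS.
have aTh v : U0 v -> anam v Th by move=> /rU; exact: coframe_ana.
have aom v w : U0 v -> anam v (fun u => om u w).
  exact: (conn_form_ana hS ltheta r0 rU Hc).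
have lom v : U0 v -> linear (om v) by exact: (conn_form_linear hS ltheta r0 rU Hc).
have eom v w : U0 v -> 'D_v (fun u => om u w) v + om v w = S v v (Th v *m w).
  exact: (conn_form_euler hS ltheta r0 rU Hc).
have fi v w : U0 v -> 'D_v Th v *m w + Th v *m w = w + om v w *m v.
  exact: (coframe_first_integral oU sU hS ltheta atheta ode theta0 r0 rU Hc).
have cons v x y : U0 v ->
    ext_d om v x y + wedge_sq om v x y = S v (Th v *m x) (Th v *m y).
  by move=> /rU Uv; rewrite -!(coframeE ltheta)//; exact: consist.
have rad v : U0 v -> Th v *m v = v.
  by move=> /rU; exact: (coframe_radial oU sU hS aS ltheta atheta ode theta0).
have Th0 : Th 0 = 1%:M := coframe0 sU ltheta theta0.
have cn := frame_connection_connection oD DU0 aTh rT aom lom.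
have tf := frame_connection_torsion_free DU0 oU0 sU0 hS0 aTh aom eom fi cons.
have rp := frame_connection_prescribed oD sD DU0 oU0 sU0 hS0 aTh rT Th0 aom lom eom fi cons rad.
exists (frame_connection Th om); split.
  by split=> //; exact: (frame_connection_real_analytic oD DU0 aTh rT aom lom).
move=> nabla' [cn' _ tf' rp'].
apply: (prescribed_unique oD sD) cn tf rp cn' tf' rp'.
- by move=> v t /DU; exact: (jac_is_derive sU atheta).
- by move=> v t /DU; exact: (djac_derivable sU atheta).
- by move=> v t /DU; exact: (djac_is_derive oU sU hS ltheta atheta ode).
- by move=> v x y /DU; exact: jacobi_opE.
- exact: Th0.
Qed.
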